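(* Suppose the sequence of grids satisfies $h_n\to0$ and $\max_{x\in\mathbb S_n^-}\delta^+x\,/\,\min_{x\in\mathbb S_n^-}\delta^+x\le C_0$ for all $n$, with $C_0$ independent of $n$. For either scheme, there exist a sufficiently small $\delta_0>0$ and a constant $C>0$ independent of $k$ and $n$ such that, whenever $h_n\in(0,\delta_0)$, for every integer $1\le k\le h_n^{-1/5}$, $$\max_{x\in\mathbb S_n^-}|\varphi_k^n(x)-\varphi_k(x)|\le Ck^4h_n^\gamma,$$ where $\gamma=1$ for Scheme 1 and $\gamma=2$ for Scheme 2.
   Context: Let $-\infty<l<r<\infty$, $\rho\in(0,\infty)$, $\mu\in C^3([l,r])$, $\sigma^2\in C^4([l,r])$ with $\sigma^2>0$, and $\kappa\in C^2([l,r])$ with $\kappa\ge0$. It is also assumed that the reflected SDE $dX_t=\mu(X_t)I(X_t>l)dt+\sigma(X_t)I(X_t>l)dB_t+\frac12dL^l_t(X)$, $I(X_t=l)dt=0$ has a unique weak solution ($L^l$ is the right local time at $l$). Continuous problem. Let $s(x)=\exp(-\int_l^x\frac{2\mu(y)}{\sigma^2(y)}dy)$, $m(x)=\frac2{\sigma^2(x)s(x)}$, $M(dx)=m(x)dx+\frac1\rho\delta_l(dx)$. Let $(\lambda_k,\varphi_k)$, $k\ge1$, $\lambda_1<\lambda_2<\cdots$, be the eigenpairs of $\mu\varphi'+\frac12\sigma^2\varphi''-\kappa\varphi=-\lambda\varphi$ on $(l,r)$, $\rho\varphi'(l)-(\kappa(l)-\lambda)\varphi(l)=0$, $\varphi(r)=0$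 (spectrum purely discrete and simple), normalized by $\int\varphi_i\varphi_j\,dM=\delta_{ij}$. Grid. $\mathbb S_n=\{x_0<x_1<\dots<x_{n+1}\}$, $x_0=l$, $x_{n+1}=r$, $\mathbb S_n^\circ=\{x_1,\dots,x_n\}$, $\mathbb S_n^-=\{x_0,\dots,x_n\}$. For $x=x_i$, $x^\pm=x_{i\pm1}$, $\delta^+x=x^+-x$, $\delta^-x=x-x^-$, $\delta x=\frac12(\delta^+x+\delta^-x)$, $h_n=\max_{x\in\mathbb S_n^-}\delta^+x$. Put $\nabla^+g(x)=\frac{g(x^+)-g(x)}{\delta^+x}$, $\nabla^-g(x)=\frac{g(x)-g(x^-)}{\delta^-x}$, $\nabla g(x)=\frac{\delta^-x}{2\delta x}\nabla^+g(x)+\frac{\delta^+x}{2\delta x}\nabla^-g(x)$, $\Delta g(x)=\frac1{\delta x}(\nabla^+g(x)-\nabla^-g(x))$. Discrete problem. For $g:\mathbb S_n\to\mathbb R$, $G_ng(x)=\mu(x)\nabla g(x)+\frac12\sigma^2(x)\Delta g(x)-\kappa(x)g(x)$ for $x\in\mathbb S_n^\circ$, and $G_ng(x_0)=\rho\beta\nabla^+g(x_0)-\kappa(x_0)g(x_0)$, with $\beta=1$, $\alpha=\mu(x_0)$ in Scheme 1, and $\beta=\bigl(1+\frac{\rho-\mu(x_0)}{\sigma^2(x_0)}\delta^+x_0\bigr)^{-1}$, $\alpha=\rho$ in Scheme 2. Define $M_n(x_0)=\frac1\rho\exp\bigl(\frac{\alpha}{\sigma^2(x_0)}\delta^+x_0\bigr)$,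 and for $x\in\mathbb S_n^\circ$, $m_n(x)=M_n(x_0)\,\beta\,\frac{2\rho}{-\mu(x_1)\delta^+x_1+\sigma^2(x_1)}\prod_{y=x_1}^{x^-}\frac{\mu(y)\delta^-y+\sigma^2(y)}{-\mu(y^+)\delta^+y^++\sigma^2(y^+)}$ (product over grid points $y$ from $x_1$ to $x^-$, equal to $1$ if $x=x_1$), $M_n(x)=m_n(x)\delta x$. Let $(\lambda_k^n,\varphi_k^n)$, $1\le k\le n+1$, $\lambda_1^n<\lambda_2^n<\cdots$, be the eigenpairs of $G_n\varphi(x)=-\lambda\varphi(x)$ for $x=x_0,\dots,x_n$, $\varphi(x_{n+1})=0$, normalized by $\sum_{x\in\mathbb S_n^-}\varphi_j^n(x)\varphi_k^n(x)M_n(x)=\delta_{jk}$, with the sign of $\varphi_k^n$ chosen so that $\varphi_k^n(x_n)\varphi_k(x_n)\ge0$. *)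

(* Defs.v *)
From Stdlib Require Import Reals List.
From Stdlib Require Export RList.
From Coquelicot Require Import Coquelicot.
Open Scope R_scope.

Definition segment (l r x : R) : Prop := l <= x <= r.

(* C^k(D): derivatives are taken within D, so they are one-sided at the ends of
   D = [l,r], and values outside D are irrelevant. *)
Fixpoint C_on (k : nat) (D : R -> Prop) (f : R -> R) : Prop :=
  match k with
  | O => forall x, D x -> continue_in f D x
  | S k' => exists df, (forall x, D x -> D_in f df D x) /\ C_on k' D df
  end.

Section Continuous.

Variables (l r rho : R) (mu sigma kappa : R -> R).

Definition scale_density (x : R) : R :=
  exp (- RInt (fun y => 2 * mu y / sigma y ^ 2) l x).

Definition speed_density (x : R) : R := 2 / (sigma x ^ 2 * scale_density x).

(* Integral over [l,r] against M(dx) = m(x) dx + (1/rho) delta_l(dx). *)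
Definition speed_integral (f : R -> R) : R :=
  RInt (fun x => f x * speed_density x) l r + f l / rho.

Definition eigenpair (lam : R) (phi : R -> R) : Prop :=
  (exists x, segment l r x /\ phi x <> 0) /\
  exists dphi ddphi : R -> R,
    (forall x, segment l r x -> D_in phi dphi (segment l r) x) /\
    (forall x, segment l r x -> D_in dphi ddphi (segment l r) x) /\
    (forall x, segment l r x -> continue_in ddphi (segment l r) x) /\
    (forall x, l < x < r ->
       mu x * dphi x + / 2 * sigma x ^ 2 * ddphi x - kappa x * phi x
       = - lam * phi x) /\
    rho * dphi l - (kappa l - lam) * phi l = 0 /\
    phi r = 0.

(* Only the indices k >= 1 are meaningful. The third clause says that the list
   is complete and that every eigenvalue is simple. *)
Definition eigensystem (lam : nat -> R) (phi : nat -> R -> R) : Prop :=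
  (forall k, (1 <= k)%nat -> eigenpair (lam k) (phi k)) /\
  (forall j k, (1 <= j < k)%nat -> lam j < lam k) /\
  (forall lam' psi, eigenpair lam' psi ->
     exists k c, (1 <= k)%nat /\ lam' = lam k /\
       forall x, segment l r x -> psi x = c * phi k x) /\
  (forall j k, (1 <= j)%nat -> (1 <= k)%nat ->
     speed_integral (fun x => phi j x * phi k x)
     = if Nat.eq_dec j k then 1 else 0).

End Continuous.

(* A grid x_0 < ... < x_{n+1} is given by i |-> x i, of which only the values at
   i <= n+1 matter; a function g on the grid is given by i |-> g(x_i). *)
Definition is_grid (l r : R) (n : nat) (x : nat -> R) : Prop :=
  x 0%nat = l /\ x (S n) = r /\ forall i, (i <= n)%nat -> x i < x (S i).

Inductive scheme := Scheme1 | Scheme2.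

Definition scheme_order (sch : scheme) : nat :=
  match sch with Scheme1 => 1%nat | Scheme2 => 2%nat end.

Section Grid.

Variable x : nat -> R.

Definition step_plus (i : nat) : R := x (S i) - x i.
Definition step_minus (i : nat) : R := x i - x (pred i).
Definition step (i : nat) : R := / 2 * (step_plus i + step_minus i).

Definition max_step (n : nat) : R := MaxRlist (map step_plus (seq 0 (S n))).
Definition min_step (n : nat) : R := MinRlist (map step_plus (seq 0 (S n))).

Definition nabla_plus (g : nat -> R) (i : nat) : R :=
  (g (S i) - g i) / step_plus i.
Definition nabla_minus (g : nat -> R) (i : nat) : R :=
  (g i - g (pred i)) / step_minus i.
Definition nabla (g : nat -> R) (i : nat) : R :=
  step_minus i / (2 * step i) * nabla_plus g i
  + step_plus i / (2 * step i) * nabla_minus g i.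
Definition laplacian (g : nat -> R) (i : nat) : R :=
  / step i * (nabla_plus g i - nabla_minus g i).

Variables (sch : scheme) (rho : R) (mu sigma kappa : R -> R).

Definition beta : R :=
  match sch with
  | Scheme1 => 1
  | Scheme2 =>
      / (1 + (rho - mu (x 0%nat)) / sigma (x 0%nat) ^ 2 * step_plus 0)
  end.

Definition alpha : R :=
  match sch with Scheme1 => mu (x 0%nat) | Scheme2 => rho end.

Definition generator (g : nat -> R) (i : nat) : R :=
  match i with
  | O => rho * beta * nabla_plus g 0 - kappa (x 0%nat) * g 0%nat
  | S _ => mu (x i) * nabla g i + / 2 * sigma (x i) ^ 2 * laplacian g i
           - kappa (x i) * g i
  end.

Definition speed_left : R :=
  / rho * exp (alpha / sigma (x 0%nat) ^ 2 * step_plus 0).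

(* m_n(x_i) for i >= 1; the product runs over y = x_1, ..., x_{i-1}. *)
Definition discrete_density (i : nat) : R :=
  speed_left * beta
  * (2 * rho / (- mu (x 1%nat) * step_plus 1 + sigma (x 1%nat) ^ 2))
  * fold_right Rmult 1
      (map (fun j => (mu (x j) * step_minus j + sigma (x j) ^ 2)
                     / (- mu (x (S j)) * step_plus (S j) + sigma (x (S j)) ^ 2))
           (seq 1 (i - 1))).

Definition discrete_speed (i : nat) : R :=
  match i with
  | O => speed_left
  | S _ => discrete_density i * step i
  end.

Definition discrete_eigenpair (n : nat) (lam : R) (g : nat -> R) : Prop :=
  (exists i, (i <= n)%nat /\ g i <> 0) /\
  (forall i, (i <= n)%nat -> generator g i = - lam * g i) /\
  g (S n) = 0.

(* Only the indices 1 <= k <= n+1 are meaningful. *)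
Definition discrete_eigensystem (n : nat) (phi : nat -> R -> R)
    (lamn : nat -> R) (phin : nat -> nat -> R) : Prop :=
  (forall k, (1 <= k <= S n)%nat -> discrete_eigenpair n (lamn k) (phin k)) /\
  (forall j k, (1 <= j)%nat -> (j < k)%nat -> (k <= S n)%nat ->
     lamn j < lamn k) /\
  (forall j k, (1 <= j <= S n)%nat -> (1 <= k <= S n)%nat ->
     sum_f_R0 (fun i => phin j i * phin k i * discrete_speed i) n
     = if Nat.eq_dec j k then 1 else 0) /\
  (forall k, (1 <= k <= S n)%nat -> 0 <= phin k n * phi k (x n)).

Definition grid_error (n : nat) (phin : nat -> R) (phi : R -> R) : R :=
  MaxRlist (map (fun i => Rabs (phin i - phi (x i))) (seq 0 (S n))).

End Grid.

(* Main.v *)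
Require Import Defs.
From Stdlib Require Import Reals List Arith Lra Lia Psatz Ranalysis5 PSeries_reg.
From Coquelicot Require Import Coquelicot.

(** The eigenvalue problem is solved by shooting from the right end.  Let
    [W lam] be the solution of the equation with [W(r) = 0] and [W'(r) = -1].
    The eigenvalues are the zeros of
    [shoot lam = rho W'(l) - (kappa(l) - lam) W(l)] and the eigenfunctions are
    multiples of [W lam].  The discrete problem has the same structure, with a
    polynomial [shoot_n] of degree at most [n + 1]; so it is enough to compare
    the two solutions, the two functions of [lam] and the two normalisations,
    keeping track of the frequency [om = sqrt (lam + 2)].

    The comparison of the solutions does not lose an order on irregular grids
    because the three-point scheme is a one-step method in disguise.  One can
    attach to each node a slope such that value and slope are propagated from
    cell to cell as in the velocity Verlet method ([back],
    [discrete_shooting]); the local errors are of third order in the length of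
    the cell.  The quadratic form [z^2 + 2 om^2 q y^2] is nearly conserved by the
    equation ([energy_derivative]) and by one step of the scheme
    ([verlet_step]), with constants that do not depend on the frequency.
    Hence the slopes differ by [O(h^2 om^3)] and the values by [O(h^2 om^2)]
    ([scheme_error]).  In Scheme 2 the factor [beta] makes the discrete
    boundary condition exact for the nodal slope, while Scheme 1 perturbs it
    by [O(h om)]; so [shoot_n - shoot] is of order [h^2 om^4 + h^gamma om]
    ([shoot_n_error]), where [gamma] is the order of the scheme.

    The Wronskian of two solutions expresses their inner product for the speed
    measure by the values of [shoot] ([wronskian]).  It follows that [shoot]
    crosses zero with a slope bounded from below uniformly in the frequency
    ([shoot_sign_change]), that the eigenvalues are separated by a fixed gap,
    and that there is a discrete eigenvalue near each eigenvalue and conversely.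
    The numberings agree: neighbouring eigenvalues have distinct discrete
    partners because of the gap, and two discrete eigenvalues cannot share a
    partner because their eigenvectors are orthogonal while both would be close
    to one eigenfunction.  As the eigenvalues grow at most quadratically, which
    follows from a high-frequency approximation ([wkb], [shoot_zeros]), the
    frequency is [O(k)] and the error of the [k]-th eigenvalue is
    [O(h^2 k^4 + h^gamma k)] ([eigenvalue_error]).

    The discrete speed measure, regrouped by cells, is a trapezoidal rule for
    the continuous one up to second order, apart from the mass at the left end,
    which is accurate to order [gamma] ([left_weight_error], [quadrature]).
    Thus the square norms of the two solutions are close, and so are the
    normalising factors, of size [O(k)], once their signs agree
    ([normalisation_close]).  Adding up gives [O(k^4 h^gamma)]
    ([eigenfunction_error]).  The bound [k <= h^(-1/5)] makes [h k^2] small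
    ([mesh_small]), which keeps the discrete eigenvalues within the gaps and
    the discrete norms away from zero. *)

Open Scope R_scope.

(** * Calculus on a closed interval *)

Lemma continuous_of_derive (f : R -> R) (x d : R) : is_derive f x d -> continuous f x.
Proof. intros H. apply (@ex_derive_continuous R_AbsRing R_NormedModule). now exists d. Qed.

(** Sign conditions, decided along the structure of the expression. *)
Ltac pos :=
  first
  [ assumption
  | lra
  | match goal with
    | |- 0 <= _ * _ => apply Rmult_le_pos; pos
    | |- 0 < _ * _ => apply Rmult_lt_0_compat; pos
    | |- 0 <= _ + _ => apply Rplus_le_le_0_compat; pos
    | |- 0 <= _ ^ 2 => apply pow2_ge_0
    | |- 0 < _ ^ _ => apply pow_lt; pos
    | |- 0 <= _ ^ _ => apply pow_le; pos
    | |- 0 < / _ => apply Rinv_0_lt_compat; pos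
    | |- 0 <= / _ => left; apply Rinv_0_lt_compat; pos
    | |- 0 < _ / _ => apply Rdiv_lt_0_compat; pos
    | |- 0 <= _ / _ => unfold Rdiv; pos
    | |- 0 <= Rabs _ => apply Rabs_pos
    | |- 0 <= exp _ => left; apply exp_pos
    | |- _ >= 0 => apply Rle_ge; pos
    | |- _ <> 0 => apply Rgt_not_eq; pos
    | |- _ > 0 => apply Rlt_gt; pos
    end ].
Ltac mono :=
  first [ apply Rmult_le_compat_l; pos | apply Rmult_le_compat_r; pos | apply Rmult_le_compat; pos ].
(** Extracts from a bound by an iterated minimum the bound by one of its terms. *)
Ltac below H :=
  first
  [ exact H
  | below constr:(Rle_trans _ _ _ H (Rmin_l _ _))
  | below constr:(Rle_trans _ _ _ H (Rmin_r _ _)) ].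

Lemma is_derive_eq (f : R -> R) (x d d' : R) :
  is_derive f x d -> d = d' -> is_derive f x d'.
Proof. now intros H <-. Qed.

Lemma derive_add (f g : R -> R) (x a b : R) : is_derive f x a -> is_derive g x b ->
  is_derive (fun t => f t + g t) x (a + b).
Proof. intros; now apply (is_derive_plus f g). Qed.

Lemma derive_sub (f g : R -> R) (x a b : R) : is_derive f x a -> is_derive g x b ->
  is_derive (fun t => f t - g t) x (a - b).
Proof. intros; now apply (is_derive_minus f g). Qed.

Lemma derive_neg (f : R -> R) (x a : R) : is_derive f x a ->
  is_derive (fun t => - f t) x (- a).
Proof. intros; now apply (is_derive_opp f). Qed.

Lemma derive_mul (f g : R -> R) (x a b : R) : is_derive f x a -> is_derive g x b ->
  is_derive (fun t => f t * g t) x (a * g x + f x * b).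
Proof.
  intros Hf Hg. apply is_derive_Reals. apply is_derive_Reals in Hf, Hg.
  now apply (derivable_pt_lim_mult f g).
Qed.

Lemma derive_pow (f : R -> R) n (x a : R) : is_derive f x a ->
  is_derive (fun t => f t ^ n) x (INR n * a * f x ^ pred n).
Proof. intros; now apply is_derive_pow. Qed.

Lemma derive_cst (c x : R) : is_derive (fun _ => c) x 0.
Proof. apply (@is_derive_const R_AbsRing). Qed.

Lemma derive_var (x : R) : is_derive (fun t => t) x 1.
Proof. apply (@is_derive_id R_AbsRing). Qed.

Lemma derive_exp (f : R -> R) (x a : R) : is_derive f x a ->
  is_derive (fun t => exp (f t)) x (a * exp (f x)).
Proof.
  intros Hf. apply (is_derive_comp exp f); auto.
  apply is_derive_Reals, derivable_pt_lim_exp.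
Qed.

Lemma derive_sin (f : R -> R) (x a : R) : is_derive f x a ->
  is_derive (fun t => sin (f t)) x (a * cos (f x)).
Proof.
  intros Hf. apply (is_derive_comp sin f); auto.
  apply is_derive_Reals, derivable_pt_lim_sin.
Qed.

Lemma derive_cos (f : R -> R) (x a : R) : is_derive f x a ->
  is_derive (fun t => cos (f t)) x (a * - sin (f x)).
Proof.
  intros Hf. apply (is_derive_comp cos f); auto.
  apply is_derive_Reals, derivable_pt_lim_cos.
Qed.

Lemma derive_inv (f : R -> R) (x a : R) : is_derive f x a -> f x <> 0 ->
  is_derive (fun t => / f t) x (- a / f x ^ 2).
Proof. intros; now apply is_derive_inv. Qed.

Ltac derive_leaf h :=
  match goal with H : context [is_derive h] |- _ =>
    solve [eapply H; solve [auto | lra | repeat split; lra]] end.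
Ltac derive_step :=
  match goal with
  | |- is_derive (fun t => t) _ _ => apply derive_var
  | |- is_derive (fun t => ?c) _ _ => let d := constr:(c) in apply derive_cst
  | |- is_derive (fun t => ?h t) _ _ => let d := constr:(h) in derive_leaf d
  | |- is_derive ?h _ _ => derive_leaf h
  | |- is_derive Ropp ?x ?d => change (is_derive (fun t => - t) x d)
  | |- is_derive (Rplus ?a) ?x ?d => change (is_derive (fun t => a + t) x d)
  | |- is_derive (Rminus ?a) ?x ?d => change (is_derive (fun t => a - t) x d)
  | |- is_derive (Rmult ?a) ?x ?d => change (is_derive (fun t => a * t) x d)
  | |- is_derive (fun t => _ + _) _ _ => eapply derive_add
  | |- is_derive (fun t => _ - _) _ _ => eapply derive_sub
  | |- is_derive (fun t => - _) _ _ => eapply derive_neg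
  | |- is_derive (fun t => _ * _) _ _ => eapply derive_mul
  | |- is_derive (fun t => _ ^ _) _ _ => eapply derive_pow
  | |- is_derive (fun t => exp _) _ _ => eapply derive_exp
  | |- is_derive (fun t => sin _) _ _ => eapply derive_sin
  | |- is_derive (fun t => cos _) _ _ => eapply derive_cos
  | |- is_derive (fun t => / _) _ _ => eapply derive_inv
  | |- is_derive (fun t => _ / _) _ _ => unfold Rdiv
  end.
(** Differentiates by structure; the remaining goal compares the derivative
    found with the one claimed. *)
Ltac derive := eapply is_derive_eq; [repeat derive_step | cbn beta].

Lemma exp_le x y : x <= y -> exp x <= exp y.
Proof. intros [H|H]; [left; now apply exp_increasing | subst; lra]. Qed.

Lemma continuous_add (f g : R -> R) (x : R) : continuous f x -> continuous g x ->
  continuous (fun t => f t + g t) x.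
Proof. intros; now apply (continuous_plus f g). Qed.

Lemma continuous_sub (f g : R -> R) (x : R) : continuous f x -> continuous g x ->
  continuous (fun t => f t - g t) x.
Proof. intros; now apply (continuous_minus f g). Qed.

Lemma continuous_mul (f g : R -> R) (x : R) : continuous f x -> continuous g x ->
  continuous (fun t => f t * g t) x.
Proof. intros; now apply (continuous_mult f g). Qed.

Lemma continuous_cst (c x : R) : continuous (fun _ : R => c) x.
Proof. apply (@continuous_const R_UniformSpace R_UniformSpace). Qed.

Lemma mean_value (f f1 : R -> R) u v : u <= v ->
  (forall x, u <= x <= v -> is_derive f x (f1 x)) ->
  exists x, u <= x <= v /\ f v - f u = f1 x * (v - u).
Proof.
  intros Huv Hd.
  destruct (MVT_gen f u v f1) as [x [Hx E]].
  - intros x; rewrite Rmin_left, Rmax_right by lra. intros ?; apply Hd; lra.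
  - intros x; rewrite Rmin_left, Rmax_right by lra. intros Hx.
    apply continuity_pt_filterlim.
    apply (continuous_of_derive _ _ _ (Hd x Hx)).
  - rewrite Rmin_left, Rmax_right in Hx by lra. now exists x.
Qed.

Lemma nondecreasing_of_derive (f f1 : R -> R) u v : u <= v ->
  (forall x, u <= x <= v -> is_derive f x (f1 x)) ->
  (forall x, u <= x <= v -> 0 <= f1 x) -> f u <= f v.
Proof.
  intros Huv Hd Hp. destruct (mean_value f f1 u v Huv Hd) as [x [Hx E]].
  specialize (Hp x Hx). nra.
Qed.

Lemma lipschitz_of_derive (f f1 : R -> R) u v B : u <= v ->
  (forall x, u <= x <= v -> is_derive f x (f1 x)) ->
  (forall x, u <= x <= v -> Rabs (f1 x) <= B) -> Rabs (f v - f u) <= B * (v - u).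
Proof.
  intros Huv Hd Hp. destruct (mean_value f f1 u v Huv Hd) as [x [Hx E]].
  rewrite E, Rabs_mult, (Rabs_right (v - u)) by lra.
  apply Rmult_le_compat_r; [lra | auto].
Qed.

(** Expansions at the right end of an interval, in the direction in which all
    solutions below are propagated. *)
Lemma taylor2_right (f f1 f2 : R -> R) u v B : u <= v ->
  (forall x, u <= x <= v -> is_derive f x (f1 x)) ->
  (forall x, u <= x <= v -> is_derive f1 x (f2 x)) ->
  (forall x, u <= x <= v -> Rabs (f2 x) <= B) ->
  Rabs (f u - (f v - (v - u) * f1 v)) <= B * (v - u) ^ 2.
Proof.
  intros Huv H1 H2 HB.
  assert (B0 : 0 <= B) by (generalize (HB u ltac:(lra)) (Rabs_pos (f2 u)); lra).
  set (G := fun t => f t - (t - v) * f1 v).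
  replace (f u - (f v - (v - u) * f1 v)) with (- (G v - G u)) by (unfold G; ring).
  rewrite Rabs_Ropp. replace (B * (v - u) ^ 2) with (B * (v - u) * (v - u)) by ring.
  apply (lipschitz_of_derive G (fun t => f1 t - f1 v)); auto.
  - intros x Hx. unfold G. derive. ring.
  - intros x Hx. rewrite Rabs_minus_sym.
    apply Rle_trans with (B * (v - x)).
    + apply (lipschitz_of_derive f1 f2); try lra; intros; [apply H2 | apply HB]; lra.
    + apply Rmult_le_compat_l; lra.
Qed.

Lemma taylor3_right (f f1 f2 f3 : R -> R) u v B : u <= v ->
  (forall x, u <= x <= v -> is_derive f x (f1 x)) ->
  (forall x, u <= x <= v -> is_derive f1 x (f2 x)) ->
  (forall x, u <= x <= v -> is_derive f2 x (f3 x)) ->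
  (forall x, u <= x <= v -> Rabs (f3 x) <= B) ->
  Rabs (f u - (f v - (v - u) * f1 v + (v - u) ^ 2 / 2 * f2 v)) <= B * (v - u) ^ 3.
Proof.
  intros Huv H1 H2 H3 HB.
  assert (B0 : 0 <= B) by (generalize (HB u ltac:(lra)) (Rabs_pos (f3 u)); lra).
  set (G := fun t => f t - (t - v) * f1 v - (t - v) ^ 2 / 2 * f2 v).
  replace (f u - (f v - (v - u) * f1 v + (v - u) ^ 2 / 2 * f2 v))
    with (- (G v - G u)) by (unfold G; field).
  rewrite Rabs_Ropp.
  replace (B * (v - u) ^ 3) with (B * (v - u) ^ 2 * (v - u)) by ring.
  apply (lipschitz_of_derive G (fun t => f1 t - (f1 v - (v - t) * f2 v))); auto.
  - intros x Hx. unfold G, Rdiv. derive. cbn; field.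
  - intros x Hx.
    apply Rle_trans with (B * (v - x) ^ 2).
    + apply (taylor2_right f1 f2 f3); try lra; intros; [apply H2|apply H3|apply HB]; lra.
    + apply Rmult_le_compat_l; [lra | apply pow_incr; lra].
Qed.

Lemma trapezoid (f f1 f2 f3 : R -> R) u v B : u <= v ->
  (forall x, u <= x <= v -> is_derive f x (f1 x)) ->
  (forall x, u <= x <= v -> is_derive f1 x (f2 x)) ->
  (forall x, u <= x <= v -> is_derive f2 x (f3 x)) ->
  (forall x, u <= x <= v -> Rabs (f3 x) <= B) ->
  Rabs (f v - f u - (v - u) / 2 * (f1 u + f1 v)) <= 2 * B * (v - u) ^ 3.
Proof.
  intros Huv H1 H2 H3 HB.
  generalize (taylor3_right f f1 f2 f3 u v B Huv H1 H2 H3 HB)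
             (taylor2_right f1 f2 f3 u v B Huv H2 H3 HB).
  set (A1 := _ - _). set (A2 := _ - (_ - _ * f2 v)). intros E1 E2.
  replace (f v - f u - (v - u) / 2 * (f1 u + f1 v))
    with (- A1 - (v - u) / 2 * A2) by (unfold A1, A2; field).
  apply Rabs_le_between in E1. apply Rabs_le_between in E2. apply Rabs_le_between.
  set (d := v - u) in *. assert (0 <= d) by (unfold d; lra).
  assert (0 <= B * d ^ 2) by lra.
  split; nra.
Qed.

Lemma gronwall_left (E E1 : R -> R) u v C b : u <= v -> 0 < C ->
  (forall x, u <= x <= v -> is_derive E x (E1 x)) ->
  (forall x, u <= x <= v -> - E1 x <= C * E x + b) ->
  forall x, u <= x <= v -> E x + b / C <= exp (C * (v - x)) * (E v + b / C).
Proof.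
  intros Huv HC Hd HE x Hx.
  set (H := fun t => exp (C * (t - v)) * (E t + b / C)).
  assert (Hm : H x <= H v).
  { apply (nondecreasing_of_derive H
      (fun t => exp (C * (t - v)) * (C * E t + b + E1 t))); try lra.
    - intros t Ht. unfold H. derive. field; lra.
    - intros t Ht. apply Rmult_le_pos; [left; apply exp_pos|].
      specialize (HE t ltac:(lra)). lra. }
  unfold H in Hm. replace (C * (v - v)) with 0 in Hm by ring.
  rewrite exp_0, Rmult_1_l in Hm.
  replace (E x + b / C) with (exp (C * (v - x)) * (exp (C * (x - v)) * (E x + b / C))).
  - apply Rmult_le_compat_l; [left; apply exp_pos | exact Hm].
  - rewrite <- Rmult_assoc, <- exp_plus.
    replace (C * (v - x) + C * (x - v)) with 0 by ring. rewrite exp_0; ring.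
Qed.

Lemma gronwall_right (E E1 : R -> R) u v C : u <= v ->
  (forall x, u <= x <= v -> is_derive E x (E1 x)) ->
  (forall x, u <= x <= v -> E1 x <= C * E x) ->
  forall x, u <= x <= v -> E v <= exp (C * (v - x)) * E x.
Proof.
  intros Huv Hd HE x Hx.
  set (H := fun t => - (exp (C * (v - t)) * E t)).
  assert (Hm : H x <= H v).
  { apply (nondecreasing_of_derive H
      (fun t => exp (C * (v - t)) * (C * E t - E1 t))); try lra.
    - intros t Ht. unfold H. derive. ring.
    - intros t Ht. apply Rmult_le_pos; [left; apply exp_pos|].
      specialize (HE t ltac:(lra)). lra. }
  unfold H in Hm. replace (C * (v - v)) with 0 in Hm by ring.
  rewrite exp_0, Rmult_1_l in Hm. lra.
Qed.

Lemma bounded_on_segment (f : R -> R) u v : u <= v ->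
  (forall x, u <= x <= v -> continuous f x) ->
  exists B, 0 < B /\ forall x, u <= x <= v -> Rabs (f x) <= B.
Proof.
  intros Huv Hf.
  assert (Hc : forall x, u <= x <= v -> continuity_pt (fun t => Rabs (f t)) x).
  { intros x Hx. apply continuity_pt_filterlim.
    apply (continuous_comp f Rabs); [auto | apply continuous_Rabs]. }
  destruct (continuity_ab_maj _ u v Huv Hc) as [m [Hm _]].
  exists (Rabs (f m) + 1). split; [generalize (Rabs_pos (f m)); lra|].
  intros x Hx. specialize (Hm x Hx). lra.
Qed.

Lemma positive_on_segment (f : R -> R) u v : u <= v ->
  (forall x, u <= x <= v -> continuous f x) ->
  (forall x, u <= x <= v -> 0 < f x) ->
  exists m, 0 < m /\ forall x, u <= x <= v -> m <= f x.
Proof.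
  intros Huv Hf Hp.
  destruct (continuity_ab_min f u v Huv) as [m [Hm Hm']].
  { intros x Hx. apply continuity_pt_filterlim. exact (Hf x Hx). }
  exists (f m). split; auto.
Qed.

(** * Extending functions from an interval to the line *)

Lemma continue_in_segment_of_D_in (f df : R -> R) u v x :
  D_in f df (segment u v) x -> continue_in f (segment u v) x.
Proof. intros H. exact (cont_deriv f df (segment u v) x H). Qed.

Lemma C_on_pred k D f : C_on (S k) D f -> C_on k D f.
Proof.
  revert f. induction k as [|k IH]; intros f [df [Hd Hc]].
  - intros x Hx. exact (cont_deriv f df D x (Hd x Hx)).
  - exists df. split; auto.
Qed.

Definition clamp (u v x : R) : R := Rmax u (Rmin x v).

Lemma clamp_in u v x : u <= v -> u <= clamp u v x <= v.
Proof. intros H. unfold clamp, Rmax, Rmin. destruct (Rle_dec x v), (Rle_dec u _); lra. Qed.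

Lemma clamp_id u v x : u <= x <= v -> clamp u v x = x.
Proof. intros H. unfold clamp, Rmax, Rmin. destruct (Rle_dec x v), (Rle_dec u _); lra. Qed.

Lemma clamp_lipschitz u v x y : Rabs (clamp u v y - clamp u v x) <= Rabs (y - x).
Proof.
  unfold clamp, Rmax, Rmin.
  destruct (Rle_dec x v), (Rle_dec y v); repeat destruct (Rle_dec u _);
  unfold Rabs; repeat destruct Rcase_abs; lra.
Qed.

Lemma continuous_clamp (f : R -> R) u v : u <= v ->
  (forall x, segment u v x -> continue_in f (segment u v) x) ->
  forall x, continuous (fun t => f (clamp u v t)) x.
Proof.
  intros Huv Hf x. apply continuity_pt_filterlim. intros eps Heps.
  destruct (Hf (clamp u v x) (clamp_in u v x Huv) eps Heps) as [alp [Ha H]].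
  exists alp. split; auto. intros y [_ Hy]. simpl in *. unfold Rdist in *.
  destruct (Req_dec (clamp u v y) (clamp u v x)) as [E|E].
  - rewrite E, Rminus_diag, Rabs_R0; lra.
  - apply H. split; [split; [apply clamp_in, Huv | auto]|].
    eapply Rle_lt_trans; [apply clamp_lipschitz | exact Hy].
Qed.

Lemma is_derive_D_in (f : R -> R) df u v x :
  is_derive f x (df x) -> D_in f df (segment u v) x.
Proof.
  intros H%is_derive_Reals eps Heps. destruct (H eps Heps) as [d Hd].
  exists d. split; [apply cond_pos|].
  intros y [[_ Hy] Hdist]. simpl in *. unfold Rdist in *.
  specialize (Hd (y - x) ltac:(lra) Hdist). now replace (x + (y - x)) with y in Hd by ring.
Qed.

Lemma continuous_continue_in (f : R -> R) u v x :
  continuous f x -> continue_in f (segment u v) x.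
Proof.
  intros H%continuity_pt_filterlim eps Heps. destruct (H eps Heps) as [d [Hd H']].
  exists d. split; auto. intros y [[Hy1 Hy2] Hy].
  apply H'. split; auto. split; [exact I | auto].
Qed.

Lemma segment_adherent u v x : u < v -> segment u v x -> adhDa (D_x (segment u v) x) x.
Proof.
  intros Huv [H1 H2] alp Halp. destruct (Rle_dec ((u + v) / 2) x) as [c|c].
  - set (e := Rmin (alp / 2) ((v - u) / 4)).
    assert (0 < e) by (apply Rmin_pos; lra).
    assert (e <= alp / 2) by apply Rmin_l. assert (e <= (v - u) / 4) by apply Rmin_r.
    exists (x - e). split; [split; [unfold segment; lra | lra]|].
    unfold Rdist. replace (x - e - x) with (- e) by ring.
    rewrite Rabs_Ropp, Rabs_right; lra.
  - set (e := Rmin (alp / 2) ((v - u) / 4)).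
    assert (0 < e) by (apply Rmin_pos; lra).
    assert (e <= alp / 2) by apply Rmin_l. assert (e <= (v - u) / 4) by apply Rmin_r.
    exists (x + e). split; [split; [unfold segment; lra | lra]|].
    unfold Rdist. replace (x + e - x) with e by ring.
    rewrite Rabs_right; lra.
Qed.

Lemma D_in_unique f d1 d2 u v x : u < v -> segment u v x ->
  D_in f d1 (segment u v) x -> D_in f d2 (segment u v) x -> d1 x = d2 x.
Proof.
  intros Huv Hx H1 H2. eapply single_limit; [|exact H1|exact H2].
  now apply segment_adherent.
Qed.

Lemma D_in_congr f g d e u v x :
  (forall y, segment u v y -> f y = g y) -> d x = e x -> segment u v x ->
  D_in f d (segment u v) x -> D_in g e (segment u v) x.
Proof.
  intros H Hde Hx Hf eps Heps. destruct (Hf eps Heps) as [alp [Ha K]].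
  exists alp. split; auto. intros y Hy. rewrite <- Hde, <- (H x Hx), <- (H y); auto.
  apply Hy.
Qed.

(** One-sided derivatives at the ends suffice for the primitive of [df] to give
    back [f], because [f] composed with the clamp is continuous. *)
Lemma primitive_unique_on_segment (f df F : R -> R) u v : u < v ->
  (forall x, segment u v x -> D_in f df (segment u v) x) ->
  (forall x, segment u v x -> is_derive F x (df x)) ->
  F u = f u -> forall x, segment u v x -> F x = f x.
Proof.
  intros Huv Hf HF Hu x Hx.
  set (g := fun t => F t - f (clamp u v t)).
  assert (Hg : forall t, u <= t <= x -> continuity_pt g t).
  { intros t Ht. apply continuity_pt_filterlim. apply (continuous_minus F).
    - apply (continuous_of_derive _ _ (df t)), HF. unfold segment in *; lra.
    - apply continuous_clamp; [lra|]. intros; eapply continue_in_segment_of_D_in; eauto. }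
  assert (Hd : forall t, u < t < x -> is_derive g t 0).
  { intros t Ht. destruct Hx as [Hx1 Hx2].
    replace 0 with (df t - df t) by ring.
    apply (is_derive_minus F); [apply HF; split; lra|].
    apply (is_derive_ext_loc f).
    - assert (Hp : 0 < Rmin (t - u) (x - t)) by (apply Rmin_pos; lra).
      exists (mkposreal _ Hp). intros s Hs. change (Rabs (s - t) < Rmin (t - u) (x - t)) in Hs.
      generalize (Rmin_l (t - u) (x - t)) (Rmin_r (t - u) (x - t)).
      apply Rabs_lt_between in Hs. intros. rewrite clamp_id; auto; lra.
    - apply is_derive_Reals. intros eps Heps.
      destruct (Hf t ltac:(split; lra) eps Heps) as [alp [Ha K]].
      assert (Hp : 0 < Rmin alp (Rmin (t - u) (x - t))) by (repeat apply Rmin_pos; lra).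
      exists (mkposreal _ Hp). intros h Hh0 Hh. simpl in Hh.
      generalize (Rmin_l alp (Rmin (t - u) (x - t))) (Rmin_r alp (Rmin (t - u) (x - t)))
        (Rmin_l (t - u) (x - t)) (Rmin_r (t - u) (x - t)). intros.
      specialize (K (t + h)). simpl in K. unfold Rdist in K.
      replace (t + h - t) with h in K by ring. apply K. split; [|lra].
      apply Rabs_lt_between in Hh. split; [split; lra | lra]. }
  destruct (MVT_gen g u x (fun _ => 0)) as [z [_ E]].
  - rewrite Rmin_left, Rmax_right by apply Hx. auto.
  - rewrite Rmin_left, Rmax_right by apply Hx. auto.
  - unfold g in E. destruct Hx. rewrite !clamp_id in E by lra. lra.
Qed.

(** The last derivative is continued by constants beyond the ends and integrated
    back, so that the derivatives at the ends become two-sided. *)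
Lemma C_on_extend k f u v : u < v -> C_on k (segment u v) f ->
  exists F : nat -> R -> R,
    (forall j, (j < k)%nat -> forall x, is_derive (F j) x (F (S j) x)) /\
    (forall j, (j <= k)%nat -> forall x, continuous (F j) x) /\
    (forall x, segment u v x -> F 0%nat x = f x).
Proof.
  intros Huv. revert f. induction k as [|k IH]; intros f Hf.
  - exists (fun _ x => f (clamp u v x)). split; [|split].
    + intros j Hj; lia.
    + intros j _. apply continuous_clamp; [lra | exact Hf].
    + intros x Hx. now rewrite clamp_id.
  - destruct Hf as [df [Hd Hc]]. destruct (IH df Hc) as [F [F1 [F2 F3]]].
    set (P := fun x => f u + RInt (F 0%nat) u x).
    assert (HP : forall x, is_derive P x (F 0%nat x)).
    { intros x. unfold P. rewrite <- (Rplus_0_l (F 0%nat x)).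
      apply (is_derive_plus (fun _ => f u)); [apply (@is_derive_const R_AbsRing)|].
      apply (is_derive_RInt (F 0%nat) _ u).
      - apply filter_forall. intros y. apply (@RInt_correct R_CompleteNormedModule).
        apply (@ex_RInt_continuous R_CompleteNormedModule). intros; apply F2; lia.
      - apply F2; lia. }
    exists (fun j => match j with O => P | S i => F i end). split; [|split].
    + intros [|j] Hj; [exact HP | apply F1; lia].
    + intros [|j] Hj x; [apply (continuous_of_derive _ _ _ (HP x)) | apply F2; lia].
    + intros x Hx. apply (primitive_unique_on_segment f df P u v); auto.
      * intros y Hy. rewrite <- (F3 y Hy). apply HP.
      * unfold P. rewrite RInt_point. apply Rplus_0_r.
Qed.

(** Continuity on the closed interval is enough for a primitive that is
    differentiable in the two-sided sense up to the ends. *)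
Lemma primitive_exists (f : R -> R) u v : u <= v ->
  (forall x, u <= x <= v -> continuous f x) ->
  exists G : R -> R, forall x, u <= x <= v -> is_derive G x (f x).
Proof.
  intros Huv Hf.
  assert (Hc : forall x, continuous (fun t => f (clamp u v t)) x).
  { apply continuous_clamp; auto. intros; apply continuous_continue_in, Hf; auto. }
  exists (fun t => RInt (fun s => f (clamp u v s)) u t). intros x Hx.
  rewrite <- (clamp_id u v x Hx) at 2.
  apply (is_derive_RInt (fun s => f (clamp u v s)) _ u); [|apply Hc].
  apply filter_forall. intros y. apply (@RInt_correct R_CompleteNormedModule).
  apply (@ex_RInt_continuous R_CompleteNormedModule). intros; apply Hc.
Qed.

Lemma ex_RInt_segment (f : R -> R) u v : u <= v ->
  (forall x, u <= x <= v -> continuous f x) -> ex_RInt f u v.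
Proof.
  intros Huv Hf. apply (@ex_RInt_continuous R_CompleteNormedModule).
  intros z. rewrite Rmin_left, Rmax_right by lra. apply Hf.
Qed.

Lemma RInt_of_primitive (f G : R -> R) u v : u <= v ->
  (forall x, u <= x <= v -> continuous f x) ->
  (forall x, u <= x <= v -> is_derive G x (f x)) -> RInt f u v = G v - G u.
Proof.
  intros Huv Hf HG. apply (@is_RInt_unique R_CompleteNormedModule).
  apply (is_RInt_derive G f); rewrite Rmin_left, Rmax_right by lra; auto.
Qed.

Lemma trapezoid_RInt (f f1 f2 : R -> R) u v B : u <= v ->
  (forall x, u <= x <= v -> is_derive f x (f1 x)) ->
  (forall x, u <= x <= v -> is_derive f1 x (f2 x)) ->
  (forall x, u <= x <= v -> Rabs (f2 x) <= B) ->
  Rabs (RInt f u v - (v - u) / 2 * (f u + f v)) <= 2 * B * (v - u) ^ 3.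
Proof.
  intros Huv H1 H2 HB.
  assert (Hc : forall x, u <= x <= v -> continuous f x).
  { intros x Hx. exact (continuous_of_derive _ _ _ (H1 x Hx)). }
  destruct (primitive_exists f u v Huv Hc) as [G HG].
  rewrite (RInt_of_primitive f G u v Huv Hc HG).
  now apply (trapezoid G f f1 f2).
Qed.

Lemma continuous_pow (f : R -> R) n (x : R) : continuous f x ->
  continuous (fun t => f t ^ n) x.
Proof.
  intros Hf. induction n as [|n IH]; simpl; [apply continuous_cst | now apply continuous_mul].
Qed.

Ltac cont_leaf h :=
  match goal with H : context [continuous h] |- _ =>
    solve [eapply H; solve [auto | lra | repeat split; lra]] end.
Ltac cont_step :=
  match goal with
  | |- continuous (fun t => ?c) _ => let d := constr:(c) in apply continuous_cst
  | |- continuous (fun t => ?h t) _ => let d := constr:(h) in cont_leaf d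
  | |- continuous ?h _ => cont_leaf h
  | |- continuous (fun t => _ + _) _ => apply continuous_add
  | |- continuous (fun t => _ - _) _ => apply continuous_sub
  | |- continuous (fun t => _ * _) _ => apply continuous_mul
  | |- continuous (fun t => _ ^ _) _ => apply continuous_pow
  end.

Lemma RInt_lin (f g : R -> R) (k u v : R) : ex_RInt f u v -> ex_RInt g u v ->
  RInt (fun x => f x + k * g x) u v = RInt f u v + k * RInt g u v.
Proof.
  intros Hf Hg. apply (@is_RInt_unique R_CompleteNormedModule).
  apply (is_RInt_plus f (fun x => k * g x)); [apply (RInt_correct f); auto|].
  apply (is_RInt_scal g). apply (RInt_correct g); auto.
Qed.

Lemma RInt_ge_cst (f : R -> R) (m u v : R) : u <= v -> ex_RInt f u v ->
  (forall x, u <= x <= v -> m <= f x) -> m * (v - u) <= RInt f u v.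
Proof.
  intros Huv Hf Hm.
  replace (m * (v - u)) with (RInt (fun _ => m) u v).
  - apply RInt_le; auto; [apply ex_RInt_const | intros; apply Hm; lra].
  - rewrite RInt_const. unfold scal; simpl. unfold mult; simpl. ring.
Qed.

Lemma RInt_congr (f g : R -> R) (u v : R) : (forall x, f x = g x) ->
  RInt f u v = RInt g u v.
Proof. intros H. apply RInt_ext. auto. Qed.

Lemma RInt_congr_open (f g : R -> R) (u v : R) : u <= v ->
  (forall x, u < x < v -> f x = g x) -> RInt f u v = RInt g u v.
Proof. intros Huv H. apply RInt_ext. now rewrite Rmin_left, Rmax_right by lra. Qed.

Lemma zero_between (f : R -> R) u v : u < v ->
  (forall x, u <= x <= v -> continuity_pt f x) -> f u * f v < 0 ->
  exists x, u < x < v /\ f x = 0.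
Proof.
  intros Huv Hf Hs.
  assert (main : forall g, (forall x, u <= x <= v -> continuity_pt g x) -> g u < 0 -> 0 < g v ->
    exists x, u < x < v /\ g x = 0).
  { intros g Hg Hu Hv. destruct (IVT_interv g u v Hg Huv Hu Hv) as [x [Hx E]].
    exists x. split; auto. split; apply Rnot_le_lt; intros H.
    - assert (x = u) by lra. subst. lra.
    - assert (x = v) by lra. subst. lra. }
  destruct (Rlt_dec (f u) 0) as [c|c].
  - apply main; auto. nra.
  - assert (f u <> 0) by (intros E; rewrite E in Hs; lra).
    destruct (main (fun x => - f x)) as [x [Hx E]]; [| nra | nra |].
    + intros x Hx. apply continuity_pt_opp, Hf, Hx.
    + exists x. split; auto. lra.
Qed.

(** The eigenvalue equation is only prescribed in the interior; continuity carries
    it to the ends. *)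
Lemma zero_at_ends (g : R -> R) u v : u < v -> (forall x, continuous g x) ->
  (forall x, u < x < v -> g x = 0) -> forall x, u <= x <= v -> g x = 0.
Proof.
  intros Huv Hg H x Hx. destruct (Req_dec (g x) 0) as [|n]; auto. exfalso.
  assert (C := Hg x). apply continuity_pt_filterlim in C.
  destruct (C (Rabs (g x)) (Rabs_pos_lt _ n)) as [d [Hd HC]].
  destruct (segment_adherent u v x Huv Hx (Rmin d ((v - u) / 4)) ltac:(apply Rmin_pos; lra)) as [y [[Hy1 Hy2] Hy3]].
  destruct (Req_dec y u) as [Eu|Nu].
  - assert (x = u).
    { destruct (Req_dec x u); auto. exfalso. apply n, H. destruct Hx. split; [lra|].
      apply Rnot_le_lt. intros Hv. assert (x = v) by lra. subst. unfold Rdist in Hy3.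
      generalize (Rmin_r d ((v - u) / 4)). intros. apply Rabs_lt_between in Hy3. lra. }
    contradiction (Hy2). lra.
  - destruct (Req_dec y v) as [Ev|Nv].
    + assert (x = v).
      { destruct (Req_dec x v); auto. exfalso. apply n, H. destruct Hx. split; [|lra].
        apply Rnot_le_lt. intros Hv. assert (x = u) by lra. subst. unfold Rdist in Hy3.
        generalize (Rmin_r d ((v - u) / 4)). intros. apply Rabs_lt_between in Hy3. lra. }
      contradiction (Hy2). lra.
    + assert (E := H y ltac:(destruct Hy1; lra)). specialize (HC y). simpl in HC. unfold Rdist in HC.
      rewrite E in HC. replace (0 - g x) with (- g x) in HC by ring. rewrite Rabs_Ropp in HC.
      assert (Rabs (g x) < Rabs (g x)); [|lra]. apply HC. split; [split; [exact I | auto]|].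
      eapply Rlt_le_trans; [exact Hy3 | apply Rmin_l].
Qed.

Lemma exp_second_order t : Rabs t <= 1 -> Rabs (exp t - 1 - t) <= 3 * t ^ 2.
Proof.
  intros Ht. apply Rabs_le_between in Ht.
  assert (Hexp : forall s, s <= 1 -> Rabs (exp s) <= 3).
  { intros s Hs. rewrite Rabs_right by (left; apply exp_pos).
    apply Rle_trans with (exp 1); [now apply exp_le | apply exp_le_3]. }
  assert (De : forall s : R, is_derive exp s (exp s)).
  { intros s. apply is_derive_Reals, derivable_pt_lim_exp. }
  destruct (Rle_dec t 0) as [c|c].
  - replace (exp t - 1 - t) with (exp t - (exp 0 - (0 - t) * exp 0)) by (rewrite exp_0; ring).
    replace (3 * t ^ 2) with (3 * (0 - t) ^ 2) by ring.
    apply (taylor2_right exp exp exp); auto. intros; apply Hexp; lra.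
  - replace (exp t - 1 - t) with (exp (- - t) - (exp (- 0) - (0 - - t) * - exp (- 0)))
      by (rewrite Ropp_involutive, Ropp_0, exp_0; ring).
    replace (3 * t ^ 2) with (3 * (0 - - t) ^ 2) by ring.
    apply (taylor2_right (fun s => exp (- s)) (fun s => - exp (- s)) (fun s => exp (- s))); try lra.
    + intros s _. derive. ring.
    + intros s _. derive. ring.
    + intros s Hs. apply Hexp. lra.
Qed.

Lemma fold_right_Rmult_snoc L y : fold_right Rmult 1 (L ++ y :: nil) = fold_right Rmult 1 L * y.
Proof. induction L as [|z L IH]; simpl; [ring | rewrite IH; ring]. Qed.

(** * Elementary estimates *)

Lemma Rabs_mul_le u v A B : Rabs u <= A -> Rabs v <= B -> Rabs (u * v) <= A * B.
Proof. intros. rewrite Rabs_mult. apply Rmult_le_compat; auto; apply Rabs_pos. Qed.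

Lemma Rabs_add_le u v A B : Rabs u <= A -> Rabs v <= B -> Rabs (u + v) <= A + B.
Proof. intros. eapply Rle_trans; [apply Rabs_triang | lra]. Qed.

Lemma abs_le_of_sqr z B : 0 <= B -> z ^ 2 <= B ^ 2 -> Rabs z <= B.
Proof.
  intros HB H. apply Rsqr_incr_0_var; auto. unfold Rsqr. rewrite <- (pow2_abs z) in H. lra.
Qed.

Lemma same_sign u v e b : e < b -> b <= Rabs u -> Rabs (v - u) <= e -> 0 < u * v.
Proof.
  intros Heb Hu Hv. apply Rabs_le_between in Hv. unfold Rabs in Hu. destruct (Rcase_abs u).
  - replace (u * v) with (- u * - v) by ring. apply Rmult_lt_0_compat; lra.
  - apply Rmult_lt_0_compat; lra.
Qed.

(** * Existence of solutions of linear second order equations *)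

Section Picard.

Variables (A B : R -> R) (x0 y0 z0 : R).
Hypothesis HA : forall x, continuous A x.
Hypothesis HB : forall x, continuous B x.

Fixpoint picard (n : nat) : (R -> R) * (R -> R) :=
  match n with
  | O => (fun _ => y0, fun _ => z0)
  | S m => let (Y, Z) := picard m in
      (fun x => y0 + RInt Z x0 x,
       fun x => z0 + RInt (fun t => A t * Z t + B t * Y t) x0 x)
  end.

Let Y n := fst (picard n).
Let Z n := snd (picard n).

Lemma is_derive_primitive (f : R -> R) (c : R) : (forall x, continuous f x) ->
  forall x, is_derive (fun t => c + RInt f x0 t) x (f x).
Proof.
  intros Hf x. eapply is_derive_eq.
  - apply derive_add; [apply derive_cst|].
    apply (is_derive_RInt f _ x0); [|apply Hf].
    apply filter_forall. intros y. apply (@RInt_correct R_CompleteNormedModule).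
    apply (@ex_RInt_continuous R_CompleteNormedModule). intros; apply Hf.
  - ring.
Qed.

Lemma picard_derive n : (forall x, continuous (Y n) x) /\ (forall x, continuous (Z n) x) /\
  (forall x, is_derive (Y (S n)) x (Z n x)) /\
  (forall x, is_derive (Z (S n)) x (A x * Z n x + B x * Y n x)).
Proof.
  assert (step : forall n, (forall x, continuous (Y n) x) /\ (forall x, continuous (Z n) x) ->
    (forall x, is_derive (Y (S n)) x (Z n x)) /\
    (forall x, is_derive (Z (S n)) x (A x * Z n x + B x * Y n x))).
  { intros m [HY HZ]. unfold Y, Z in *. simpl. destruct (picard m) as [u v]. simpl in *.
    split; [apply (is_derive_primitive v y0 HZ)|].
    apply (is_derive_primitive (fun t => A t * v t + B t * u t) z0).
    intros x. apply continuous_add; apply continuous_mul; auto. }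
  induction n as [|n [IH1 [IH2 [IH3 IH4]]]].
  - assert (H0 : (forall x, continuous (Y 0) x) /\ (forall x, continuous (Z 0) x)).
    { split; intros x; apply continuous_cst. }
    split; [apply H0|]. split; [apply H0|]. apply step, H0.
  - assert (H : (forall x, continuous (Y (S n)) x) /\ (forall x, continuous (Z (S n)) x)).
    { split; intros x; eapply continuous_of_derive; [apply IH3 | apply IH4]. }
    split; [apply H|]. split; [apply H|]. apply step, H.
Qed.

Lemma picard_start n : Y n x0 = y0 /\ Z n x0 = z0.
Proof.
  unfold Y, Z. destruct n as [|n]; simpl; auto. destruct (picard n) as [u v]. simpl.
  rewrite !RInt_point. split; apply Rplus_0_r.
Qed.

(** An exponential weight turns the Picard map into a contraction by one half. *)
Lemma weighted_primitive (f f1 : R -> R) (M k rad : R) : 0 <= M -> 0 <= k ->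
  f x0 = 0 ->
  (forall x, Rabs (x - x0) <= rad -> is_derive f x (f1 x)) ->
  (forall x, Rabs (x - x0) <= rad -> Rabs (f1 x) <= M * (k * exp (2 * M * Rabs (x - x0)))) ->
  forall x, Rabs (x - x0) <= rad -> Rabs (f x) <= k / 2 * exp (2 * M * Rabs (x - x0)).
Proof.
  intros HM Hk Hf0 Hd Hb x Hx.
  destruct (Rle_dec x0 x) as [c|c].
  - rewrite (Rabs_right (x - x0)) in * by lra.
    assert (E : forall t, x0 <= t <= x -> Rabs (t - x0) = t - x0)
      by (intros; apply Rabs_right; lra).
    assert (H1 : k / 2 * exp (2 * M * (x0 - x0)) - f x0 <= k / 2 * exp (2 * M * (x - x0)) - f x).
    { apply (nondecreasing_of_derive (fun t => k / 2 * exp (2 * M * (t - x0)) - f t)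
        (fun t => M * (k * exp (2 * M * (t - x0))) - f1 t)); auto.
      - intros t Ht. assert (Hd' := Hd t ltac:(rewrite E; lra)). derive. field.
      - intros t Ht. specialize (Hb t ltac:(rewrite E; lra)). rewrite E in Hb by lra.
        apply Rabs_le_between in Hb. lra. }
    assert (H2 : k / 2 * exp (2 * M * (x0 - x0)) + f x0 <= k / 2 * exp (2 * M * (x - x0)) + f x).
    { apply (nondecreasing_of_derive (fun t => k / 2 * exp (2 * M * (t - x0)) + f t)
        (fun t => M * (k * exp (2 * M * (t - x0))) + f1 t)); auto.
      - intros t Ht. assert (Hd' := Hd t ltac:(rewrite E; lra)). derive. field.
      - intros t Ht. specialize (Hb t ltac:(rewrite E; lra)). rewrite E in Hb by lra.
        apply Rabs_le_between in Hb. lra. }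
    rewrite Hf0 in *. replace (2 * M * (x0 - x0)) with 0 in * by ring. rewrite exp_0 in *.
    apply Rabs_le. lra.
  - rewrite (Rabs_left (x - x0)) in * by lra.
    assert (E : forall t, x <= t <= x0 -> Rabs (t - x0) = - (t - x0))
      by (intros; apply Rabs_left1; lra).
    assert (H1 : - (k / 2 * exp (2 * M * - (x - x0))) + f x
                 <= - (k / 2 * exp (2 * M * - (x0 - x0))) + f x0).
    { apply (nondecreasing_of_derive (fun t => - (k / 2 * exp (2 * M * - (t - x0))) + f t)
        (fun t => M * (k * exp (2 * M * - (t - x0))) + f1 t)); try lra.
      - intros t Ht. assert (Hd' := Hd t ltac:(rewrite E; lra)). derive. field.
      - intros t Ht. specialize (Hb t ltac:(rewrite E; lra)). rewrite E in Hb by lra.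
        apply Rabs_le_between in Hb. lra. }
    assert (H2 : - (k / 2 * exp (2 * M * - (x - x0))) - f x
                 <= - (k / 2 * exp (2 * M * - (x0 - x0))) - f x0).
    { apply (nondecreasing_of_derive (fun t => - (k / 2 * exp (2 * M * - (t - x0))) - f t)
        (fun t => M * (k * exp (2 * M * - (t - x0))) - f1 t)); try lra.
      - intros t Ht. assert (Hd' := Hd t ltac:(rewrite E; lra)). derive. field.
      - intros t Ht. specialize (Hb t ltac:(rewrite E; lra)). rewrite E in Hb by lra.
        apply Rabs_le_between in Hb. lra. }
    rewrite Hf0 in *. replace (2 * M * - (x0 - x0)) with 0 in * by ring. rewrite exp_0 in *.
    apply Rabs_le. lra.
Qed.

Lemma picard_contraction rad : 0 < rad -> exists k, 0 <= k /\
  forall n x, Rabs (x - x0) <= rad ->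
    Rabs (Y (S n) x - Y n x) <= k / 2 ^ n /\ Rabs (Z (S n) x - Z n x) <= k / 2 ^ n.
Proof.
  intros Hrad.
  destruct (bounded_on_segment A (x0 - rad) (x0 + rad) ltac:(lra) (fun x _ => HA x)) as [KA [KA0 BA]].
  destruct (bounded_on_segment B (x0 - rad) (x0 + rad) ltac:(lra) (fun x _ => HB x)) as [KB [KB0 BB]].
  set (M := 1 + KA + KB).
  assert (Habs : forall x, Rabs (x - x0) <= rad -> x0 - rad <= x <= x0 + rad).
  { intros x Hx. apply Rabs_le_between in Hx. lra. }
  destruct (bounded_on_segment (fun x => Y 1 x - Y 0 x) (x0 - rad) (x0 + rad)) as [k1 [Hk1 B1]]; [lra| |].
  { intros x _. destruct (picard_derive 1) as [c1 _], (picard_derive 0) as [c0 _].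
    exact (continuous_sub _ _ x (c1 x) (c0 x)). }
  destruct (bounded_on_segment (fun x => Z 1 x - Z 0 x) (x0 - rad) (x0 + rad)) as [k2 [Hk2 B2]]; [lra| |].
  { intros x _. destruct (picard_derive 1) as [_ [c1 _]], (picard_derive 0) as [_ [c0 _]].
    exact (continuous_sub _ _ x (c1 x) (c0 x)). }
  set (k0 := k1 + k2).
  assert (main : forall n x, Rabs (x - x0) <= rad ->
    Rabs (Y (S n) x - Y n x) <= k0 / 2 ^ n * exp (2 * M * Rabs (x - x0)) /\
    Rabs (Z (S n) x - Z n x) <= k0 / 2 ^ n * exp (2 * M * Rabs (x - x0))).
  { induction n as [|n IH]; intros x Hx.
    - specialize (B1 x (Habs x Hx)). specialize (B2 x (Habs x Hx)).
      assert (1 <= exp (2 * M * Rabs (x - x0))).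
      { rewrite <- exp_0. apply exp_le. apply Rmult_le_pos; [unfold M; lra | apply Rabs_pos]. }
      simpl. unfold Rdiv. rewrite Rinv_1, Rmult_1_r. unfold k0 in *. split; nra.
    - assert (P2 : 0 < 2 ^ n) by pos.
      assert (Hk : 0 <= k0 / 2 ^ n) by (apply Rmult_le_pos; [unfold k0; lra | left; now apply Rinv_0_lt_compat]).
      replace (k0 / 2 ^ S n) with (k0 / 2 ^ n / 2) by (simpl; field; lra).
      destruct (picard_derive (S n)) as [_ [_ [D1 D2]]].
      destruct (picard_derive n) as [_ [_ [D3 D4]]].
      destruct (picard_start (S (S n))) as [S1 S2], (picard_start (S n)) as [S3 S4].
      assert (HM : 0 <= M) by (unfold M; lra).
      split.
      + apply (weighted_primitive (fun t => Y (S (S n)) t - Y (S n) t)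
          (fun t => Z (S n) t - Z n t) M (k0 / 2 ^ n) rad); auto.
        * rewrite S1, S3; ring.
        * intros t Ht. apply derive_sub; auto.
        * intros t Ht. destruct (IH t Ht) as [_ I2].
          eapply Rle_trans; [exact I2|].
          rewrite <- (Rmult_1_l (_ * exp _)) at 1. apply Rmult_le_compat_r; [|unfold M; lra].
          apply Rmult_le_pos; [auto | left; apply exp_pos].
      + apply (weighted_primitive (fun t => Z (S (S n)) t - Z (S n) t)
          (fun t => A t * (Z (S n) t - Z n t) + B t * (Y (S n) t - Y n t)) M (k0 / 2 ^ n) rad); auto.
        * rewrite S2, S4; ring.
        * intros t Ht. eapply is_derive_eq; [apply derive_sub; [apply D2 | apply D4] | ring].
        * intros t Ht. destruct (IH t Ht) as [I1 I2].
          specialize (BA t (Habs t Ht)). specialize (BB t (Habs t Ht)).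
          set (W := k0 / 2 ^ n * exp _) in *.
          eapply Rle_trans; [apply Rabs_triang|]. rewrite !Rabs_mult.
          assert (Rabs (A t) * Rabs (Z (S n) t - Z n t) <= KA * W)
            by (apply Rmult_le_compat; auto; apply Rabs_pos).
          assert (Rabs (B t) * Rabs (Y (S n) t - Y n t) <= KB * W)
            by (apply Rmult_le_compat; auto; apply Rabs_pos).
          assert (0 <= W) by (eapply Rle_trans; [apply Rabs_pos | exact I1]).
          unfold M. lra. }
  exists (k0 * exp (2 * M * rad)). split.
  { apply Rmult_le_pos; [unfold k0; lra | left; apply exp_pos]. }
  intros n x Hx. destruct (main n x Hx) as [I1 I2].
  assert (P2 : 0 < 2 ^ n) by pos.
  assert (He : k0 / 2 ^ n * exp (2 * M * Rabs (x - x0)) <= k0 * exp (2 * M * rad) / 2 ^ n).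
  { replace (k0 * exp (2 * M * rad) / 2 ^ n) with (k0 / 2 ^ n * exp (2 * M * rad)) by (field; lra).
    apply Rmult_le_compat_l.
    - apply Rmult_le_pos; [unfold k0; lra | left; now apply Rinv_0_lt_compat].
    - apply exp_le, Rmult_le_compat_l; [unfold M; lra | auto]. }
  split; eapply Rle_trans; eauto.
Qed.

Lemma geometric_limit (u : nat -> R) k : 0 <= k ->
  (forall n, Rabs (u (S n) - u n) <= k / 2 ^ n) ->
  forall n, Rabs (real (Lim_seq u) - u n) <= 2 * k / 2 ^ n.
Proof.
  intros Hk Hu.
  assert (P2 : forall n, 0 < 2 ^ n) by (intros; apply pow_lt; lra).
  assert (Hd : forall n p, Rabs (u (n + p)%nat - u n) <= 2 * k / 2 ^ n - 2 * k / 2 ^ (n + p)).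
  { intros n p. induction p as [|p IH].
    - rewrite Nat.add_0_r, Rminus_diag, Rabs_R0. lra.
    - replace (n + S p)%nat with (S (n + p)) by lia. specialize (Hu (n + p)%nat).
      replace (2 * k / 2 ^ S (n + p)) with (2 * k / 2 ^ (n + p) - k / 2 ^ (n + p))
        by (simpl; specialize (P2 (n + p)%nat); field; lra).
      replace (u (S (n + p)) - u n) with ((u (S (n + p)) - u (n + p)%nat) + (u (n + p)%nat - u n)) by ring.
      eapply Rle_trans; [apply Rabs_triang|]. lra. }
  assert (Hd' : forall n m, (n <= m)%nat -> Rabs (u m - u n) <= 2 * k / 2 ^ n).
  { intros n m Hnm. replace m with (n + (m - n))%nat by lia. eapply Rle_trans; [apply Hd|].
    assert (0 <= 2 * k / 2 ^ (n + (m - n))); [|lra].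
    apply Rmult_le_pos; [lra | left; apply Rinv_0_lt_compat, P2]. }
  assert (Hlim : is_lim_seq (fun n => 2 * k / 2 ^ n) 0).
  { replace (Finite 0) with (Rbar_mult (2 * k) 0) by (simpl; f_equal; ring).
    apply (is_lim_seq_ext (fun n => 2 * k * (/ 2) ^ n)).
    - intros n. unfold Rdiv. now rewrite pow_inv.
    - apply is_lim_seq_scal_l. apply is_lim_seq_geom. rewrite Rabs_right; lra. }
  assert (Hex : ex_finite_lim_seq u).
  { apply ex_lim_seq_cauchy_corr. intros eps.
    apply is_lim_seq_spec in Hlim. destruct (Hlim (mkposreal (eps / 2) ltac:(generalize (cond_pos eps); lra))) as [N HN].
    exists N. intros n m Hn Hm. specialize (HN N (le_n N)). simpl in HN.
    rewrite Rminus_0_r in HN. apply Rabs_lt_between in HN.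
    generalize (Hd' N n Hn) (Hd' N m Hm). intros I1 I2.
    apply Rabs_le_between in I1. apply Rabs_le_between in I2. apply Rabs_lt_between. lra. }
  destruct Hex as [y Hy]. rewrite (is_lim_seq_unique _ _ Hy). simpl. intros n.
  assert (H1 : is_lim_seq (fun m => Rabs (u m - u n)) (Rabs (y - u n))).
  { apply (is_lim_seq_abs _ (Finite (y - u n))).
    apply is_lim_seq_minus'; [exact Hy | apply is_lim_seq_const]. }
  assert (H2 := is_lim_seq_le_loc (fun m => Rabs (u m - u n)) (fun _ => 2 * k / 2 ^ n)
    (Rabs (y - u n)) (2 * k / 2 ^ n)).
  apply H2; [exists n; auto | exact H1 | apply is_lim_seq_const].
Qed.

Lemma CVU_of_geometric (u : nat -> R -> R) (w : R -> R) k (rad : posreal) : 0 <= k ->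
  (forall n x, Rabs (x - x0) <= rad -> Rabs (w x - u n x) <= 2 * k / 2 ^ n) ->
  CVU u w x0 rad.
Proof.
  intros Hk Hu eps Heps.
  destruct (pow_lt_1_zero (/ 2) ltac:(rewrite Rabs_right; lra) (eps / (2 * k + 1))) as [N HN].
  { apply Rmult_lt_0_compat; [auto | apply Rinv_0_lt_compat; lra]. }
  exists N. intros n x Hn Hx. unfold Boule in Hx.
  eapply Rle_lt_trans; [apply Hu; lra|]. specialize (HN n Hn).
  rewrite pow_inv in HN. rewrite Rabs_right in HN
    by (apply Rle_ge; left; apply Rinv_0_lt_compat, pow_lt; lra).
  assert (0 < / 2 ^ n) by (apply Rinv_0_lt_compat, pow_lt; lra).
  apply Rmult_lt_compat_r with (r := 2 * k + 1) in HN; [|lra].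
  replace (eps / (2 * k + 1) * (2 * k + 1)) with eps in HN by (field; lra).
  unfold Rdiv. nra.
Qed.

Definition ode_value (x : R) : R := Lim_seq (fun n => fst (picard n) x).
Definition ode_slope (x : R) : R := Lim_seq (fun n => snd (picard n) x).

Lemma ode_start : ode_value x0 = y0 /\ ode_slope x0 = z0.
Proof.
  split.
  - unfold ode_value. rewrite (Lim_seq_ext _ (fun _ => y0)) by (intros; apply picard_start).
    now rewrite Lim_seq_const.
  - unfold ode_slope. rewrite (Lim_seq_ext _ (fun _ => z0)) by (intros; apply picard_start).
    now rewrite Lim_seq_const.
Qed.

(** The iterates and their derivatives converge uniformly on bounded intervals, so
    the system passes to the limit. *)
Lemma ode_solves x : is_derive ode_value x (ode_slope x) /\
  is_derive ode_slope x (A x * ode_slope x + B x * ode_value x).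
Proof.
  set (rad := Rabs (x - x0) + 1).
  assert (Hrad : 0 < rad) by (unfold rad; generalize (Rabs_pos (x - x0)); lra).
  destruct (picard_contraction rad Hrad) as [k [Hk Hc]].
  set (y := ode_value). set (z := ode_slope).
  assert (Hy : forall n x, Rabs (x - x0) <= rad -> Rabs (y x - Y n x) <= 2 * k / 2 ^ n).
  { intros n t Ht. apply (geometric_limit (fun n => Y n t)); auto. intros; now apply Hc. }
  assert (Hz : forall n x, Rabs (x - x0) <= rad -> Rabs (z x - Z n x) <= 2 * k / 2 ^ n).
  { intros n t Ht. apply (geometric_limit (fun n => Z n t)); auto. intros; now apply Hc. }
  set (R' := mkposreal rad Hrad).
  assert (CY : CVU Y y x0 R') by (apply (CVU_of_geometric _ _ k); auto).
  assert (CZ : CVU Z z x0 R') by (apply (CVU_of_geometric _ _ k); auto).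
  assert (Hcy : forall x, Boule x0 R' x -> continuity_pt y x).
  { apply (CVU_continuity Y y x0 R' CY). intros n t _. apply continuity_pt_filterlim. exact (proj1 (picard_derive n) t). }
  assert (Hcz : forall x, Boule x0 R' x -> continuity_pt z x).
  { apply (CVU_continuity Z z x0 R' CZ). intros n t _. apply continuity_pt_filterlim. exact (proj1 (proj2 (picard_derive n)) t). }
  assert (Hx : Rabs (x - x0) < rad) by (unfold rad; lra).
  split; apply is_derive_Reals.
  - apply (derivable_pt_lim_CVU (fun n => Y (S n)) Z y z x x0 R'); auto.
    + intros t n _. apply is_derive_Reals. exact (proj1 (proj2 (proj2 (picard_derive n))) t).
    + intros t Ht. intros eps Heps. destruct (CY eps Heps) as [N HN].
      exists N. intros n Hn. unfold Rdist. rewrite Rabs_minus_sym. apply HN; [lia | auto].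
  - apply (derivable_pt_lim_CVU (fun n => Z (S n)) (fun n t => A t * Z n t + B t * Y n t)
      z (fun t => A t * z t + B t * y t) x x0 R'); auto.
    + intros t n _. apply is_derive_Reals. exact (proj2 (proj2 (proj2 (picard_derive n))) t).
    + intros t Ht. intros eps Heps. destruct (CZ eps Heps) as [N HN].
      exists N. intros n Hn. unfold Rdist. rewrite Rabs_minus_sym. apply HN; [lia | auto].
    + destruct (bounded_on_segment A (x0 - rad) (x0 + rad) ltac:(lra) (fun x _ => HA x)) as [KA [KA0 BA]].
      destruct (bounded_on_segment B (x0 - rad) (x0 + rad) ltac:(lra) (fun x _ => HB x)) as [KB [KB0 BB]].
      apply (CVU_of_geometric _ _ ((KA + KB) * k)); [nra|]. simpl. intros n t Ht.
      assert (Ht' : x0 - rad <= t <= x0 + rad) by (apply Rabs_le_between in Ht; lra).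
      specialize (BA t Ht'). specialize (BB t Ht').
      specialize (Hy n t Ht). specialize (Hz n t Ht).
      replace (A t * z t + B t * y t - (A t * Z n t + B t * Y n t))
        with (A t * (z t - Z n t) + B t * (y t - Y n t)) by ring.
      eapply Rle_trans; [apply Rabs_triang|]. rewrite !Rabs_mult.
      replace (2 * ((KA + KB) * k) / 2 ^ n) with (KA * (2 * k / 2 ^ n) + KB * (2 * k / 2 ^ n))
        by (field; apply pow_nonzero; lra).
      apply Rplus_le_compat; apply Rmult_le_compat; auto; apply Rabs_pos.
    + intros t Ht. apply continuity_pt_plus; apply continuity_pt_mult; auto;
        apply continuity_pt_filterlim; [apply HA | apply HB].
Qed.

End Picard.

(** * Counting the roots of a polynomial function *)

(** Polynomial functions of degree less than [m], encoded by synthetic division at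
    an arbitrary point, which is the step that counts roots. *)
Fixpoint Plt (m : nat) (f : R -> R) : Prop :=
  match m with
  | O => forall t, f t = 0
  | S m => forall a, exists g, Plt m g /\ forall t, f t = f a + (t - a) * g t
  end.

Lemma Plt_ext m f g : (forall t, f t = g t) -> Plt m f -> Plt m g.
Proof.
  intros E. destruct m as [|m]; simpl; intros H.
  - intros t. now rewrite <- E.
  - intros a. destruct (H a) as [k [Hk Hf]]. exists k. split; auto. intros t. now rewrite <- !E.
Qed.

Lemma Plt_lin m f g u v : Plt m f -> Plt m g -> Plt m (fun t => u * f t + v * g t).
Proof.
  revert f g. induction m as [|m IH]; simpl; intros f g Hf Hg.
  - intros t. rewrite Hf, Hg. ring.
  - intros a. destruct (Hf a) as [f' [F1 F2]], (Hg a) as [g' [G1 G2]].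
    exists (fun t => u * f' t + v * g' t). split; [now apply IH|].
    intros t. rewrite (F2 t), (G2 t). ring.
Qed.

Lemma Plt_succ m f : Plt m f -> Plt (S m) f.
Proof.
  revert f. induction m as [|m IH]; intros f Hf a.
  - exists (fun _ => 0). split; [simpl; auto|]. intros t. simpl in Hf. rewrite !Hf. ring.
  - destruct (Hf a) as [g [G1 G2]]. exists g. split; [now apply IH | auto].
Qed.

Lemma Plt_var m f : Plt m f -> Plt (S m) (fun t => t * f t).
Proof.
  revert f. induction m as [|m IH]; intros f Hf a.
  - exists (fun _ => 0). split; [simpl; auto|]. intros t. simpl in Hf. rewrite !Hf. ring.
  - destruct (Hf a) as [g [G1 G2]]. exists (fun t => 1 * f t + a * g t). split.
    + apply Plt_lin; [auto | now apply Plt_succ].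
    + intros t. rewrite (G2 t). ring.
Qed.

Lemma Plt_cst u : Plt 1 (fun _ => u).
Proof. intros a. exists (fun _ => 0). split; [simpl; auto | intros; ring]. Qed.

(** Each division by a root lowers the degree and keeps the other roots. *)
Lemma Plt_roots m f (z : nat -> R) : Plt m f ->
  (forall i, (i < m)%nat -> f (z i) = 0) ->
  (forall i j, (i < j < m)%nat -> z i <> z j) -> forall t, f t = 0.
Proof.
  revert f. induction m as [|m IH]; intros f Hf Hz Hd; [exact Hf|].
  destruct (Hf (z m)) as [g [G1 G2]].
  assert (Hg : forall t, g t = 0).
  { apply IH; auto.
    - intros i Hi. assert (E := Hz i ltac:(lia)). rewrite (G2 (z i)), (Hz m ltac:(lia)) in E.
      assert (z i <> z m) by (apply Hd; lia).
      apply (Rmult_eq_reg_l (z i - z m)); lra.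
    - intros i j Hij. apply Hd. lia. }
  intros t. rewrite G2, (Hz m ltac:(lia)), Hg. ring.
Qed.

Lemma Plt_continuous m f : Plt m f -> forall t, continuity_pt f t.
Proof.
  revert f. induction m as [|m IH]; intros f Hf t.
  - apply (continuity_pt_ext (fun _ => 0)); [intros; now rewrite Hf|]. apply continuity_pt_const. intros ? ?; auto.
  - destruct (Hf t) as [g [G1 G2]].
    apply (continuity_pt_ext (fun s => f t + (s - t) * g s)); [intros; now rewrite <- G2|].
    apply continuity_pt_plus; [apply continuity_pt_const; intros ? ?; auto|].
    apply continuity_pt_mult; [|now apply IH].
    apply continuity_pt_minus; [apply continuity_pt_id | apply continuity_pt_const; intros ? ?; auto].
Qed.

(** * The scheme as a one-step method *)

(** To first order in [theta] the step rotates [(eta, sqrt (2 q) G)], so the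
    quadratic form only changes at second order. *)
Lemma verlet_energy K Th q q' theta delta eta G eta' G' E :
  0 <= q <= K -> 0 <= q' <= K -> Rabs (q - q') <= K * delta -> 0 <= delta -> 0 <= theta <= 1 ->
  theta ^ 2 <= Th * delta -> 0 <= Th -> 0 <= E ->
  Rabs (eta - (eta' + 2 * theta * q' * G')) <= E -> Rabs (G - (G' - theta * eta')) <= E ->
  eta ^ 2 + 2 * q * G ^ 2 <= eta' ^ 2 + 2 * q' * G' ^ 2
    + (2 * K + (4 * K ^ 2 + 2 * K) * Th) * delta * (Rabs eta' + Rabs G') ^ 2
    + (2 + 8 * K) * (Rabs eta' + Rabs G') * E + (1 + 2 * K) * E ^ 2.
Proof.
  intros Hq Hq' Hqq Hd Hth Hth2 HTh HE H1 H2.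
  set (N := Rabs eta' + Rabs G').
  assert (N1 : Rabs eta' <= N) by (unfold N; generalize (Rabs_pos G'); lra).
  assert (N2 : Rabs G' <= N) by (unfold N; generalize (Rabs_pos eta'); lra).
  assert (N0 : 0 <= N) by (eapply Rle_trans; [apply Rabs_pos | exact N1]).
  set (u := eta' + 2 * theta * q' * G') in *. set (v := G' - theta * eta') in *.
  assert (Hv : Rabs v <= N).
  { unfold v, N, Rminus. rewrite Rplus_comm. apply Rabs_add_le; [|lra].
    rewrite Rabs_Ropp, <- (Rmult_1_l (Rabs eta')). apply Rabs_mul_le; [|lra]. rewrite Rabs_right; lra. }
  assert (Hu : Rabs u <= (1 + 2 * K) * N).
  { unfold u. rewrite Rmult_plus_distr_r. apply Rabs_add_le; [lra|].
    apply Rabs_mul_le; auto. rewrite Rabs_right by (apply Rle_ge; apply Rmult_le_pos; lra).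
    assert (theta * q' <= 1 * K) by mono. lra. }
  assert (sq : forall s t, Rabs (s - t) <= E -> s ^ 2 <= t ^ 2 + 2 * Rabs t * E + E ^ 2).
  { intros s t Hst. assert (Rabs s <= Rabs t + E).
    { replace s with (t + (s - t)) by ring. apply Rabs_add_le; lra. }
    rewrite <- (pow2_abs s), <- (pow2_abs t). assert (0 <= Rabs s) by apply Rabs_pos.
    replace (Rabs t ^ 2 + 2 * Rabs t * E + E ^ 2) with ((Rabs t + E) ^ 2) by ring.
    apply pow_incr. lra. }
  assert (S1 := sq eta u H1). assert (S2 := sq G v H2).
  assert (S3 : 2 * Rabs u * E <= 2 * ((1 + 2 * K) * N) * E) by mono.
  assert (S4 : 2 * Rabs v * E <= 2 * N * E) by mono.
  assert (NE : 0 <= N * E) by pos.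
  assert (E2 : 0 <= E ^ 2) by pos.
  assert (S5 : 2 * q * G ^ 2 <= 2 * q * v ^ 2 + 2 * K * (2 * N * E + E ^ 2)).
  { assert (q * G ^ 2 <= q * (v ^ 2 + (2 * N * E + E ^ 2))) by mono.
    assert (q * (2 * N * E + E ^ 2) <= K * (2 * N * E + E ^ 2)) by mono. lra. }
  assert (Nv : v ^ 2 <= N ^ 2) by (rewrite <- (pow2_abs v); apply pow_incr; split; [apply Rabs_pos | auto]).
  assert (S6 : 2 * q * v ^ 2 <= 2 * q' * v ^ 2 + 2 * K * delta * N ^ 2).
  { assert (Rabs ((q - q') * v ^ 2) <= K * delta * N ^ 2).
    { apply Rabs_mul_le; auto. rewrite Rabs_right; auto. apply Rle_ge, pow2_ge_0. }
    apply Rabs_le_between in H. lra. }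
  assert (Ng : G' ^ 2 <= N ^ 2) by (rewrite <- (pow2_abs G'); apply pow_incr; split; [apply Rabs_pos | auto]).
  assert (Ne : eta' ^ 2 <= N ^ 2) by (rewrite <- (pow2_abs eta'); apply pow_incr; split; [apply Rabs_pos | auto]).
  assert (S7 : u ^ 2 + 2 * q' * v ^ 2 <= eta' ^ 2 + 2 * q' * G' ^ 2 + (4 * K ^ 2 + 2 * K) * (Th * delta) * N ^ 2).
  { replace (u ^ 2 + 2 * q' * v ^ 2) with (eta' ^ 2 + 2 * q' * G' ^ 2
      + theta ^ 2 * (4 * q' ^ 2 * G' ^ 2 + 2 * q' * eta' ^ 2)) by (unfold u, v; ring).
    assert (T1 : 4 * q' ^ 2 * G' ^ 2 <= 4 * K ^ 2 * N ^ 2).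
    { apply Rmult_le_compat; auto; try apply pow2_ge_0.
      - apply Rmult_le_pos; [lra | apply pow2_ge_0].
      - apply Rmult_le_compat_l; [lra | apply pow_incr; lra]. }
    assert (T2 : 2 * q' * eta' ^ 2 <= 2 * K * N ^ 2) by (apply Rmult_le_compat; try apply pow2_ge_0; lra).
    assert (T3 : 0 <= 4 * K ^ 2 * N ^ 2 + 2 * K * N ^ 2).
    { apply Rplus_le_le_0_compat; apply Rmult_le_pos; try apply pow2_ge_0; [apply Rmult_le_pos; [lra | apply pow2_ge_0] | lra]. }
    assert (theta ^ 2 * (4 * q' ^ 2 * G' ^ 2 + 2 * q' * eta' ^ 2) <= Th * delta * (4 * K ^ 2 * N ^ 2 + 2 * K * N ^ 2)).
    { apply Rle_trans with (theta ^ 2 * (4 * K ^ 2 * N ^ 2 + 2 * K * N ^ 2)).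
      - apply Rmult_le_compat_l; [apply pow2_ge_0 | lra].
      - apply Rmult_le_compat_r; lra. }
    lra. }
  lra.
Qed.

(** One step of the scheme, from a node to its left neighbour, for the error
    [(eta, e)] of the pair (slope, value); [t1] and [t2] are the truncation errors
    of the value and of the slope. The step is a half kick of the slope, a drift
    of the value and another half kick; the terms of order [theta = w delta] form
    the rotation of [verlet_energy], and everything else is of order [delta]. The
    truncation errors enter squared and divided by [delta], so that errors of
    third order in [delta] add up to a second-order error over the whole grid. *)
Lemma verlet_step K Th : 1 <= K -> 0 <= Th -> exists C, 1 <= C /\
  forall w lam delta a a' q q' c c' e eta e' eta' t1 t2 S,
  1 <= w -> w ^ 2 = lam + 2 -> 0 < delta -> K * delta <= / 2 -> delta <= 1 ->
  w ^ 2 * delta <= Th -> Th * delta <= 1 ->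
  Rabs a <= K -> Rabs a' <= K -> 0 <= q <= K -> 0 <= q' <= K -> Rabs c <= K -> Rabs c' <= K ->
  Rabs (q - q') <= K * delta ->
  w * Rabs t1 <= S -> Rabs t2 <= S ->
  e = e' - delta * ((1 + a' * delta) * eta' - (c' - lam * q') * delta * e') + t1 ->
  (1 - a * delta) * eta + (c - lam * q) * delta * e
    = (1 + a' * delta) * eta' - (c' - lam * q') * delta * e' + t2 ->
  eta ^ 2 + 2 * q * (w * e) ^ 2 <= eta' ^ 2 + 2 * q' * (w * e') ^ 2
    + C * delta * (Rabs eta' + Rabs (w * e')) ^ 2 + C * (S ^ 2 / delta).
Proof.
  intros HK HTh.
  set (C2 := 4 * K + K * Th + 1).
  set (C3 := 4 * K + 7 * K + K * Th + 4 * K * C2 + 1).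
  set (C4 := 2 * (C3 + 3 * K ^ 2 + K)).
  set (Q := 2 * K + (4 * K ^ 2 + 2 * K) * Th).
  exists (Q + (2 + 8 * K) * C4 * 2 + (1 + 2 * K) * C4 ^ 2 * 2 + 1).
  assert (HC2 : 1 <= C2) by (unfold C2; nra).
  assert (HKT : 0 <= K * Th) by pos.
  assert (HKC2 : 1 <= K * C2) by nra.
  assert (HC3 : 1 <= C3) by (unfold C3; lra).
  assert (HK2 : 1 <= K ^ 2) by nra.
  assert (HC4 : 1 <= C4) by (unfold C4; lra).
  assert (HC42 : 1 <= C4 ^ 2) by nra.
  assert (HQ : 0 <= Q).
  { unfold Q. assert (0 <= (4 * K ^ 2 + 2 * K) * Th) by pos. lra. }
  assert (HKC4 : 1 <= K * C4) by nra. assert (HKC42 : 1 <= K * C4 ^ 2) by nra.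
  split; [lra|].
  intros w lam delta a a' q q' c c' e eta e' eta' t1 t2 S Hw Hlam Hd HKd Hd1 HwT HTd Ha Ha' Hq Hq'
    Hc Hc' Hqq Ht1 Ht2 He Heta.
  set (theta := w * delta). set (G := w * e). set (G' := w * e'). set (N := Rabs eta' + Rabs G').
  assert (S0 : 0 <= S) by (eapply Rle_trans; [apply Rabs_pos | exact Ht2]).
  assert (N1 : Rabs eta' <= N) by (unfold N; generalize (Rabs_pos G'); lra).
  assert (N2 : Rabs G' <= N) by (unfold N; generalize (Rabs_pos eta'); lra).
  assert (N0 : 0 <= N) by (eapply Rle_trans; [apply Rabs_pos | exact N1]).
  assert (Hth2 : theta ^ 2 <= Th * delta).
  { unfold theta. replace ((w * delta) ^ 2) with (w ^ 2 * delta * delta) by ring.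
    apply Rmult_le_compat_r; lra. }
  assert (Hth0 : 0 <= theta) by (unfold theta; apply Rmult_le_pos; lra).
  assert (Hth1 : theta <= 1) by nra.
  assert (abs_e : forall u, Rabs u <= Rabs (w * u)).
  { intros u. rewrite Rabs_mult, (Rabs_right w) by lra. generalize (Rabs_pos u). nra. }
  assert (Ne' : Rabs e' <= N) by (eapply Rle_trans; [apply abs_e | exact N2]).
  set (D := (1 + a' * delta) * eta' - (c' - lam * q') * delta * e') in *.
  set (r1 := D - (eta' + theta * q' * G')).
  assert (Hr1 : Rabs r1 <= 4 * K * delta * N).
  { unfold r1. replace (D - (eta' + theta * q' * G')) with (delta * (a' * eta' + - ((c' + 2 * q') * e'))).
    2:{ unfold D, theta, G'. replace lam with (w ^ 2 - 2) by lra. ring. }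
    replace (4 * K * delta * N) with (delta * (K * N + 3 * K * N)) by ring.
    apply Rabs_mul_le; [rewrite Rabs_right; lra|]. apply Rabs_add_le; [now apply Rabs_mul_le|].
    rewrite Rabs_Ropp. apply Rabs_mul_le; auto. apply Rabs_le_between in Hc'. apply Rabs_le. lra. }
  assert (HthG : Rabs (theta * q' * G') <= theta * K * N).
  { apply Rabs_mul_le; auto. apply Rabs_mul_le; rewrite Rabs_right; lra. }
  assert (H2 : Rabs (G - (G' - theta * eta')) <= C2 * (delta * N + S)).
  { replace (G - (G' - theta * eta')) with (- (theta ^ 2 * (q' * G')) + - (theta * r1) + w * t1).
    2:{ unfold G, G'. rewrite He. unfold r1, theta, G'. ring. }
    apply Rle_trans with (Th * delta * (K * N) + 1 * (4 * K * delta * N) + S).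
    - apply Rabs_add_le; [apply Rabs_add_le|].
      + rewrite Rabs_Ropp. apply Rabs_mul_le.
        * rewrite Rabs_right; auto. apply Rle_ge, pow2_ge_0.
        * apply Rabs_mul_le; auto. rewrite Rabs_right; lra.
      + rewrite Rabs_Ropp. apply Rabs_mul_le; auto. rewrite Rabs_right; lra.
      + rewrite Rabs_mult, (Rabs_right w) by lra. exact Ht1.
    - unfold C2. assert (0 <= delta * N) by pos.
      assert (0 <= K * Th * S) by pos. assert (0 <= K * S) by pos. lra. }
  assert (HN' : 0 <= delta * N) by pos.
  set (E2 := C2 * (delta * N + S)) in *.
  assert (HE2 : 0 <= E2) by (unfold E2; apply Rmult_le_pos; lra).
  assert (HG : Rabs (G - G') <= theta * N + E2).
  { replace (G - G') with (- (theta * eta') + (G - (G' - theta * eta'))) by ring.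
    apply Rabs_add_le; auto. rewrite Rabs_Ropp. apply Rabs_mul_le; auto. rewrite Rabs_right; lra. }
  assert (HG2 : Rabs G <= 2 * N + E2).
  { replace G with (G' + (G - G')) by ring. eapply Rle_trans; [apply Rabs_add_le; [exact N2 | exact HG]|]. nra. }
  set (u := eta' + 2 * theta * q' * G').
  set (r3 := (1 - a * delta) * eta - u).
  assert (Hr3 : Rabs r3 <= C3 * (delta * N + S)).
  { unfold r3. replace ((1 - a * delta) * eta - u)
      with (r1 + theta * (q - q') * G' + theta * q * (G - G') + - (delta * ((2 * q + c) * e)) + t2).
    2:{ unfold r1, u. replace ((1 - a * delta) * eta) with (D - (c - lam * q) * delta * e + t2) by lra.
        unfold theta, G, G'. replace lam with (w ^ 2 - 2) by lra. ring. }
    apply Rle_trans with (4 * K * delta * N + 1 * (K * delta) * N + K * (Th * delta * N + 1 * E2)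
      + delta * (3 * K * (2 * N + E2)) + S).
    - repeat apply Rabs_add_le; auto.
      + apply Rabs_mul_le; auto. apply Rabs_mul_le; auto. rewrite Rabs_right; lra.
      + rewrite (Rmult_comm theta q), Rmult_assoc. apply Rabs_mul_le; [rewrite Rabs_right; lra|].
        rewrite Rabs_mult, (Rabs_right theta) by lra.
        apply Rle_trans with (theta * (theta * N + E2)); [apply Rmult_le_compat_l; lra|].
        replace (theta * (theta * N + E2)) with (theta ^ 2 * N + theta * E2) by ring.
        apply Rplus_le_compat; apply Rmult_le_compat_r; lra.
      + rewrite Rabs_Ropp. apply Rabs_mul_le; [rewrite Rabs_right; lra|]. apply Rabs_mul_le.
        * apply Rabs_le_between in Hc. apply Rabs_le. lra.
        * eapply Rle_trans; [apply abs_e | exact HG2].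
    - assert (delta * (3 * K * (2 * N + E2)) <= 6 * K * (delta * N) + 3 * K * E2).
      { assert (delta * (K * E2) <= 1 * (K * E2)) by (apply Rmult_le_compat_r; [apply Rmult_le_pos; lra | lra]). nra. }
      unfold C3. unfold E2 in *. assert (0 <= K * S) by pos.
      assert (0 <= K * Th * S) by pos. nra. }
  assert (Had : Rabs (a * delta) <= / 2).
  { eapply Rle_trans; [apply Rabs_mul_le; [exact Ha | apply Rle_refl]|]. rewrite Rabs_right; lra. }
  apply Rabs_le_between in Had.
  assert (Hu : Rabs u <= 3 * K * N).
  { unfold u. apply Rle_trans with (N + 2 * K * N); [|nra]. apply Rabs_add_le; auto.
    apply Rabs_mul_le; auto. rewrite Rabs_right by (apply Rle_ge; apply Rmult_le_pos; lra).
    assert (theta * q' <= 1 * K) by mono. lra. }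
  assert (H1 : Rabs (eta - u) <= C4 * (delta * N + S)).
  { replace (eta - u) with ((r3 + delta * (a * u)) * / (1 - a * delta)) by (unfold r3; field; lra).
    apply Rle_trans with ((C3 * (delta * N + S) + delta * (K * (3 * K * N))) * 2).
    - apply Rabs_mul_le.
      + apply Rabs_add_le; auto. apply Rabs_mul_le; [rewrite Rabs_right; lra|]. now apply Rabs_mul_le.
      + rewrite Rabs_right by pos.
        rewrite <- (Rinv_inv 2). apply Rinv_le_contravar; lra.
    - unfold C4. assert (0 <= K ^ 2 * S) by pos. assert (0 <= K * (delta * N + S)) by pos. nra. }
  assert (H2' : Rabs (G - (G' - theta * eta')) <= C4 * (delta * N + S)).
  { eapply Rle_trans; [exact H2|]. unfold E2. apply Rmult_le_compat_r; [lra|].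
    unfold C4, C3. nra. }
  assert (HE : 0 <= C4 * (delta * N + S)) by pos.
  assert (Hfin := verlet_energy K Th q q' theta delta eta G eta' G' (C4 * (delta * N + S)) Hq Hq' Hqq
    ltac:(lra) (conj Hth0 Hth1) Hth2 HTh HE H1 H2').
  fold N in Hfin. fold Q in Hfin.
  eapply Rle_trans; [exact Hfin|].
  set (T := S ^ 2 / delta).
  assert (HT : S ^ 2 = T * delta) by (unfold T; field; lra).
  assert (HT0 : 0 <= T) by (unfold T; apply Rmult_le_pos; [apply pow2_ge_0 | left; now apply Rinv_0_lt_compat]).
  set (M := delta * N ^ 2). assert (HM : 0 <= M) by (unfold M; apply Rmult_le_pos; [lra | apply pow2_ge_0]).
  assert (HNS : N * S <= M + T).
  { apply Rmult_le_reg_r with delta; auto. rewrite Rmult_plus_distr_r, <- HT. unfold M.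
    generalize (pow2_ge_0 (delta * N - S)). intros.
    assert (0 <= (delta * N) ^ 2) by pos. assert (0 <= S ^ 2) by pos. lra. }
  assert (A1 : N * (C4 * (delta * N + S)) <= 2 * C4 * (M + T)).
  { replace (N * (C4 * (delta * N + S))) with (C4 * (M + N * S)) by (unfold M; ring).
    assert (C4 * (M + N * S) <= C4 * (2 * (M + T))) by mono. lra. }
  assert (A2 : (C4 * (delta * N + S)) ^ 2 <= 2 * C4 ^ 2 * (M + T)).
  { replace ((C4 * (delta * N + S)) ^ 2) with (C4 ^ 2 * (delta * N + S) ^ 2) by ring.
    replace (2 * C4 ^ 2 * (M + T)) with (C4 ^ 2 * (2 * (M + T))) by ring.
    apply Rmult_le_compat_l; [apply pow2_ge_0|].
    assert ((delta * N) ^ 2 <= M).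
    { unfold M. replace ((delta * N) ^ 2) with (delta * (delta * N ^ 2)) by ring.
      rewrite <- (Rmult_1_l (delta * N ^ 2)) at 2. apply Rmult_le_compat_r; [exact HM | lra]. }
    assert (S ^ 2 <= T).
    { rewrite HT. rewrite <- (Rmult_1_r T) at 2. apply Rmult_le_compat_l; lra. }
    generalize (pow2_ge_0 (delta * N - S)). lra. }
  assert (A3 : (2 + 8 * K) * N * (C4 * (delta * N + S)) <= (2 + 8 * K) * (2 * C4 * (M + T))).
  { rewrite Rmult_assoc. apply Rmult_le_compat_l; lra. }
  assert (A4 : (1 + 2 * K) * (C4 * (delta * N + S)) ^ 2 <= (1 + 2 * K) * (2 * C4 ^ 2 * (M + T))).
  { apply Rmult_le_compat_l; lra. }
  replace (Q * delta * N ^ 2) with (Q * M) by (unfold M; ring).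
  replace ((Q + (2 + 8 * K) * C4 * 2 + (1 + 2 * K) * C4 ^ 2 * 2 + 1) * delta * N ^ 2)
    with ((Q + (2 + 8 * K) * C4 * 2 + (1 + 2 * K) * C4 ^ 2 * 2 + 1) * M) by (unfold M; ring).
  assert (0 <= Q * T) by pos. lra.
Qed.

(** * The shooting function *)

(** With [a = mu / sigma^2], [q = 1 / sigma^2] and [c = kappa / sigma^2] the
    eigenvalue equation reads [y'' = - 2 a y' + 2 (c - lam q) y].  The three
    coefficients are twice differentiable in the two-sided sense at each point
    of the closed interval, and merely continuous elsewhere. *)
Record sticky_problem := StickyProblem {
  lft : R; rgt : R; stick : R;
  ca : R -> R; ca1 : R -> R; ca2 : R -> R;
  cq : R -> R; cq1 : R -> R; cq2 : R -> R;
  cc : R -> R; cc1 : R -> R; cc2 : R -> R;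
  bnd : R; q_low : R;
  lft_rgt : lft < rgt;
  stick_pos : 0 < stick;
  ca_cont : forall x, continuous ca x;
  cq_cont : forall x, continuous cq x;
  cc_cont : forall x, continuous cc x;
  ca_derive : forall x, lft <= x <= rgt -> is_derive ca x (ca1 x);
  ca1_derive : forall x, lft <= x <= rgt -> is_derive ca1 x (ca2 x);
  cq_derive : forall x, lft <= x <= rgt -> is_derive cq x (cq1 x);
  cq1_derive : forall x, lft <= x <= rgt -> is_derive cq1 x (cq2 x);
  cc_derive : forall x, lft <= x <= rgt -> is_derive cc x (cc1 x);
  cc1_derive : forall x, lft <= x <= rgt -> is_derive cc1 x (cc2 x);
  bnd_ge1 : 1 <= bnd;
  ca_bnd : forall x, lft <= x <= rgt -> Rabs (ca x) <= bnd;
  ca1_bnd : forall x, lft <= x <= rgt -> Rabs (ca1 x) <= bnd;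
  ca2_bnd : forall x, lft <= x <= rgt -> Rabs (ca2 x) <= bnd;
  cq_bnd : forall x, lft <= x <= rgt -> Rabs (cq x) <= bnd;
  cq1_bnd : forall x, lft <= x <= rgt -> Rabs (cq1 x) <= bnd;
  cq2_bnd : forall x, lft <= x <= rgt -> Rabs (cq2 x) <= bnd;
  cc_bnd : forall x, lft <= x <= rgt -> Rabs (cc x) <= bnd;
  cc1_bnd : forall x, lft <= x <= rgt -> Rabs (cc1 x) <= bnd;
  cc2_bnd : forall x, lft <= x <= rgt -> Rabs (cc2 x) <= bnd;
  q_low_pos : 0 < q_low;
  q_low_le : forall x, lft <= x <= rgt -> q_low <= cq x;
  cc_nonneg : forall x, lft <= x <= rgt -> 0 <= cc x
}.

Section Sticky.

Variable P : sticky_problem.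
Notation l := (lft P).
Notation r := (rgt P).
Notation rho := (stick P).
Notation a := (ca P).
Notation q := (cq P).
Notation c := (cc P).
Notation K := (bnd P).

Definition inside (x : R) : Prop := l <= x <= r.

Definition solves (lam : R) (f y z : R -> R) : Prop :=
  forall x, inside x -> is_derive y x (z x) /\
    is_derive z x (- 2 * a x * z x + 2 * (c x - lam * cq P x) * y x + f x).

Definition om (lam : R) : R := sqrt (lam + 2).

Lemma om_sqr lam : -1 <= lam -> om lam ^ 2 = lam + 2.
Proof. intros H. unfold om. rewrite pow2_sqrt; lra. Qed.

Lemma om_ge1 lam : -1 <= lam -> 1 <= om lam.
Proof. intros H. rewrite <- sqrt_1. apply sqrt_le_1_alt. lra. Qed.

(** The slope and the value weighted by the frequency have comparable sizes;
    [z^2 + 2 om^2 q y^2] varies by a factor that does not depend on [lam]. *)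
Lemma energy_derivative : exists C, 0 < C /\ forall lam f y z b, -1 <= lam -> 0 <= b ->
  solves lam f y z -> (forall x, inside x -> Rabs (f x) <= b) ->
  exists E E1 : R -> R, forall x, inside x ->
    is_derive E x (E1 x) /\ Rabs (E1 x) <= C * E x + b ^ 2 /\
    z x ^ 2 + (lam + 2) * y x ^ 2 <= C * E x /\
    E x <= C * (z x ^ 2 + (lam + 2) * y x ^ 2).
Proof.
  generalize (bnd_ge1 P) (q_low_pos P). intros HK Hq0.
  set (k0 := Rmin 1 (2 * q_low P)).
  assert (Hk0 : 0 < k0) by (apply Rmin_pos; lra).
  assert (Hk1 : k0 <= 1) by apply Rmin_l. assert (Hk2 : k0 <= 2 * q_low P) by apply Rmin_r.
  exists (11 * K / k0).
  assert (HC : 11 * K <= 11 * K / k0).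
  { apply Rmult_le_reg_r with k0; auto. replace (11 * K / k0 * k0) with (11 * K) by (field; lra). nra. }
  split; [lra|].
  intros lam f y z b Hlam Hb Hs Hf.
  exists (fun x => z x ^ 2 + 2 * (lam + 2) * (q x * y x ^ 2)),
    (fun x => -4 * a x * z x ^ 2 + 4 * (c x + 2 * q x) * y x * z x + 2 * z x * f x
              + 2 * (lam + 2) * cq1 P x * y x ^ 2).
  intros x Hx. destruct (Hs x Hx) as [Hy Hz].
  assert (Hq' := cq_derive P x Hx).
  generalize (ca_bnd P x Hx) (cq_bnd P x Hx) (cq1_bnd P x Hx) (cc_bnd P x Hx) (q_low_le P x Hx) (Hf x Hx).
  intros Ba Bq Bq1 Bc Bl Bf.
  apply Rabs_le_between in Ba, Bq, Bq1, Bc, Bf.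
  set (N := z x ^ 2 + (lam + 2) * y x ^ 2).
  assert (HN1 : k0 * N <= z x ^ 2 + 2 * (lam + 2) * (q x * y x ^ 2)).
  { unfold N. assert (0 <= (lam + 2) * y x ^ 2) by pos.
    generalize (pow2_ge_0 (z x)). intros.
    assert (k0 * ((lam + 2) * y x ^ 2) <= 2 * q x * ((lam + 2) * y x ^ 2))
      by mono. nra. }
  assert (HN2 : z x ^ 2 + 2 * (lam + 2) * (q x * y x ^ 2) <= 2 * K * N).
  { unfold N. assert (0 <= (lam + 2) * y x ^ 2) by pos.
    generalize (pow2_ge_0 (z x)). intros.
    assert (q x * ((lam + 2) * y x ^ 2) <= K * ((lam + 2) * y x ^ 2))
      by mono. nra. }
  assert (HN0 : 0 <= N).
  { unfold N. apply Rplus_le_le_0_compat; [apply pow2_ge_0 | apply Rmult_le_pos; [lra | apply pow2_ge_0]]. }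
  assert (HNE : 11 * K * N <= 11 * K / k0 * (z x ^ 2 + 2 * (lam + 2) * (q x * y x ^ 2))).
  { replace (11 * K * N) with (11 * K / k0 * (k0 * N)) by (field; lra).
    apply Rmult_le_compat_l; lra. }
  split; [|split; [|split]].
  - derive. cbn. ring.
  - eapply Rle_trans; [|apply Rplus_le_compat_r, HNE].
    assert (Hyz : Rabs (y x * z x) <= N / 2).
    { unfold N. apply Rabs_le. generalize (pow2_ge_0 (y x - z x)) (pow2_ge_0 (y x + z x)) (pow2_ge_0 (y x)).
      intros. assert (0 <= (lam + 1) * y x ^ 2) by pos. split; nra. }
    apply Rabs_le_between in Hyz.
    assert (H1 : Rabs (a x * z x ^ 2) <= K * z x ^ 2).
    { rewrite Rabs_mult, (Rabs_right (z x ^ 2)) by (apply Rle_ge, pow2_ge_0).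
      apply Rmult_le_compat_r; [apply pow2_ge_0 | apply Rabs_le; lra]. }
    assert (H2 : Rabs ((c x + 2 * q x) * (y x * z x)) <= 3 * K * (N / 2)).
    { rewrite Rabs_mult. apply Rmult_le_compat; try apply Rabs_pos; apply Rabs_le; lra. }
    assert (H3 : Rabs (2 * z x * f x) <= z x ^ 2 + b ^ 2).
    { assert (f x ^ 2 <= b ^ 2) by (rewrite <- (pow2_abs (f x)); apply pow_incr; split;
        [apply Rabs_pos | apply Rabs_le; lra]).
      apply Rabs_le. generalize (pow2_ge_0 (z x - f x)) (pow2_ge_0 (z x + f x)). intros; split; nra. }
    assert (H4 : Rabs (cq1 P x * ((lam + 2) * y x ^ 2)) <= K * ((lam + 2) * y x ^ 2)).
    { assert (0 <= (lam + 2) * y x ^ 2) by pos.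
      rewrite Rabs_mult, (Rabs_right ((lam + 2) * _)) by lra.
      apply Rmult_le_compat_r; [lra | apply Rabs_le; lra]. }
    apply Rabs_le_between in H1, H2, H3, H4. apply Rabs_le. unfold N in *.
    generalize (pow2_ge_0 (z x)). intros.
    assert (0 <= (lam + 2) * y x ^ 2) by pos.
    assert (z x ^ 2 <= K * z x ^ 2) by nra.
    split; nra.
  - fold N. eapply Rle_trans; [|exact HNE]. nra.
  - fold N. eapply Rle_trans; [exact HN2|]. apply Rmult_le_compat_r; lra.
Qed.

Lemma energy_upper : exists C, 1 <= C /\ forall lam f y z b, -1 <= lam -> 0 <= b ->
  solves lam f y z -> (forall x, inside x -> Rabs (f x) <= b) -> forall x, inside x ->
  z x ^ 2 + (lam + 2) * y x ^ 2 <= C * (z r ^ 2 + (lam + 2) * y r ^ 2 + b ^ 2).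
Proof.
  destruct energy_derivative as [C [HC H]]. generalize (lft_rgt P). intros Hlr.
  set (D := exp (C * (r - l))).
  assert (HD : 1 <= D) by (rewrite <- exp_0; apply exp_le; nra).
  exists (C * D * (C + / C) + 1).
  assert (HCi : 0 < / C) by pos.
  assert (0 < C * D) by pos.
  assert (0 < C * D * (C + / C)) by pos.
  split; [lra|]. intros lam f y z b Hlam Hb Hs Hf x Hx.
  destruct (H lam f y z b Hlam Hb Hs Hf) as [E [E1 HE]].
  assert (Hr : inside r) by (unfold inside; lra).
  destruct (HE x Hx) as [_ [_ [Hx1 _]]]. destruct (HE r Hr) as [_ [_ [_ Hr2]]].
  assert (G : E x + b ^ 2 / C <= exp (C * (r - x)) * (E r + b ^ 2 / C)).
  { apply (gronwall_left E E1 l r); auto; try lra.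
    - intros t Ht. now apply HE.
    - intros t Ht. destruct (HE t Ht) as [_ [B _]]. apply Rabs_le_between in B. lra. }
  set (N := z r ^ 2 + (lam + 2) * y r ^ 2) in *.
  assert (0 <= N).
  { unfold N. apply Rplus_le_le_0_compat; [apply pow2_ge_0 | apply Rmult_le_pos; [lra | apply pow2_ge_0]]. }
  assert (Hb2 := pow2_ge_0 b).
  assert (0 <= b ^ 2 / C) by pos.
  assert (HCN : 0 <= C * N) by pos.
  assert (G2 : E x <= D * (C * N + b ^ 2 / C)).
  { assert (exp (C * (r - x)) * (E r + b ^ 2 / C) <= D * (C * N + b ^ 2 / C)); [|lra].
    apply Rle_trans with (exp (C * (r - x)) * (C * N + b ^ 2 / C)).
    - apply Rmult_le_compat_l; [left; apply exp_pos | lra].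
    - apply Rmult_le_compat_r; [lra|]. apply exp_le. unfold inside in Hx. nra. }
  eapply Rle_trans; [exact Hx1|].
  apply Rle_trans with (C * D * (C * N + b ^ 2 / C)).
  - rewrite Rmult_assoc. apply Rmult_le_compat_l; lra.
  - apply Rle_trans with (C * D * ((C + / C) * (N + b ^ 2))); [|nra].
    apply Rmult_le_compat_l; [lra|]. unfold Rdiv. nra.
Qed.

(** The same differential inequality, integrated towards the right end: a solution
    cannot fade out, whatever its frequency. This is the source of all lower
    bounds that are uniform in [lam]. *)
Lemma energy_lower : exists k, 0 < k /\ forall lam y z, -1 <= lam ->
  solves lam (fun _ => 0) y z -> forall x, inside x ->
  k * (z r ^ 2 + (lam + 2) * y r ^ 2) <= z x ^ 2 + (lam + 2) * y x ^ 2.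
Proof.
  destruct energy_derivative as [C [HC H]]. generalize (lft_rgt P). intros Hlr.
  set (D := exp (C * (r - l))).
  assert (HD : 1 <= D) by (rewrite <- exp_0; apply exp_le; nra).
  exists (/ (C * D * C)).
  assert (HD' : 0 < C * D * C) by (repeat apply Rmult_lt_0_compat; lra).
  split; [now apply Rinv_0_lt_compat|]. intros lam y z Hlam Hs x Hx.
  destruct (H lam _ y z 0 Hlam (Rle_refl 0) Hs) as [E [E1 HE]].
  { intros. rewrite Rabs_R0; lra. }
  assert (Hr : inside r) by (unfold inside; lra).
  destruct (HE x Hx) as [_ [_ [_ Hx2]]]. destruct (HE r Hr) as [_ [_ [Hr1 _]]].
  assert (G : E r <= exp (C * (r - x)) * E x).
  { apply (gronwall_right E E1 l r); auto; try lra.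
    - intros t Ht. now apply HE.
    - intros t Ht. destruct (HE t Ht) as [_ [B _]]. apply Rabs_le_between in B. lra. }
  set (N := z r ^ 2 + (lam + 2) * y r ^ 2) in *.
  set (M := z x ^ 2 + (lam + 2) * y x ^ 2) in *.
  assert (0 <= M).
  { unfold M. apply Rplus_le_le_0_compat; [apply pow2_ge_0 | apply Rmult_le_pos; [lra | apply pow2_ge_0]]. }
  assert (G2 : E r <= D * (C * M)).
  { eapply Rle_trans; [exact G|]. apply Rle_trans with (exp (C * (r - x)) * (C * M)).
    - apply Rmult_le_compat_l; [left; apply exp_pos | lra].
    - apply Rmult_le_compat_r; [nra|]. apply exp_le. unfold inside in Hx. nra. }
  apply Rmult_le_reg_l with (C * D * C); auto.
  rewrite <- Rmult_assoc, Rinv_r, Rmult_1_l by lra.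
  eapply Rle_trans; [exact Hr1|]. replace (C * D * C * M) with (C * (D * (C * M))) by ring.
  apply Rmult_le_compat_l; lra.
Qed.

Lemma inside_lft : inside l.
Proof. generalize (lft_rgt P). unfold inside. lra. Qed.

Lemma inside_rgt : inside r.
Proof. generalize (lft_rgt P). unfold inside. lra. Qed.

(** Shooting starts at the right end, where the eigenfunctions vanish: the slope
    there is their natural normalisation, uniformly in the frequency. *)
Definition W (lam : R) : R -> R :=
  ode_value (fun t => - 2 * a t) (fun t => 2 * (c t - lam * q t)) r 0 (-1).
Definition V (lam : R) : R -> R :=
  ode_slope (fun t => - 2 * a t) (fun t => 2 * (c t - lam * q t)) r 0 (-1).

Lemma W_V_derive lam x : is_derive (W lam) x (V lam x) /\
  is_derive (V lam) x (- 2 * a x * V lam x + 2 * (c x - lam * q x) * W lam x).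
Proof.
  apply ode_solves; intros t; assert (H1 := ca_cont P); assert (H2 := cq_cont P);
    assert (H3 := cc_cont P); repeat cont_step.
Qed.

Lemma W_derive lam x : is_derive (W lam) x (V lam x).
Proof. apply W_V_derive. Qed.

Lemma V_derive lam x :
  is_derive (V lam) x (- 2 * a x * V lam x + 2 * (c x - lam * q x) * W lam x).
Proof. apply W_V_derive. Qed.

Lemma W_solves lam : solves lam (fun _ => 0) (W lam) (V lam).
Proof.
  intros x _. split; [apply W_derive|]. eapply is_derive_eq; [apply V_derive | ring].
Qed.

Lemma W_rgt lam : W lam r = 0.
Proof.
  exact (proj1 (ode_start _ _ _ _ _)).
Qed.

Lemma V_rgt lam : V lam r = -1.
Proof. exact (proj2 (ode_start _ _ _ _ _)). Qed.

Lemma amplitude_le lam y z B : -1 <= lam -> 0 <= B ->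
  z ^ 2 + (lam + 2) * y ^ 2 <= B ^ 2 -> Rabs z <= B /\ om lam * Rabs y <= B.
Proof.
  intros Hl HB H. assert (Ho := om_ge1 lam Hl).
  assert (Hz := pow2_ge_0 z). assert (0 <= (lam + 2) * y ^ 2) by pos.
  split.
  - apply Rsqr_incr_0_var; [|auto]. unfold Rsqr.
    rewrite <- (pow2_abs z) in *. lra.
  - apply Rsqr_incr_0_var; [|auto]. unfold Rsqr. rewrite <- (om_sqr lam Hl), <- (pow2_abs y) in *. lra.
Qed.

Lemma W_bound : exists C, 1 <= C /\ forall lam x, -1 <= lam -> inside x ->
  Rabs (V lam x) <= C /\ om lam * Rabs (W lam x) <= C.
Proof.
  destruct (energy_upper) as [C [HC H]]. exists C. split; auto. intros lam x Hl Hx.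
  apply amplitude_le; auto; try lra.
  eapply Rle_trans; [apply (H lam _ (W lam) (V lam) 0 Hl (Rle_refl 0) (W_solves lam))|]; auto.
  - intros. rewrite Rabs_R0; lra.
  - rewrite W_rgt, V_rgt. nra.
Qed.

Lemma W_lower : exists k, 0 < k /\ forall lam x, -1 <= lam -> inside x ->
  k <= V lam x ^ 2 + (lam + 2) * W lam x ^ 2.
Proof.
  destruct (energy_lower) as [k [Hk H]]. exists k. split; auto. intros lam x Hl Hx.
  generalize (H lam (W lam) (V lam) Hl (W_solves lam) x Hx). rewrite W_rgt, V_rgt. nra.
Qed.

Lemma om_close lam lam' : -1 <= lam -> -1 <= lam' -> lam <= lam' + 1 -> om lam <= 2 * om lam'.
Proof.
  intros H H' Hd. unfold om.
  assert (E : sqrt 4 = 2) by (replace 4 with (2 * 2) by ring; apply sqrt_square; lra).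
  rewrite <- E at 2.
  rewrite <- sqrt_mult by lra. apply sqrt_le_1_alt. lra.
Qed.

(** The difference of [W lam'] and [W lam] starts from zero data and is driven by
    [2 (lam - lam') q W], which is of size [|lam' - lam| / om lam]. *)
Lemma W_lipschitz : exists C, 1 <= C /\ forall lam lam' x,
  -1 <= lam -> -1 <= lam' -> inside x ->
  Rabs (V lam' x - V lam x) <= C * Rabs (lam' - lam) / om lam /\
  om lam' * Rabs (W lam' x - W lam x) <= C * Rabs (lam' - lam) / om lam.
Proof.
  destruct (energy_upper) as [C [HC H]]. destruct W_bound as [B [HB HW]].
  assert (HK := bnd_ge1 P).
  exists (C * (2 * K * B)). split.
  { assert (1 <= K * B) by nra. nra. }
  intros lam lam' x Hl Hl' Hx. assert (Ho := om_ge1 lam Hl).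
  set (b := 2 * K * B * Rabs (lam' - lam) / om lam).
  assert (Hb : 0 <= b).
  { unfold b, Rdiv. apply Rmult_le_pos; [|left; apply Rinv_0_lt_compat; lra].
    apply Rmult_le_pos; [nra | apply Rabs_pos]. }
  replace (C * (2 * K * B) * Rabs (lam' - lam) / om lam) with (C * b) by (unfold b; field; lra).
  apply amplitude_le; auto; [nra|].
  assert (Hs : solves lam' (fun t => - 2 * (lam' - lam) * q t * W lam t)
    (fun t => W lam' t - W lam t) (fun t => V lam' t - V lam t)).
  { intros t _. split.
    - apply derive_sub; apply W_derive.
    - eapply is_derive_eq; [apply derive_sub; apply V_derive | ring]. }
  eapply Rle_trans; [apply (H lam' _ _ _ b Hl' Hb Hs)|]; auto.
  - intros t Ht. destruct (HW lam t Hl Ht) as [_ Hw].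
    rewrite !Rabs_mult, (Rabs_left (-2)) by lra.
    assert (Hq := cq_bnd P t Ht). unfold b.
    assert (Rabs (W lam t) <= B / om lam).
    { apply Rmult_le_reg_l with (om lam); [lra|]. replace (om lam * (B / om lam)) with B by (field; lra). auto. }
    replace (2 * K * B * Rabs (lam' - lam) / om lam) with (2 * Rabs (lam' - lam) * K * (B / om lam)) by (field; lra).
    replace (- (-2)) with 2 by ring.
    apply Rmult_le_compat; auto; try apply Rabs_pos.
    + apply Rmult_le_pos; [|apply Rabs_pos]. generalize (Rabs_pos (lam' - lam)); lra.
    + apply Rmult_le_compat_l; auto. generalize (Rabs_pos (lam' - lam)); lra.
  - rewrite !W_rgt, !V_rgt. replace ((-1 - -1) ^ 2 + (lam' + 2) * (0 - 0) ^ 2 + b ^ 2) with (b ^ 2) by ring.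
    assert (0 <= b ^ 2) by pos. nra.
Qed.

Lemma solves_unique lam y z : -1 <= lam -> solves lam (fun _ => 0) y z -> y r = 0 ->
  forall x, inside x -> y x = - z r * W lam x /\ z x = - z r * V lam x.
Proof.
  intros Hl Hs Hy x Hx. destruct (energy_upper) as [C [HC H]].
  assert (Hs' : solves lam (fun _ => 0) (fun t => y t + z r * W lam t) (fun t => z t + z r * V lam t)).
  { intros t Ht. destruct (Hs t Ht) as [H1 H2]. split.
    - assert (D1 := W_derive lam). derive. ring.
    - assert (D2 := V_derive lam). derive. ring. }
  generalize (H lam _ _ _ 0 Hl (Rle_refl 0) Hs' (fun t _ => eq_ind_r (fun u => u <= 0) (Rle_refl 0) Rabs_R0) x Hx).
  rewrite Hy, W_rgt, V_rgt. intros E.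
  assert (E1 : 0 <= (z x + z r * V lam x) ^ 2) by pos.
  assert (E2 : 0 <= (y x + z r * W lam x) ^ 2) by pos.
  assert (E3 : 0 <= (lam + 1) * (y x + z r * W lam x) ^ 2) by pos.
  assert (F1 : (z x + z r * V lam x) ^ 2 = 0) by lra.
  assert (F2 : (y x + z r * W lam x) ^ 2 = 0) by lra.
  assert (zero : forall u, u ^ 2 = 0 -> u = 0).
  { intros u Hu. destruct (Req_dec u 0) as [|n]; auto. now apply (pow_nonzero u 2) in n. }
  apply zero in F1, F2. lra.
Qed.

(** * The self-adjoint form and its identities *)

(** The reciprocal of the scale density: multiplied by it, the equation takes the
    self-adjoint form [(scale y')' = 2 scale (c - lam q) y]. *)
Definition scale (x : R) : R := exp (2 * RInt a l x).

Lemma scale_derive x : is_derive scale x (2 * a x * scale x).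
Proof.
  unfold scale. eapply is_derive_eq.
  - apply derive_exp. apply derive_mul; [apply derive_cst|].
    apply (is_derive_RInt a _ l); [|apply ca_cont].
    apply filter_forall. intros y. apply (@RInt_correct R_CompleteNormedModule).
    apply (@ex_RInt_continuous R_CompleteNormedModule). intros; apply ca_cont.
  - cbn beta. ring.
Qed.

Lemma scale_pos x : 0 < scale x.
Proof. apply exp_pos. Qed.

Lemma scale_lft : scale l = 1.
Proof. unfold scale. rewrite RInt_point. unfold zero; simpl. rewrite Rmult_0_r. apply exp_0. Qed.

Lemma scale_cont x : continuous scale x.
Proof. exact (continuous_of_derive _ _ _ (scale_derive x)). Qed.

(** The inner product for the speed measure, whose density is [2 scale q] and
    which has the mass [1 / rho] at the left end. *)
Definition inner (u v : R -> R) : R :=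
  RInt (fun x => 2 * scale x * q x * (u x * v x)) l r + u l * v l / rho.

(** The value of [kappa] at the left end. *)
Definition kap0 : R := c l / q l.

Lemma q_pos x : inside x -> 0 < q x.
Proof. intros H. generalize (q_low_pos P) (q_low_le P x H). lra. Qed.

Lemma kap0_nonneg : 0 <= kap0.
Proof.
  apply Rmult_le_pos; [apply cc_nonneg, inside_lft|].
  left. apply Rinv_0_lt_compat, q_pos, inside_lft.
Qed.

(** The defect in the boundary condition at the left end. *)
Definition residual (lam : R) (y z : R -> R) : R := rho * z l - (kap0 - lam) * y l.

Lemma solves_cont lam y z : solves lam (fun _ => 0) y z ->
  (forall x, inside x -> continuous y x) /\ (forall x, inside x -> continuous z x).
Proof.
  intros H. split; intros x Hx; destruct (H x Hx) as [H1 H2]; eapply continuous_of_derive; eassumption.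
Qed.

(** Integrate [(scale (u' v - u v'))']. The atom of the speed measure accounts for
    the part of the boundary condition that depends on [lam], so the boundary term
    at the left end consists of residuals alone. *)
Lemma wronskian lam lam' u u1 v v1 :
  solves lam (fun _ => 0) u u1 -> solves lam' (fun _ => 0) v v1 -> u r = 0 -> v r = 0 ->
  residual lam u u1 * v l - residual lam' v v1 * u l = rho * (lam - lam') * inner u v.
Proof.
  intros Hu Hv Hu0 Hv0. generalize (lft_rgt P) (stick_pos P). intros Hlr Hrho.
  destruct (solves_cont _ _ _ Hu) as [c1 c2], (solves_cont _ _ _ Hv) as [c3 c4].
  assert (C1 := scale_cont). assert (C2 := cq_cont P).
  assert (E : RInt (fun x => 0 + (lam' - lam) * (2 * scale x * q x * (u x * v x))) l r
    = scale r * (u1 r * v r - u r * v1 r) - scale l * (u1 l * v l - u l * v1 l)).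
  { apply (RInt_of_primitive _ (fun x => scale x * (u1 x * v x - u x * v1 x))); [lra| |].
    - intros x Hx. repeat cont_step.
    - intros x Hx. destruct (Hu x Hx) as [D1 D2], (Hv x Hx) as [D3 D4].
      assert (D5 := scale_derive). derive. ring. }
  rewrite (RInt_lin (fun _ => 0) (fun x => 2 * scale x * q x * (u x * v x))) in E.
  - rewrite RInt_const in E. unfold scal in E; simpl in E. unfold mult in E; simpl in E.
    rewrite Hu0, Hv0, scale_lft in E. unfold inner, residual.
    set (I := RInt _ l r) in *.
    replace (rho * (lam - lam') * (I + u l * v l / rho))
      with (- rho * ((lam' - lam) * I) + (lam - lam') * (u l * v l)) by (field; lra).
    replace ((lam' - lam) * I) with (- (u1 l * v l - u l * v1 l)) by lra. ring.
  - apply ex_RInt_const.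
  - apply ex_RInt_segment; [lra|]. intros x Hx. repeat cont_step.
Qed.

(** Integrate [(scale y y')']. For an eigenfunction all terms on the right are
    nonnegative, hence so are the eigenvalues. *)
Lemma energy_identity lam y z : solves lam (fun _ => 0) y z -> y r = 0 ->
  lam * inner y y = RInt (fun x => scale x * z x ^ 2 + 2 * scale x * c x * y x ^ 2) l r
    + kap0 * y l ^ 2 / rho + residual lam y z * y l / rho.
Proof.
  intros Hy Hy0. generalize (lft_rgt P) (stick_pos P). intros Hlr Hrho.
  destruct (solves_cont _ _ _ Hy) as [c1 c2].
  assert (C1 := scale_cont). assert (C2 := cq_cont P). assert (C3 := cc_cont P).
  assert (E : RInt (fun x => (scale x * z x ^ 2 + 2 * scale x * c x * y x ^ 2)
       + (- lam) * (2 * scale x * q x * (y x * y x))) l r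
    = scale r * (y r * z r) - scale l * (y l * z l)).
  { apply (RInt_of_primitive _ (fun x => scale x * (y x * z x))); [lra| |].
    - intros x Hx. repeat cont_step.
    - intros x Hx. destruct (Hy x Hx) as [D1 D2].
      assert (D5 := scale_derive). derive. ring. }
  rewrite (RInt_lin (fun x => scale x * z x ^ 2 + 2 * scale x * c x * y x ^ 2)
    (fun x => 2 * scale x * q x * (y x * y x))) in E.
  - rewrite Hy0, scale_lft in E. unfold inner, residual.
    set (I := RInt (fun x => 2 * _ * _ * _) l r) in *. set (J := RInt (fun x => _ + _) l r) in *.
    replace J with (lam * I - y l * z l) by lra. field. lra.
  - apply ex_RInt_segment; [lra|]. intros x Hx. repeat cont_step.
  - apply ex_RInt_segment; [lra|]. intros x Hx. repeat cont_step.
Qed.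

Definition shoot (lam : R) : R := residual lam (W lam) (V lam).

Lemma W_cont lam x : continuous (W lam) x.
Proof. exact (continuous_of_derive _ _ _ (W_derive lam x)). Qed.

Lemma V_cont lam x : continuous (V lam) x.
Proof. exact (continuous_of_derive _ _ _ (V_derive lam x)). Qed.

Lemma scale_bounds : exists m M, 0 < m /\ 1 <= M /\ forall x, inside x -> m <= scale x <= M.
Proof.
  assert (Hlr := lft_rgt P).
  destruct (positive_on_segment scale l r) as [m [Hm H1]]; [lra| | |].
  - intros; apply scale_cont.
  - intros; apply scale_pos.
  - destruct (bounded_on_segment scale l r) as [M [HM H2]]; [lra|intros; apply scale_cont|].
    exists m, (M + 1). split; [auto|]. split; [lra|]. intros x Hx. split; auto.
    specialize (H2 x Hx). apply Rabs_le_between in H2. lra.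
Qed.

Lemma inner_bound : exists M, 1 <= M /\ forall u v A B,
  (forall x, inside x -> continuous u x) -> (forall x, inside x -> continuous v x) ->
  (forall x, inside x -> Rabs (u x) <= A) -> (forall x, inside x -> Rabs (v x) <= B) ->
  Rabs (inner u v) <= M * (A * B).
Proof.
  destruct scale_bounds as [m [M [Hm [HM Hs]]]].
  assert (Hlr := lft_rgt P). assert (Hrho := stick_pos P). assert (HK := bnd_ge1 P).
  assert (Hir : 0 < / rho) by pos.
  exists ((r - l) * (2 * M * K) + / rho + 1).
  assert (0 <= (r - l) * (2 * M * K)) by (apply Rmult_le_pos; nra).
  split; [lra|]. intros u v A B Hu Hv HA HB.
  assert (A0 : 0 <= A) by (generalize (HA l (inside_lft)) (Rabs_pos (u l)); lra).
  assert (B0 : 0 <= B) by (generalize (HB l (inside_lft)) (Rabs_pos (v l)); lra).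
  assert (AB : 0 <= A * B) by (apply Rmult_le_pos; auto).
  assert (C1 := scale_cont). assert (C2 := cq_cont P).
  unfold inner. eapply Rle_trans; [apply Rabs_triang|].
  assert (H1 : Rabs (RInt (fun x => 2 * scale x * q x * (u x * v x)) l r) <= (r - l) * (2 * M * K * (A * B))).
  { apply abs_RInt_le_const; [lra| |].
    - apply ex_RInt_segment; [lra|]. intros; repeat cont_step.
    - intros t Ht. specialize (Hs t Ht). assert (Hq := cq_bnd P t Ht).
      rewrite !Rabs_mult. rewrite (Rabs_right 2), (Rabs_right (scale t)) by lra.
      apply Rmult_le_compat; try (apply Rmult_le_pos; try apply Rabs_pos; lra).
      + apply Rmult_le_compat; try lra. apply Rabs_pos.
      + apply Rmult_le_compat; auto; apply Rabs_pos. }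
  assert (H2 : Rabs (u l * v l / rho) <= A * B * / rho).
  { unfold Rdiv. rewrite !Rabs_mult. rewrite (Rabs_right (/ rho)) by lra.
    apply Rmult_le_compat_r; [lra|].
    apply Rmult_le_compat; try apply Rabs_pos; [apply HA | apply HB]; apply inside_lft. }
  nra.
Qed.

Lemma inner_sub_r u v w : (forall x, inside x -> continuous u x) ->
  (forall x, inside x -> continuous v x) -> (forall x, inside x -> continuous w x) ->
  inner u (fun x => v x - w x) = inner u v - inner u w.
Proof.
  intros Hu Hv Hw. assert (Hlr := lft_rgt P). assert (Hrho := stick_pos P).
  assert (C1 := scale_cont). assert (C2 := cq_cont P). unfold inner.
  rewrite (RInt_congr _ (fun x => 2 * scale x * q x * (u x * v x) + (-1) * (2 * scale x * q x * (u x * w x))))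
    by (intros; ring).
  rewrite (RInt_lin (fun x => 2 * scale x * q x * (u x * v x)) (fun x => 2 * scale x * q x * (u x * w x))).
  - field. lra.
  - apply ex_RInt_segment; [lra|]. intros; repeat cont_step.
  - apply ex_RInt_segment; [lra|]. intros; repeat cont_step.
Qed.

(** By the energy identity [(2 lam + 2) inner W W] is, up to the small residual,
    at least the integral of the energy [V^2 + 2 (lam + 2) q W^2] weighted by
    [scale], and [energy_lower] keeps that away from zero. *)
Lemma inner_lower : exists eta k, 0 < eta /\ 0 < k /\ forall lam, -1 <= lam ->
  Rabs (shoot lam) <= eta -> k <= (lam + 2) * inner (W lam) (W lam).
Proof.
  destruct scale_bounds as [m [M [Hm [HM Hs]]]]. destruct (W_bound) as [B [HB HW]].
  destruct (W_lower) as [k [Hk HL]].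
  assert (Hlr := lft_rgt P). assert (Hrho := stick_pos P). assert (HK := bnd_ge1 P).
  assert (Hq0 := q_low_pos P).
  set (k0 := Rmin 1 (2 * q_low P)).
  assert (Hk0 : 0 < k0) by (apply Rmin_pos; lra).
  assert (Hk1 : k0 <= 1) by apply Rmin_l. assert (Hk2 : k0 <= 2 * q_low P) by apply Rmin_r.
  set (e := m * k0 * k * (r - l)).
  assert (He : 0 < e) by (unfold e; repeat apply Rmult_lt_0_compat; lra).
  exists (e * rho / (2 * B)), (e / 4). split.
  { apply Rmult_lt_0_compat; [nra | apply Rinv_0_lt_compat; lra]. }
  split; [lra|]. intros lam Hl Hsh.
  assert (Ho := om_ge1 lam Hl).
  destruct (HW lam l Hl (inside_lft)) as [_ HWl].
  assert (C1 := scale_cont). assert (C2 := cq_cont P). assert (C3 := cc_cont P).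
  assert (C4 := W_cont lam). assert (C5 := V_cont lam).
  assert (E := energy_identity lam (W lam) (V lam) (W_solves lam) (W_rgt lam)).
  fold (shoot lam) in E.
  set (J := RInt (fun x => scale x * V lam x ^ 2 + 2 * scale x * c x * W lam x ^ 2) l r) in *.
  set (I := RInt (fun x => 2 * scale x * q x * (W lam x * W lam x)) l r).
  assert (HJI : e <= J + (lam + 2) * I).
  { unfold J, I. rewrite <- RInt_lin.
    - apply RInt_ge_cst; [lra| |].
      + apply ex_RInt_segment; [lra|]. intros; repeat cont_step.
      + intros x Hx. specialize (Hs x Hx). specialize (HL lam x Hl Hx).
        assert (Hq := q_low_le P x Hx). assert (Hc := cc_nonneg P x Hx).
        assert (Z1 := pow2_ge_0 (V lam x)). assert (Z2 := pow2_ge_0 (W lam x)).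
        assert (Z3 : 0 <= (lam + 2) * W lam x ^ 2) by pos.
        assert (T1 : 0 <= 2 * scale x * c x * W lam x ^ 2).
        { apply Rmult_le_pos; auto. apply Rmult_le_pos; lra. }
        assert (T2 : k0 * k <= V lam x ^ 2 + 2 * q x * ((lam + 2) * W lam x ^ 2)).
        { apply Rle_trans with (k0 * (V lam x ^ 2 + (lam + 2) * W lam x ^ 2)).
          - apply Rmult_le_compat_l; lra.
          - assert (k0 * ((lam + 2) * W lam x ^ 2) <= 2 * q x * ((lam + 2) * W lam x ^ 2))
              by mono. nra. }
        assert (T3 : 0 <= k0 * k) by nra.
        assert (T4 : m * (k0 * k) <= scale x * (V lam x ^ 2 + 2 * q x * ((lam + 2) * W lam x ^ 2)))
          by mono. lra.
    - apply ex_RInt_segment; [lra|]. intros; repeat cont_step.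
    - apply ex_RInt_segment; [lra|]. intros; repeat cont_step. }
  assert (HB0 : Rabs (W lam l) <= B).
  { apply Rle_trans with (om lam * Rabs (W lam l)); auto. generalize (Rabs_pos (W lam l)); nra. }
  assert (HR : Rabs (shoot lam * W lam l / rho) <= e / 2).
  { unfold Rdiv. rewrite !Rabs_mult, (Rabs_right (/ rho)) by (left; now apply Rinv_0_lt_compat).
    apply Rle_trans with (e * rho / (2 * B) * B * / rho); [|right; field; lra].
    apply Rmult_le_compat_r; [left; now apply Rinv_0_lt_compat|].
    apply Rmult_le_compat; auto; apply Rabs_pos. }
  apply Rabs_le_between in HR.
  assert (Hk0' := kap0_nonneg).
  assert (Z1 : 0 <= kap0 * W lam l ^ 2 / rho).
  { apply Rmult_le_pos; [apply Rmult_le_pos; [auto | apply pow2_ge_0] | left; now apply Rinv_0_lt_compat]. }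
  assert (Z2 : 0 <= W lam l * W lam l / rho).
  { apply Rmult_le_pos; [nra | left; now apply Rinv_0_lt_compat]. }
  assert (EI : inner (W lam) (W lam) = I + W lam l * W lam l / rho) by reflexivity.
  assert (Z3 : 0 <= (lam + 2) * (W lam l * W lam l / rho)) by pos.
  rewrite EI in *.
  assert (E2 : e / 2 <= lam * (I + W lam l * W lam l / rho) + (lam + 2) * (I + W lam l * W lam l / rho)) by lra.
  set (N := I + W lam l * W lam l / rho) in *.
  assert (0 <= N) by nra. nra.
Qed.

(** If the boundary condition nearly holds, its term [lam W] must balance the
    bounded slope. *)
Lemma W_left_small : exists C, 1 <= C /\ forall lam, -1 <= lam ->
  Rabs (shoot lam) <= 1 -> (lam + 2) * Rabs (W lam l) <= C.
Proof.
  destruct (W_bound) as [B [HB HW]]. assert (Hrho := stick_pos P). assert (Hk := kap0_nonneg).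
  exists (1 + rho * B + (kap0 + 2) * B). split; [nra|]. intros lam Hl Hs.
  assert (Ho := om_ge1 lam Hl). destruct (HW lam l Hl (inside_lft)) as [H1 H2].
  assert (H3 : Rabs (W lam l) <= B) by (generalize (Rabs_pos (W lam l)); nra).
  rewrite <- (Rabs_right (lam + 2)) by lra. rewrite <- Rabs_mult.
  replace ((lam + 2) * W lam l) with (shoot lam + - (rho * V lam l) + (kap0 + 2) * W lam l)
    by (unfold shoot, residual; ring).
  eapply Rle_trans; [apply Rabs_triang|]. apply Rplus_le_compat.
  - eapply Rle_trans; [apply Rabs_triang|]. rewrite Rabs_Ropp, Rabs_mult, (Rabs_right rho) by lra.
    apply Rplus_le_compat; [auto | apply Rmult_le_compat_l; lra].
  - rewrite Rabs_mult, (Rabs_right (kap0 + 2)) by lra. apply Rmult_le_compat_l; lra.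
Qed.

(** * Transversality at the zeros of the shooting function *)

Lemma inv_om_le lam lam' : -1 <= lam -> -1 <= lam' -> lam <= lam' + 1 ->
  / (om lam * om lam') <= 2 / (lam + 2).
Proof.
  intros H H' Hd. assert (H1 := om_ge1 lam H). assert (H2 := om_ge1 lam' H').
  assert (H3 := om_close lam lam' H H' Hd). rewrite <- (om_sqr lam H).
  replace (2 / om lam ^ 2) with (/ (om lam * (om lam / 2))) by (field; lra).
  apply Rinv_le_contravar; [nra|]. apply Rmult_le_compat_l; lra.
Qed.

(** In the limit [lam' -> lam] the Wronskian identity shows that at a zero the
    derivative of [shoot], multiplied by [W lam l], is [rho] times the square norm
    of [W lam]. With the weights [lam + 2] on both sides the bounds are uniform:
    [shoot] crosses zero with a slope that does not depend on the frequency. *)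
Lemma shoot_sign_change : exists t0 c1 c2, 0 < t0 <= / 2 /\ 0 < c1 /\ 0 < c2 /\
  forall lam t, 0 <= lam -> 0 < t <= t0 -> Rabs (shoot lam) <= c1 * t ->
  c2 * t <= Rabs (shoot (lam + t)) /\ c2 * t <= Rabs (shoot (lam - t)) /\
  shoot (lam + t) * shoot (lam - t) < 0.
Proof.
  destruct inner_lower as [eta [k [Heta [Hk HN]]]]. destruct W_left_small as [C [HC HWl]].
  destruct (W_lipschitz) as [D [HD HLip]]. destruct (W_bound) as [B [HB HW]].
  destruct inner_bound as [M [HM HI]].
  assert (Hrho := stick_pos P).
  set (G := 2 * M * B * D). assert (HG : 1 <= G).
  { unfold G. assert (1 <= M * B) by nra. assert (1 <= M * B * D) by nra. lra. }
  set (C' := C + 2 * D).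
  exists (Rmin (/ 2) (k / (2 * G))).
  exists (Rmin (Rmin 1 eta) (rho * k / (4 * C'))), (rho * k / (4 * C)).
  assert (Hg0 : 0 < k / (2 * G)) by (apply Rmult_lt_0_compat; [auto | apply Rinv_0_lt_compat; lra]).
  assert (HC' : 0 < C') by (unfold C'; lra).
  assert (Hrk : 0 < rho * k) by nra.
  split; [|split; [|split]].
  - split; [apply Rmin_pos; lra | apply Rmin_l].
  - repeat apply Rmin_pos; try lra. apply Rmult_lt_0_compat; [auto | apply Rinv_0_lt_compat; lra].
  - apply Rmult_lt_0_compat; [auto | apply Rinv_0_lt_compat; lra].
  - intros lam t Hl Ht Hs.
    assert (Ht1 : t <= / 2) by (eapply Rle_trans; [apply Ht | apply Rmin_l]).
    assert (Ht2 : t <= k / (2 * G)) by (eapply Rle_trans; [apply Ht | apply Rmin_r]).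
    set (c1 := Rmin (Rmin 1 eta) _) in *.
    assert (Hc1 : c1 <= 1) by below (Rle_refl c1).
    assert (Hc2 : c1 <= eta) by below (Rle_refl c1).
    assert (Hc3 : c1 <= rho * k / (4 * C')) by below (Rle_refl c1).
    assert (Hc0 : 0 < c1).
    { unfold c1; repeat apply Rmin_pos; try lra. apply Rmult_lt_0_compat; [auto | apply Rinv_0_lt_compat; lra]. }
    set (X := (lam + 2) * W lam l).
    assert (HX : Rabs X <= C).
    { unfold X. rewrite Rabs_mult, (Rabs_right (lam + 2)) by lra. apply HWl; [lra|]. nra. }
    assert (HNl : k <= (lam + 2) * inner (W lam) (W lam)) by (apply HN; [lra | nra]).
    assert (step : forall s, Rabs s = t ->
      exists Y Z, shoot (lam + s) * X = Y + rho * s * Z /\ Rabs Y <= rho * t * k / 4 /\ k / 2 <= Z).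
    { intros s Hst.
      assert (Hs1 : - t <= s <= t) by (apply Rabs_le_between; lra).
      assert (Hl' : -1 <= lam + s) by lra.
      exists (shoot lam * ((lam + 2) * W (lam + s) l)), ((lam + 2) * inner (W lam) (W (lam + s))).
      assert (Ho := om_ge1 lam ltac:(lra)). assert (Ho' := om_ge1 (lam + s) Hl').
      assert (Hinv := inv_om_le lam (lam + s) ltac:(lra) Hl' ltac:(lra)).
      assert (HdW : forall x, inside x -> Rabs (W (lam + s) x - W lam x) <= 2 * D * t / (lam + 2)).
      { intros x Hx. destruct (HLip lam (lam + s) x ltac:(lra) Hl' Hx) as [_ H2].
        replace (lam + s - lam) with s in H2 by ring. rewrite Hst in H2.
        apply Rle_trans with (D * t * / (om lam * om (lam + s))).
        - apply Rmult_le_reg_l with (om (lam + s)); [lra|].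
          replace (om (lam + s) * (D * t * / (om lam * om (lam + s)))) with (D * t / om lam) by (field; lra).
          exact H2.
        - replace (2 * D * t / (lam + 2)) with (D * t * (2 / (lam + 2))) by (field; lra).
          apply Rmult_le_compat_l; [nra | exact Hinv]. }
      split; [|split].
      - generalize (wronskian lam (lam + s) _ _ _ _ (W_solves lam) (W_solves (lam + s))
          (W_rgt lam) (W_rgt (lam + s))).
        fold (shoot lam) (shoot (lam + s)). intros E. unfold X.
        replace (rho * (lam - (lam + s))) with (- rho * s) in E by ring.
        replace (shoot (lam + s) * ((lam + 2) * W lam l))
          with ((lam + 2) * (shoot lam * W (lam + s) l + rho * s * inner (W lam) (W (lam + s)))).
        + ring.
        + replace (shoot lam * W (lam + s) l) with (shoot (lam + s) * W lam l + - rho * s * inner (W lam) (W (lam + s))) by lra.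
          ring.
      - rewrite Rabs_mult.
        assert (HY : Rabs ((lam + 2) * W (lam + s) l) <= C').
        { replace ((lam + 2) * W (lam + s) l) with (X + (lam + 2) * (W (lam + s) l - W lam l)) by (unfold X; ring).
          eapply Rle_trans; [apply Rabs_triang|]. unfold C'. apply Rplus_le_compat; auto.
          rewrite Rabs_mult, (Rabs_right (lam + 2)) by lra.
          apply Rle_trans with ((lam + 2) * (2 * D * t / (lam + 2))).
          - apply Rmult_le_compat_l; [lra | apply HdW, inside_lft].
          - replace ((lam + 2) * (2 * D * t / (lam + 2))) with (2 * D * t) by (field; lra). nra. }
        apply Rle_trans with (rho * k / (4 * C') * t * C').
        + apply Rmult_le_compat; try apply Rabs_pos; auto.
          eapply Rle_trans; [exact Hs|]. apply Rmult_le_compat_r; lra.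
        + right. field. lra.
      - assert (E : inner (W lam) (W (lam + s)) = inner (W lam) (W lam)
            + inner (W lam) (fun x => W (lam + s) x - W lam x)).
        { rewrite inner_sub_r; [ring| | |]; intros; apply W_cont. }
        assert (HD1 : Rabs (inner (W lam) (fun x => W (lam + s) x - W lam x)) <= M * (B * (2 * D * t / (lam + 2)))).
        { apply HI; auto.
          - intros; apply W_cont.
          - intros; apply continuous_sub; apply W_cont.
          - intros x Hx. destruct (HW lam x ltac:(lra) Hx) as [_ H2]. generalize (Rabs_pos (W lam x)); nra. }
        apply Rabs_le_between in HD1. rewrite E, Rmult_plus_distr_l.
        assert (HD2 : (lam + 2) * (M * (B * (2 * D * t / (lam + 2)))) <= k / 2).
        { replace ((lam + 2) * (M * (B * (2 * D * t / (lam + 2))))) with (G * t) by (unfold G; field; lra).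
          apply Rle_trans with (G * (k / (2 * G))); [apply Rmult_le_compat_l; lra | right; field; lra]. }
        assert ((lam + 2) * - (M * (B * (2 * D * t / (lam + 2)))) <= (lam + 2) * inner (W lam) (fun x => W (lam + s) x - W lam x))
          by mono. lra. }
    destruct (step t ltac:(apply Rabs_right; lra)) as [Y1 [Z1 [E1 [HY1 HZ1]]]].
    destruct (step (- t) ltac:(rewrite Rabs_Ropp; apply Rabs_right; lra)) as [Y2 [Z2 [E2 [HY2 HZ2]]]].
    fold (lam - t) in E2. replace (lam + - t) with (lam - t) in E2 by ring.
    apply Rabs_le_between in HY1, HY2.
    assert (Hrt : 0 < rho * t) by nra.
    assert (rho * t * (k / 2) <= rho * t * Z1) by mono.
    assert (rho * t * (k / 2) <= rho * t * Z2) by mono.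
    assert (P1' : rho * t * k / 4 <= shoot (lam + t) * X) by nra.
    assert (P2' : shoot (lam - t) * X <= - (rho * t * k / 4)) by nra.
    assert (0 < rho * t * k / 4) by nra.
    assert (fin : forall u, rho * t * k / 4 <= Rabs (u * X) -> rho * k / (4 * C) * t <= Rabs u).
    { intros u Hu. rewrite Rabs_mult in Hu. apply Rmult_le_reg_r with C; [lra|].
      replace (rho * k / (4 * C) * t * C) with (rho * t * k / 4) by (field; lra).
      eapply Rle_trans; [exact Hu|]. apply Rmult_le_compat_l; [apply Rabs_pos | auto]. }
    split; [|split].
    + apply fin. eapply Rle_trans; [exact P1' | apply Rle_abs].
    + apply fin. rewrite <- Rabs_Ropp. eapply Rle_trans; [|apply Rle_abs]. lra.
    + apply Rnot_le_lt. intros Hn.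
      assert (0 <= (shoot (lam + t) * shoot (lam - t)) * (X * X)) by (apply Rmult_le_pos; nra).
      nra.
Qed.

Lemma shoot_cont lam : -1 < lam -> continuity_pt shoot lam.
Proof.
  intros Hl. destruct (W_lipschitz) as [D [HD HLip]]. destruct (W_bound) as [B [HB HW]].
  assert (Hrho := stick_pos P). assert (Hk := kap0_nonneg).
  set (G := rho * D + (kap0 + Rabs lam + 1) * D + B).
  assert (HG : 0 < G).
  { unfold G. generalize (Rabs_pos lam). intros. assert (0 <= (kap0 + Rabs lam + 1) * D) by pos.
    assert (0 < rho * D) by pos. lra. }
  assert (Hlip : forall lam', -1 <= lam' -> Rabs (lam' - lam) <= 1 -> Rabs (shoot lam' - shoot lam) <= G * Rabs (lam' - lam)).
  { intros lam' Hl' Hd. destruct (HLip lam lam' l ltac:(lra) Hl' (inside_lft)) as [H1 H2].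
    destruct (HW lam l ltac:(lra) (inside_lft)) as [_ H3].
    assert (Ho := om_ge1 lam ltac:(lra)). assert (Ho' := om_ge1 lam' Hl').
    assert (Hd0 := Rabs_pos (lam' - lam)).
    assert (HD' : D * Rabs (lam' - lam) / om lam <= D * Rabs (lam' - lam)).
    { apply Rmult_le_reg_r with (om lam); [lra|].
      replace (D * Rabs (lam' - lam) / om lam * om lam) with (D * Rabs (lam' - lam)) by (field; lra).
      assert (0 <= D * Rabs (lam' - lam)) by pos. nra. }
    replace (shoot lam' - shoot lam) with (rho * (V lam' l - V lam l) + - ((kap0 - lam') * (W lam' l - W lam l)) + (lam' - lam) * W lam l)
      by (unfold shoot, residual; ring).
    eapply Rle_trans; [apply Rabs_triang|].
    unfold G. rewrite !Rmult_plus_distr_r. apply Rplus_le_compat.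
    - eapply Rle_trans; [apply Rabs_triang|]. rewrite Rabs_Ropp, !Rabs_mult, (Rabs_right rho) by lra.
      apply Rplus_le_compat.
      + rewrite Rmult_assoc. apply Rmult_le_compat_l; lra.
      + rewrite <- !Rmult_plus_distr_r, Rmult_assoc. apply Rmult_le_compat; try apply Rabs_pos.
        * unfold Rminus at 1. eapply Rle_trans; [apply Rabs_triang|]. rewrite Rabs_Ropp, (Rabs_right kap0) by lra.
          assert (Rabs lam' <= Rabs lam + Rabs (lam' - lam)).
          { replace lam' with (lam + (lam' - lam)) at 1 by ring. apply Rabs_triang. }
          lra.
        * generalize (Rabs_pos (W lam' l - W lam l)). nra.
    - rewrite Rabs_mult, Rmult_comm. apply Rmult_le_compat_r; auto.
      generalize (Rabs_pos (W lam l)). nra. }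
  intros eps Heps.
  assert (Hmin : 0 < Rmin (Rmin 1 (lam + 1)) (eps / (2 * G))).
  { repeat apply Rmin_pos; try lra. apply Rmult_lt_0_compat; [auto | apply Rinv_0_lt_compat; lra]. }
  exists (Rmin (Rmin 1 (lam + 1)) (eps / (2 * G))). split; auto.
  intros lam' [_ Hd]. simpl in *. unfold Rdist in *.
  assert (h1 := Rmin_l (Rmin 1 (lam + 1)) (eps / (2 * G))). assert (h2 := Rmin_r (Rmin 1 (lam + 1)) (eps / (2 * G))).
  assert (h3 := Rmin_l 1 (lam + 1)). assert (h4 := Rmin_r 1 (lam + 1)).
  assert (Hd' := Hd). apply Rabs_lt_between in Hd'.
  eapply Rle_lt_trans; [apply Hlip; lra|].
  apply Rle_lt_trans with (G * (eps / (2 * G))); [apply Rmult_le_compat_l; lra|].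
  replace (G * (eps / (2 * G))) with (eps / 2) by (field; lra). lra.
Qed.

(** * Quadratic growth of the eigenvalues *)

Definition wave (x : R) : R := sqrt (2 * q x).

Lemma wave_sqr x : inside x -> wave x * wave x = 2 * q x.
Proof. intros H. apply sqrt_sqrt. generalize (q_pos x H). lra. Qed.

Lemma wave_pos x : inside x -> 0 < wave x.
Proof. intros H. apply sqrt_lt_R0. generalize (q_pos x H). lra. Qed.

Lemma wave_derive x : inside x -> is_derive wave x (cq1 P x / wave x).
Proof.
  intros H. assert (Hq := q_pos x H). assert (Hw := wave_pos x H).
  assert (D := cq_derive P x H).
  eapply is_derive_eq.
  - apply (is_derive_comp sqrt (fun t => 2 * q t)).
    + apply is_derive_Reals, derivable_pt_lim_sqrt. lra.
    + derive. reflexivity.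
  - unfold scal; simpl. unfold mult; simpl. fold (wave x). field. lra.
Qed.

(** The high-frequency approximation [A sin (nu Phi)], with [Phi' = - sqrt (2 q)]
    and the amplitude [A] such that the terms of order [nu] in the equation
    cancel; its residual stays bounded as [nu] grows. *)
Lemma wkb : exists Phi B, Phi r = 0 /\ 0 < Phi l /\ 0 < B /\ exists A0, 0 < A0 /\
  forall nu, 1 <= nu -> exists y z f n,
    solves (nu ^ 2) f y z /\ (forall x, inside x -> Rabs (f x) <= B) /\
    0 < n /\ y r = 0 /\ z r = - n /\ Rabs (z l) <= B * nu /\ y l = A0 * sin (nu * Phi l).
Proof.
  assert (Hlr := lft_rgt P).
  assert (Hw1 := wave_derive). assert (Hq := cq_derive P). assert (Hq1 := cq1_derive P).
  assert (Ha := ca_derive P).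
  assert (cw : forall x, inside x -> continuous wave x).
  { intros x Hx. exact (continuous_of_derive _ _ _ (Hw1 x Hx)). }
  destruct (primitive_exists wave l r) as [F HF]; [lra | exact cw |].
  set (Phi := fun x => F r - F x).
  assert (DPhi : forall x, inside x -> is_derive Phi x (- wave x)).
  { intros x Hx. specialize (HF x Hx). unfold Phi. derive. ring. }
  set (g := fun x => a x + cq1 P x / (4 * q x)).
  set (g1 := fun x => ca1 P x + (cq2 P x * (4 * q x) - cq1 P x * (4 * cq1 P x)) / (4 * q x) ^ 2).
  assert (Dg : forall x, inside x -> is_derive g x (g1 x)).
  { intros x Hx. assert (Hqx := q_pos x Hx). assert (D1 := Ha x Hx). assert (D2 := Hq x Hx).
    assert (D3 := Hq1 x Hx). unfold g, g1. derive; try lra. field. lra. }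
  assert (cg : forall x, inside x -> continuous g x).
  { intros x Hx. exact (continuous_of_derive _ _ _ (Dg x Hx)). }
  destruct (primitive_exists g l r) as [G HG]; [lra | exact cg |].
  set (A := fun x => exp (- G x)).
  assert (DA : forall x, inside x -> is_derive A x (- g x * A x)).
  { intros x Hx. specialize (HG x Hx). unfold A. derive. ring. }
  assert (HL : 0 < Phi l).
  { unfold Phi. destruct (mean_value F wave l r) as [x [Hx E]]; [lra | exact HF|].
    rewrite E. apply Rmult_lt_0_compat; [now apply wave_pos | lra]. }
  assert (Ap : forall x, 0 < A x) by (intros; apply exp_pos).
  destruct (bounded_on_segment A l r) as [BA [BA0 BA1]]; [lra | |].
  { intros x Hx. exact (continuous_of_derive _ _ _ (DA x Hx)). }
  destruct (bounded_on_segment g l r) as [Bg [Bg0 Bg1]]; [lra | exact cg |].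
  destruct (bounded_on_segment wave l r) as [Bw [Bw0 Bw1]]; [lra | exact cw |].
  assert (HK := bnd_ge1 P). assert (Hq0 := q_low_pos P).
  set (Bd := K + 8 * K ^ 2 / (4 * q_low P) ^ 2).
  assert (Hg1 : forall x, inside x -> Rabs (g1 x) <= Bd).
  { intros x Hx. unfold g1, Bd. eapply Rle_trans; [apply Rabs_triang|].
    apply Rplus_le_compat; [now apply ca1_bnd|].
    assert (Hqx := q_low_le P x Hx).
    assert (H1 := cq_bnd P x Hx). assert (H2 := cq1_bnd P x Hx). assert (H3 := cq2_bnd P x Hx).
    assert (H4 : (4 * q_low P) ^ 2 <= (4 * q x) ^ 2) by (apply pow_incr; lra).
    assert (H5 : 0 < (4 * q_low P) ^ 2) by pos.
    unfold Rdiv. rewrite Rabs_mult, (Rabs_right (/ _)) by pos.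
    apply Rmult_le_compat; [apply Rabs_pos | left; apply Rinv_0_lt_compat; lra | | apply Rinv_le_contravar; lra].
    unfold Rminus. eapply Rle_trans; [apply Rabs_triang|]. rewrite Rabs_Ropp, !Rabs_mult, !(Rabs_right 4) by lra.
    assert (Rabs (cq2 P x) * (4 * Rabs (q x)) <= K * (4 * K)).
    { apply Rmult_le_compat; try apply Rabs_pos; auto; [generalize (Rabs_pos (q x)) |]; lra. }
    assert (Rabs (cq1 P x) * (4 * Rabs (cq1 P x)) <= K * (4 * K)).
    { apply Rmult_le_compat; try apply Rabs_pos; auto; [generalize (Rabs_pos (cq1 P x)) |]; lra. }
    nra. }
  assert (Hbd : 0 <= Bd) by (eapply Rle_trans; [apply Rabs_pos | apply (Hg1 l (inside_lft))]).
  set (B1 := BA * (Bg ^ 2 + Bd + 2 * K * Bg + 2 * K)). set (B2 := BA * (Bg + Bw)).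
  assert (HB1 : 0 <= B1).
  { unfold B1. apply Rmult_le_pos; [lra|]. assert (0 <= Bg ^ 2) by pos.
    assert (0 <= K * Bg) by nra. lra. }
  assert (HB2 : 0 < B2) by (unfold B2; apply Rmult_lt_0_compat; lra).
  exists Phi, (B1 + B2). split; [unfold Phi; ring|]. split; [exact HL|]. split; [lra|].
  exists (A l). split; [apply Ap|].
  intros nu Hnu.
  exists (fun x => A x * sin (nu * Phi x)),
    (fun x => - g x * A x * sin (nu * Phi x) - nu * wave x * A x * cos (nu * Phi x)),
    (fun x => A x * sin (nu * Phi x) * (g x * g x - g1 x - 2 * a x * g x - 2 * c x)),
    (nu * wave r * A r).
  assert (Hr0 : Phi r = 0) by (unfold Phi; ring).
  assert (Hs : forall u, Rabs (sin u) <= 1) by (intros u; apply Rabs_le, SIN_bound).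
  assert (Hc : forall u, Rabs (cos u) <= 1) by (intros u; apply Rabs_le, COS_bound).
  split; [|split; [|split; [|split; [|split; [|split]]]]].
  - intros x Hx. assert (D1 := DA x Hx). assert (D2 := DPhi x Hx). assert (D3 := Dg x Hx).
    assert (D4 := Hw1 x Hx). assert (Hw := wave_pos x Hx). assert (Hww := wave_sqr x Hx).
    assert (Hqx := q_pos x Hx).
    split; [derive; ring|]. derive.
    assert (E1 : cq1 P x / wave x = 2 * (g x - a x) * wave x).
    { unfold g. replace (2 * (a x + cq1 P x / (4 * q x) - a x) * wave x)
        with (cq1 P x * wave x / (wave x * wave x)) by (rewrite Hww; field; lra).
      field. lra. }
    rewrite E1. replace (q x) with (wave x * wave x / 2) by lra. field.
  - intros x Hx. assert (T1 := BA1 x Hx). assert (T2 := Bg1 x Hx). assert (T3 := Hg1 x Hx).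
    assert (T4 := ca_bnd P x Hx). assert (T5 := cc_bnd P x Hx).
    apply Rle_trans with B1; [|lra]. unfold B1. rewrite !Rabs_mult.
    apply Rmult_le_compat; try apply Rabs_pos.
    + apply Rmult_le_pos; apply Rabs_pos.
    + rewrite <- (Rmult_1_r BA). apply Rmult_le_compat; auto; apply Rabs_pos.
    + assert (S1 : Rabs (g x * g x) <= Bg ^ 2).
      { rewrite Rabs_mult. replace (Bg ^ 2) with (Bg * Bg) by ring.
        apply Rmult_le_compat; auto; apply Rabs_pos. }
      assert (S2 : Rabs (a x * g x) <= K * Bg).
      { rewrite Rabs_mult. apply Rmult_le_compat; auto; apply Rabs_pos. }
      apply Rabs_le_between in S1, S2, T3, T5. apply Rabs_le. split; lra.
  - apply Rmult_lt_0_compat; [|apply Ap]. apply Rmult_lt_0_compat; [lra | apply wave_pos, inside_rgt].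
  - rewrite Hr0, Rmult_0_r, sin_0. ring.
  - rewrite Hr0, Rmult_0_r, sin_0, cos_0. ring.
  - assert (T1 := BA1 l (inside_lft)). assert (T2 := Bg1 l (inside_lft)).
    assert (T3 := Bw1 l (inside_lft)).
    assert (S1 : Rabs (g l * A l * sin (nu * Phi l)) <= Bg * BA * 1).
    { rewrite !Rabs_mult. apply Rmult_le_compat; auto; try apply Rabs_pos.
      - apply Rmult_le_pos; apply Rabs_pos.
      - apply Rmult_le_compat; auto; apply Rabs_pos. }
    assert (S2 : Rabs (wave l * A l * cos (nu * Phi l)) <= Bw * BA * 1).
    { rewrite !Rabs_mult. apply Rmult_le_compat; auto; try apply Rabs_pos.
      - apply Rmult_le_pos; apply Rabs_pos.
      - apply Rmult_le_compat; auto; apply Rabs_pos. }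
    replace (- g l * A l * sin (nu * Phi l) - nu * wave l * A l * cos (nu * Phi l))
      with (- (g l * A l * sin (nu * Phi l)) + - (nu * (wave l * A l * cos (nu * Phi l)))) by ring.
    eapply Rle_trans; [apply Rabs_triang|]. rewrite !Rabs_Ropp, (Rabs_mult nu), (Rabs_right nu) by lra.
    assert (nu * Rabs (wave l * A l * cos (nu * Phi l)) <= nu * (Bw * BA * 1)) by mono.
    unfold B2. assert (0 <= Bg * BA * 1) by nra. assert (0 <= B1 * nu) by nra. nra.
  - reflexivity.
Qed.

(** At a peak of the sine the term [lam y] of the boundary condition is of order
    [nu^2], whereas the slope and the distance of the approximation from the exact
    solution only contribute terms of order [nu]. So [shoot] has the sign of the
    sine. *)
Lemma shoot_oscillates : exists L N0, 0 < L /\ 1 <= N0 /\ forall nu, N0 <= nu ->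
  sin (nu * L) ^ 2 = 1 -> 0 < sin (nu * L) * shoot (nu ^ 2).
Proof.
  destruct wkb as [Phi [B [_ [HL [HB [A0 [HA0 H]]]]]]].
  destruct (energy_upper) as [C [HC HE]].
  assert (Hrho := stick_pos P). assert (Hk := kap0_nonneg).
  set (D := rho * B + kap0 * A0 + rho * (C * B) + (kap0 + 2) * (C * B)).
  assert (HD : 0 < D).
  { unfold D. assert (0 < rho * B) by nra. assert (0 < C * B) by nra. assert (0 <= kap0 * A0) by nra.
    assert (0 < rho * (C * B)) by nra. assert (0 < (kap0 + 2) * (C * B)) by nra. lra. }
  exists (Phi l), (1 + D / A0). split; auto.
  assert (HDA : 0 < D / A0) by (apply Rmult_lt_0_compat; [auto | now apply Rinv_0_lt_compat]).
  split; [lra|]. intros nu Hnu Hsin.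
  destruct (H nu ltac:(lra)) as [y [z [f [n [Hs [Hf [Hn [Hy [Hz [Hzl Hyl]]]]]]]]]].
  assert (Hl2 : 1 <= nu ^ 2) by nra. assert (Hl : -1 <= nu ^ 2) by lra.
  assert (Hs' : solves (nu ^ 2) f (fun x => y x - n * W (nu ^ 2) x) (fun x => z x - n * V (nu ^ 2) x)).
  { intros x Hx. destruct (Hs x Hx) as [D1 D2]. assert (D3 := W_derive (nu ^ 2) x).
    assert (D4 := V_derive (nu ^ 2) x). split; derive; ring. }
  assert (Eb := HE (nu ^ 2) f _ _ B Hl ltac:(lra) Hs' Hf l (inside_lft)).
  cbv beta in Eb. rewrite Hy, Hz, W_rgt, V_rgt in Eb.
  assert (Eb2 : C * ((- n - n * -1) ^ 2 + (nu ^ 2 + 2) * (0 - n * 0) ^ 2 + B ^ 2) <= (C * B) ^ 2).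
  { replace (C * ((- n - n * -1) ^ 2 + (nu ^ 2 + 2) * (0 - n * 0) ^ 2 + B ^ 2)) with (C * B ^ 2) by ring.
    rewrite Rpow_mult_distr. apply Rmult_le_compat_r; [apply pow2_ge_0 | nra]. }
  destruct (amplitude_le (nu ^ 2) _ _ (C * B) Hl ltac:(nra) (Rle_trans _ _ _ Eb Eb2)) as [E1 E2].
  set (lam := nu ^ 2) in *. set (e := y l - n * W lam l) in *. set (e1 := z l - n * V lam l) in *.
  assert (E3 : nu * Rabs e <= C * B).
  { eapply Rle_trans; [|exact E2]. apply Rmult_le_compat_r; [apply Rabs_pos|].
    rewrite <- (sqrt_pow2 nu) by lra. apply sqrt_le_1_alt. fold lam. lra. }
  assert (E4 : Rabs e <= C * B) by (generalize (Rabs_pos e); nra).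
  assert (Esh : n * shoot lam = rho * z l - (kap0 - lam) * y l - (rho * e1 - (kap0 - lam) * e)).
  { unfold shoot, residual, e, e1. ring. }
  set (s := sin (nu * Phi l)) in *.
  assert (Hs1 : Rabs s = 1).
  { rewrite <- sqrt_1, <- Hsin. symmetry. rewrite <- (pow2_abs s). apply sqrt_pow2, Rabs_pos. }
  assert (main : Rabs (n * shoot lam - lam * A0 * s) <= D * nu).
  { rewrite Esh, Hyl.
    replace (rho * z l - (kap0 - lam) * (A0 * s) - (rho * e1 - (kap0 - lam) * e) - lam * A0 * s)
      with (rho * z l + (- (kap0 * (A0 * s))) + (- (rho * e1)) + (kap0 * e + - (nu * (nu * e)))) by (unfold lam; ring).
    eapply Rle_trans; [apply Rabs_triang|].
    assert (S4 : Rabs (kap0 * e + - (nu * (nu * e))) <= (kap0 + 2) * (C * B) * nu).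
    { eapply Rle_trans; [apply Rabs_triang|]. rewrite Rabs_Ropp, !Rabs_mult, (Rabs_right kap0), (Rabs_right nu) by lra.
      assert (kap0 * Rabs e <= kap0 * (C * B)) by mono.
      assert (nu * (nu * Rabs e) <= nu * (C * B)) by mono.
      assert (0 <= kap0 * (C * B)) by (apply Rmult_le_pos; nra). assert (0 <= C * B) by nra. nra. }
    assert (S3 : Rabs (rho * z l + - (kap0 * (A0 * s)) + - (rho * e1)) <= (rho * B + kap0 * A0 + rho * (C * B)) * nu).
    { eapply Rle_trans; [apply Rabs_triang|]. eapply Rle_trans; [apply Rplus_le_compat_r, Rabs_triang|].
      rewrite !Rabs_Ropp, !Rabs_mult, (Rabs_right kap0), (Rabs_right rho), (Rabs_right A0), Hs1 by lra.
      assert (rho * Rabs (z l) <= rho * (B * nu)) by mono.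
      assert (rho * Rabs e1 <= rho * (C * B)) by mono.
      assert (0 <= kap0 * A0) by nra. assert (0 <= rho * (C * B)) by (apply Rmult_le_pos; nra). nra. }
    unfold D. rewrite (Rmult_plus_distr_r (rho * B + kap0 * A0 + rho * (C * B))). lra. }
  assert (Hbig : D * nu < lam * A0).
  { unfold lam. replace (nu ^ 2 * A0) with (nu * (nu * A0)) by ring. rewrite (Rmult_comm D).
    apply Rmult_lt_compat_l; [lra|].
    assert (D / A0 * A0 < nu * A0) by (apply Rmult_lt_compat_r; lra).
    replace (D / A0 * A0) with D in * by (field; lra). auto. }
  assert (main2 : Rabs (s * (n * shoot lam - lam * A0 * s)) <= D * nu) by (rewrite Rabs_mult, Hs1; lra).
  apply Rabs_le_between in main2.
  assert (s * s = 1) by (rewrite <- Hsin; ring).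
  assert (n * (s * shoot lam) >= lam * A0 - D * nu).
  { replace (n * (s * shoot lam)) with (s * (n * shoot lam - lam * A0 * s) + lam * A0 * (s * s)) by ring.
    rewrite H0. lra. }
  apply Rmult_lt_reg_l with n; auto. lra.
Qed.

Lemma sin_half_odd j : sin ((INR j + / 2) * PI) ^ 2 = 1 /\
  sin ((INR (S j) + / 2) * PI) = - sin ((INR j + / 2) * PI).
Proof.
  assert (E : forall j, sin ((INR (S j) + / 2) * PI) = - sin ((INR j + / 2) * PI)).
  { intros i. rewrite S_INR. replace ((INR i + 1 + / 2) * PI) with ((INR i + / 2) * PI + PI) by ring.
    apply neg_sin. }
  split; [|apply E]. induction j as [|j IH].
  - simpl INR. replace ((0 + / 2) * PI) with (PI / 2) by field. rewrite sin_PI2. ring.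
  - rewrite E. rewrite <- IH. ring.
Qed.

(** [shoot] changes sign between consecutive peaks of the sine, which are
    equidistant in the square root of [lam]. *)
Lemma shoot_zeros : exists C (tau : nat -> R), 0 < C /\ 0 <= tau 0%nat /\
  forall i, tau i < tau (S i) /\ tau i <= C * INR (S i) ^ 2 /\
  exists lam, tau i < lam < tau (S i) /\ shoot lam = 0.
Proof.
  destruct shoot_oscillates as [L [N0 [HL [HN0 H]]]].
  destruct (nfloor_ex (N0 * L)) as [j0 Hj0]; [nra|].
  assert (HPI := PI2_3_2). unfold PI2 in HPI.
  set (nu := fun i => (INR (S j0 + i) + / 2) * PI / L).
  assert (Hnu : forall i, N0 <= nu i).
  { intros i. unfold nu. apply Rmult_le_reg_r with L; auto.
    replace ((INR (S j0 + i) + / 2) * PI / L * L) with ((INR (S j0 + i) + / 2) * PI) by (field; lra).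
    rewrite plus_INR, S_INR. generalize (pos_INR i) (pos_INR j0). nra. }
  assert (Hinc : forall i, nu i < nu (S i)).
  { intros i. unfold nu, Rdiv. apply Rmult_lt_compat_r; [now apply Rinv_0_lt_compat|].
    apply Rmult_lt_compat_r; [lra|]. rewrite !plus_INR, !S_INR. lra. }
  assert (Hsin : forall i, nu i * L = (INR (S j0 + i) + / 2) * PI) by (intros; unfold nu; field; lra).
  set (D := (INR j0 + 2) * PI / L).
  assert (HD : 0 < D).
  { unfold D. apply Rmult_lt_0_compat; [|now apply Rinv_0_lt_compat].
    apply Rmult_lt_0_compat; [generalize (pos_INR j0)|]; lra. }
  exists (D ^ 2), (fun i => nu i ^ 2). split; [now apply pow_lt|]. split; [apply pow2_ge_0|].
  intros i. assert (h1 := Hnu i). assert (h2 := Hinc i). assert (h3 := Hnu (S i)).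
  assert (Hlt : nu i ^ 2 < nu (S i) ^ 2) by nra.
  split; [exact Hlt|]. split.
  - rewrite <- Rpow_mult_distr. apply pow_incr. split; [lra|].
    unfold nu, D. replace ((INR j0 + 2) * PI / L * INR (S i)) with ((INR j0 + 2) * INR (S i) * PI / L) by (field; lra).
    unfold Rdiv. apply Rmult_le_compat_r; [left; now apply Rinv_0_lt_compat|].
    apply Rmult_le_compat_r; [lra|]. rewrite plus_INR, !S_INR. generalize (pos_INR i) (pos_INR j0). nra.
  - apply zero_between; auto.
    + intros t Ht. apply shoot_cont. assert (0 <= nu i ^ 2) by pos. lra.
    + destruct (sin_half_odd (S j0 + i)) as [s1 s2].
      destruct (sin_half_odd (S j0 + S i)) as [s3 _].
      replace (S (S j0 + i)) with (S j0 + S i)%nat in s2 by lia.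
      assert (g1 := H (nu i) h1). assert (g2 := H (nu (S i)) h3).
      rewrite !Hsin in g1, g2. specialize (g1 s1). specialize (g2 s3). rewrite s2 in g2.
      set (s := sin _) in *. apply Rnot_le_lt. intros Hn.
      assert (0 <= s ^ 2 * (shoot (nu i ^ 2) * shoot (nu (S i) ^ 2))) by (apply Rmult_le_pos; [apply pow2_ge_0 | auto]).
      nra.
Qed.

(** * Derivatives of the solution *)

Definition cb (lam x : R) : R := cc P x - lam * cq P x.
Definition cb1 (lam x : R) : R := cc1 P x - lam * cq1 P x.
Definition cb2 (lam x : R) : R := cc2 P x - lam * cq2 P x.
(** The derivatives of [W lam] of order two to four, rewritten by the equation so
    that they only involve two derivatives of the coefficients. *)
Definition W2 (lam x : R) : R := - 2 * ca P x * V lam x + 2 * cb lam x * W lam x.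
Definition W3 (lam x : R) : R := - 2 * ca1 P x * V lam x - 2 * ca P x * W2 lam x
  + 2 * cb1 lam x * W lam x + 2 * cb lam x * V lam x.
Definition W4 (lam x : R) : R := - 2 * ca2 P x * V lam x - 4 * ca1 P x * W2 lam x
  - 2 * ca P x * W3 lam x + 2 * cb2 lam x * W lam x + 4 * cb1 lam x * V lam x
  + 2 * cb lam x * W2 lam x.

Lemma V_derive2 lam x : is_derive (V lam) x (W2 lam x).
Proof. apply V_derive. Qed.

Lemma W2_derive lam x : inside x -> is_derive (W2 lam) x (W3 lam x).
Proof.
  intros Hx. assert (D1 := W_derive lam x). assert (D2 := V_derive2 lam x).
  assert (D3 := ca_derive P x Hx). assert (D4 := cq_derive P x Hx). assert (D5 := cc_derive P x Hx).
  unfold W2, cb. derive. unfold W3, cb, cb1. ring.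
Qed.

Lemma W3_derive lam x : inside x -> is_derive (W3 lam) x (W4 lam x).
Proof.
  intros Hx. assert (D1 := W_derive lam x). assert (D2 := V_derive2 lam x).
  assert (D3 := ca_derive P x Hx). assert (D4 := cq_derive P x Hx). assert (D5 := cc_derive P x Hx).
  assert (D6 := ca1_derive P x Hx). assert (D7 := cq1_derive P x Hx). assert (D8 := cc1_derive P x Hx).
  assert (D9 := W2_derive lam x Hx).
  unfold W3, cb, cb1. derive. unfold W4, cb, cb1, cb2. ring.
Qed.

Lemma cb_bound lam x : -1 <= lam -> inside x ->
  Rabs (cb lam x) <= 2 * K * om lam ^ 2 /\ Rabs (cb1 lam x) <= 2 * K * om lam ^ 2 /\
  Rabs (cb2 lam x) <= 2 * K * om lam ^ 2.
Proof.
  intros Hl Hx. rewrite om_sqr by auto. assert (HK := bnd_ge1 P).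
  assert (main : forall u v, Rabs u <= K -> Rabs v <= K -> Rabs (u - lam * v) <= 2 * K * (lam + 2)).
  { intros u v Hu Hv. unfold Rminus.
    apply Rle_trans with (K + (lam + 2) * K); [|nra].
    apply Rabs_add_le; auto. rewrite Rabs_Ropp. apply Rabs_mul_le; auto. apply Rabs_le; lra. }
  split; [|split]; apply main; [apply cc_bnd | apply cq_bnd | apply cc1_bnd | apply cq1_bnd
    | apply cc2_bnd | apply cq2_bnd]; exact Hx.
Qed.

(** Each derivative costs one factor [om lam]. *)
Lemma W_derivatives_bound : exists M, 1 <= M /\ forall lam x, -1 <= lam -> inside x ->
  Rabs (V lam x) <= M /\ Rabs (W lam x) <= M / om lam /\ Rabs (W2 lam x) <= M * om lam /\
  Rabs (W3 lam x) <= M * om lam ^ 2 /\ Rabs (W4 lam x) <= M * om lam ^ 3.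
Proof.
  destruct (W_bound) as [B [HB HW]]. assert (HK := bnd_ge1 P).
  set (M2 := 6 * K * B). set (M3 := 10 * K * B + 2 * K * M2).
  set (M4 := 14 * K * B + 8 * K * M2 + 2 * K * M3).
  assert (HKB : 1 <= K * B) by nra.
  assert (H2 : 1 <= M2) by (unfold M2; lra).
  assert (HK2 : 1 <= K * M2) by nra.
  assert (H3 : 1 <= M3) by (unfold M3; lra).
  assert (HK3 : 1 <= K * M3) by nra.
  exists (B + M2 + M3 + M4). split; [unfold M4; lra|].
  intros lam x Hl Hx. assert (Ho := om_ge1 lam Hl). set (w := om lam) in *.
  destruct (HW lam x Hl Hx) as [HV HW0]. destruct (cb_bound lam x Hl Hx) as [Hb [Hb1 Hb2]].
  fold w in HW0, Hb, Hb1, Hb2.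
  assert (HW' : Rabs (W lam x) <= B / w).
  { apply Rmult_le_reg_l with w; [lra|]. replace (w * (B / w)) with B by (field; lra). auto. }
  assert (Ha := ca_bnd P x Hx). assert (Ha1 := ca1_bnd P x Hx). assert (Ha2 := ca2_bnd P x Hx).
  assert (Hw2 : w <= w ^ 2) by nra. assert (Hw3 : w ^ 2 <= w ^ 3) by (simpl; nra).
  assert (R2 : Rabs 2 <= 2) by (rewrite Rabs_right; lra).
  assert (R2' : Rabs (-2) <= 2) by (rewrite Rabs_left; lra).
  assert (R4 : Rabs 4 <= 4) by (rewrite Rabs_right; lra).
  assert (E2 : Rabs (W2 lam x) <= M2 * w).
  { unfold W2. eapply Rle_trans.
    - apply Rabs_add_le; repeat apply Rabs_mul_le; eassumption.
    - replace (2 * (2 * K * w ^ 2) * (B / w)) with (4 * (K * B) * w) by (field; lra).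
      unfold M2. nra. }
  assert (E3 : Rabs (W3 lam x) <= M3 * w ^ 2).
  { unfold W3, Rminus. eapply Rle_trans.
    - repeat apply Rabs_add_le; [| rewrite Rabs_Ropp | |]; repeat apply Rabs_mul_le; eassumption.
    - replace (2 * (2 * K * w ^ 2) * (B / w)) with (4 * (K * B) * w) by (field; lra).
      replace (2 * K * (M2 * w)) with (2 * (K * M2) * w) by ring.
      replace (2 * (2 * K * w ^ 2) * B) with (4 * (K * B) * w ^ 2) by ring.
      unfold M3. assert (1 <= w ^ 2) by nra.
      assert (4 * (K * B) * w <= 4 * (K * B) * w ^ 2) by mono.
      assert (2 * (K * M2) * w <= 2 * (K * M2) * w ^ 2) by mono.
      assert (2 * (K * B) * 1 <= 2 * (K * B) * w ^ 2) by mono. lra. }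
  assert (E4 : Rabs (W4 lam x) <= M4 * w ^ 3).
  { unfold W4, Rminus. eapply Rle_trans.
    - repeat apply Rabs_add_le; [| rewrite Rabs_Ropp | rewrite Rabs_Ropp | | |];
        repeat apply Rabs_mul_le; eassumption.
    - replace (2 * (2 * K * w ^ 2) * (B / w)) with (4 * (K * B) * w) by (field; lra).
      replace (4 * K * (M2 * w)) with (4 * (K * M2) * w) by ring.
      replace (2 * K * (M3 * w ^ 2)) with (2 * (K * M3) * w ^ 2) by ring.
      replace (4 * (2 * K * w ^ 2) * B) with (8 * (K * B) * w ^ 2) by ring.
      replace (2 * (2 * K * w ^ 2) * (M2 * w)) with (4 * (K * M2) * w ^ 3) by ring.
      unfold M4. assert (1 <= w ^ 3) by lra. assert (w <= w ^ 3) by lra.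
      assert (2 * (K * B) * 1 <= 2 * (K * B) * w ^ 3) by mono.
      assert (4 * (K * B) * w <= 4 * (K * B) * w ^ 3) by mono.
      assert (4 * (K * M2) * w <= 4 * (K * M2) * w ^ 3) by mono.
      assert (2 * (K * M3) * w ^ 2 <= 2 * (K * M3) * w ^ 3) by mono.
      assert (8 * (K * B) * w ^ 2 <= 8 * (K * B) * w ^ 3) by mono.
      lra. }
  assert (HM4 : 0 <= M4) by (unfold M4; lra).
  split; [lra|]. split.
  { eapply Rle_trans; [exact HW'|]. unfold Rdiv. apply Rmult_le_compat_r; [|lra].
    left; apply Rinv_0_lt_compat; lra. }
  split; [|split].
  - eapply Rle_trans; [exact E2|]. apply Rmult_le_compat_r; lra.
  - eapply Rle_trans; [exact E3|]. apply Rmult_le_compat_r; lra.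
  - eapply Rle_trans; [exact E4|]. apply Rmult_le_compat_r; lra.
Qed.

(** * The discrete solution and its error *)

Section Nodes.

Variables (n : nat) (x : nat -> R).

Lemma node_bounds i : is_grid l r n x -> (i <= S n)%nat -> inside (x i).
Proof.
  intros [H0 [H1 H2]] Hi.
  assert (up : forall j, (j <= S n)%nat -> l <= x j).
  { induction j as [|j IH]; intros Hj; [lra|]. specialize (IH ltac:(lia)). specialize (H2 j ltac:(lia)). lra. }
  assert (down : forall j, (j <= S n)%nat -> x (S n - j)%nat <= r).
  { induction j as [|j IH]; intros Hj; [rewrite Nat.sub_0_r; lra|].
    specialize (IH ltac:(lia)). specialize (H2 (S n - S j)%nat ltac:(lia)).
    replace (S (S n - S j)) with (S n - j)%nat in H2 by lia. lra. }
  split; [now apply up|]. replace i with (S n - (S n - i))%nat by lia. apply down. lia.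
Qed.

Lemma step_positive i : is_grid l r n x -> (i <= n)%nat -> 0 < step_plus x i.
Proof. intros [_ [_ H]] Hi. specialize (H i Hi). unfold step_plus. lra. Qed.

(** The scheme from the right end to the left, [j] cells away from it. Seen from
    either end of a cell of length [delta], the difference quotient over the cell
    is the nodal slope corrected by [delta / 2] times the second derivative, [(1 +
    a delta) d - cb delta g] at the right node and [(1 - a delta) d + cb delta g]
    at the left node. Requiring both expressions to agree determines the next
    slope, and eliminating the slopes leaves the three-point equation. *)
Fixpoint back (lam : R) (j : nat) : R * R :=
  match j with
  | O => (0, -1)
  | S j' =>
      let (g', d') := back lam j' in
      let i := (n - j')%nat in
      let delta := step_plus x i in
      let D := (1 + a (x (S i)) * delta) * d' - cb lam (x (S i)) * delta * g' in
      let g := g' - delta * D in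
      (g, (D - cb lam (x i) * delta * g) * / (1 - a (x i) * delta))
  end.

(** The discrete solution that vanishes at the right end, with nodal slope -1
    there, together with its nodal slopes and its difference quotients. *)
Definition gv (lam : R) (i : nat) : R := fst (back lam (S n - i)).
Definition dv (lam : R) (i : nat) : R := snd (back lam (S n - i)).
Definition flux (lam : R) (i : nat) : R :=
  (1 + a (x (S i)) * step_plus x i) * dv lam (S i) - cb lam (x (S i)) * step_plus x i * gv lam (S i).

Lemma gv_last lam : gv lam (S n) = 0.
Proof. unfold gv. rewrite Nat.sub_diag. reflexivity. Qed.

Lemma dv_last lam : dv lam (S n) = -1.
Proof. unfold dv. rewrite Nat.sub_diag. reflexivity. Qed.

Lemma gv_step lam i : (i <= n)%nat -> gv lam i = gv lam (S i) - step_plus x i * flux lam i.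
Proof.
  intros Hi. unfold flux, gv, dv. replace (S n - i)%nat with (S (n - i)) by lia.
  replace (S n - S i)%nat with (n - i)%nat by lia. simpl.
  destruct (back lam (n - i)) as [g' d']. replace (n - (n - i))%nat with i by lia. reflexivity.
Qed.

Lemma dv_step lam i : (i <= n)%nat ->
  dv lam i = (flux lam i - cb lam (x i) * step_plus x i * gv lam i) * / (1 - a (x i) * step_plus x i).
Proof.
  intros Hi. rewrite (gv_step lam i Hi). unfold flux, gv, dv. replace (S n - i)%nat with (S (n - i)) by lia.
  replace (S n - S i)%nat with (n - i)%nat by lia. simpl.
  destruct (back lam (n - i)) as [g' d']. replace (n - (n - i))%nat with i by lia. reflexivity.
Qed.

(** The factor [beta] of Scheme 2 turns the difference quotient over the first
    cell into the nodal slope, so that the discrete boundary condition is the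
    continuous one; Scheme 1 keeps the difference quotient, which is off by
    [O(delta)]. *)
Definition shoot_n (sch : scheme) (lam : R) : R :=
  rho * match sch with Scheme1 => flux lam 0 | Scheme2 => dv lam 0 end - (kap0 - lam) * gv lam 0.

Lemma cb_lin lam t : cb lam t = cc P t + lam * (- cq P t).
Proof. unfold cb. ring. Qed.

Lemma cb_Plt m f t : Plt m f -> Plt (S m) (fun lam => cb lam t * f lam).
Proof.
  intros Hf. apply (Plt_ext _ (fun lam => cc P t * f lam + (- cq P t) * (lam * f lam))).
  - intros. rewrite cb_lin. ring.
  - apply Plt_lin; [now apply Plt_succ | now apply Plt_var].
Qed.

Lemma back_Plt j : Plt j (fun lam => fst (back lam j)) /\ Plt (S j) (fun lam => snd (back lam j)).
Proof.
  induction j as [|j [IH1 IH2]].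
  - split; [simpl; auto | exact (Plt_cst (-1))].
  - set (delta := step_plus x (n - j)). set (u := 1 + a (x (S (n - j))) * delta).
    set (D := fun lam => u * snd (back lam j) + (- delta) * (cb lam (x (S (n - j))) * fst (back lam j))).
    assert (HD : Plt (S j) D).
    { unfold D. apply Plt_lin; [exact IH2|]. apply (cb_Plt _ (fun lam => fst (back lam j))). exact IH1. }
    set (g := fun lam => 1 * fst (back lam j) + (- delta) * D lam).
    assert (Hg : Plt (S j) g).
    { unfold g. apply Plt_lin; [now apply Plt_succ | exact HD]. }
    split.
    + apply (Plt_ext _ g); auto. intros lam. unfold g, D, u, delta. simpl.
      destruct (back lam j) as [g' d']. simpl. ring.
    + apply (Plt_ext _ (fun lam => / (1 - a (x (n - j)%nat) * delta) * D lam
         + (- delta * / (1 - a (x (n - j)%nat) * delta)) * (cb lam (x (n - j)%nat) * g lam))).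
      * intros lam. unfold g, D, u, delta. simpl. destruct (back lam j) as [g' d']. simpl. ring.
      * apply Plt_lin; [now apply Plt_succ|]. apply cb_Plt. exact Hg.
Qed.

Lemma shoot_n_Plt sch : Plt (S (S n)) (shoot_n sch).
Proof.
  destruct (back_Plt (S n)) as [H1 H2]. destruct (back_Plt n) as [H3 H4].
  assert (Hk : Plt (S (S n)) (fun lam => - kap0 * gv lam 0 + 1 * (lam * gv lam 0))).
  { apply Plt_lin; [apply Plt_succ; exact H1 | apply Plt_var; exact H1]. }
  destruct sch.
  - apply (Plt_ext _ (fun lam => 1 * (rho * (1 + a (x 1%nat) * step_plus x 0) * dv lam 1
       + (- rho * step_plus x 0) * (cb lam (x 1%nat) * gv lam 1))
       + 1 * (- kap0 * gv lam 0 + 1 * (lam * gv lam 0)))).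
    + intros lam. unfold shoot_n, flux. ring.
    + apply Plt_lin; [|exact Hk].
      assert (E : (S n - 1)%nat = n) by lia. unfold dv, gv. rewrite E.
      apply Plt_succ. apply Plt_lin; [exact H4|].
      apply (cb_Plt _ (fun lam => fst (back lam n))). exact H3.
  - apply (Plt_ext _ (fun lam => rho * dv lam 0 + 1 * (- kap0 * gv lam 0 + 1 * (lam * gv lam 0)))).
    + intros lam. unfold shoot_n. ring.
    + apply Plt_lin; [exact H2 | exact Hk].
Qed.

End Nodes.

Definition fine_grid (n : nat) (x : nat -> R) (h : R) : Prop :=
  is_grid l r n x /\ forall i, (i <= n)%nat -> step_plus x i <= h.

Lemma grid_factor n x h i j : fine_grid n x h -> K * h <= / 2 -> (i <= n)%nat -> (j <= S n)%nat ->
  / 2 <= 1 - a (x j) * step_plus x i <= 3 / 2 /\ / 2 <= 1 + a (x j) * step_plus x i <= 3 / 2.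
Proof.
  intros [Hg Hs] HK Hi Hj. assert (Hx := node_bounds n x j Hg Hj).
  assert (Hd := step_positive n x i Hg Hi). specialize (Hs i Hi).
  assert (H : Rabs (a (x j) * step_plus x i) <= K * h).
  { apply Rabs_mul_le; [now apply ca_bnd | rewrite Rabs_right; lra]. }
  apply Rabs_le_between in H. lra.
Qed.

(** A three-point difference quotient on an irregular grid is only consistent to
    first order, but the pair of value and nodal slope is propagated by a one-step
    method with local error [O(delta^3)] (a Taylor expansion for the value, the
    trapezoidal rule for the slope), on every grid. The energy of the error grows
    by a factor [1 + O(delta)] per cell, uniformly in the frequency. *)
Lemma scheme_error Th : 0 <= Th -> exists C h0, 1 <= C /\ 0 < h0 /\
  forall n x h lam, fine_grid n x h -> 0 < h <= h0 -> -1 <= lam -> om lam ^ 2 * h <= Th ->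
  forall i, (i <= S n)%nat ->
  Rabs (dv n x lam i - V lam (x i)) <= C * h ^ 2 * om lam ^ 3 /\
  om lam * Rabs (gv n x lam i - W lam (x i)) <= C * h ^ 2 * om lam ^ 3.
Proof.
  intros HTh. assert (HK := bnd_ge1 P). assert (Hq0 := q_low_pos P). assert (Hlr := lft_rgt P).
  destruct (verlet_step K Th HK HTh) as [C [HC Hstep]].
  destruct (W_derivatives_bound) as [M [HM HW]].
  set (k0 := Rmin 1 (2 * q_low P)).
  assert (Hk0 : 0 < k0) by (apply Rmin_pos; lra).
  assert (Hk1 : k0 <= 1) by apply Rmin_l. assert (Hk2 : k0 <= 2 * q_low P) by apply Rmin_r.
  set (C3 := 2 * C / k0).
  assert (HC3 : 0 < C3) by (unfold C3; apply Rmult_lt_0_compat; [lra | now apply Rinv_0_lt_compat]).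
  set (B := C * (4 * M ^ 2)).
  assert (HB : 0 < B) by (unfold B; apply Rmult_lt_0_compat; nra).
  set (X := exp (C3 * (r - l))).
  assert (HX : 0 < X) by apply exp_pos.
  assert (HXB : 0 < X * (B / C3) / k0).
  { apply Rdiv_lt_0_compat; auto. apply Rmult_lt_0_compat; auto. now apply Rdiv_lt_0_compat. }
  exists (1 + X * (B / C3) / k0), (Rmin (/ (2 * K)) (/ (Th + 1))).
  split; [lra|]. split; [apply Rmin_pos; apply Rinv_0_lt_compat; lra|].
  intros n x h lam [Hg Hs] [Hh0 Hh] Hl HTheta.
  assert (HKh : K * h <= / 2).
  { apply Rle_trans with (K * / (2 * K)); [|right; field; lra].
    apply Rmult_le_compat_l; [lra|]. eapply Rle_trans; [exact Hh | apply Rmin_l]. }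
  assert (Hh1 : h <= / (Th + 1)) by below Hh.
  assert (HThh : Th * h <= 1).
  { apply Rle_trans with ((Th + 1) * / (Th + 1)); [|right; field; lra].
    apply Rle_trans with ((Th + 1) * h); [nra | apply Rmult_le_compat_l; lra]. }
  assert (Hh1' : h <= 1) by nra.
  set (w := om lam) in *. assert (Hw := om_ge1 lam Hl). fold w in Hw. assert (Hw2 := om_sqr lam Hl). fold w in Hw2.
  set (eta := fun i => dv n x lam i - V lam (x i)). set (e := fun i => gv n x lam i - W lam (x i)).
  set (E := fun i => eta i ^ 2 + 2 * cq P (x i) * (w * e i) ^ 2).
  set (b := B * (h ^ 4 * w ^ 6) / C3).
  assert (Hb : 0 <= b).
  { unfold b. apply Rmult_le_pos; [|left; now apply Rinv_0_lt_compat].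
    apply Rmult_le_pos; [lra|]. apply Rmult_le_pos; apply pow_le; lra. }
  assert (Elow : forall i, (i <= S n)%nat -> k0 * (eta i ^ 2 + (w * e i) ^ 2) <= E i).
  { intros i Hi. assert (Hq := q_low_le P (x i) (node_bounds n x i Hg Hi)). unfold E.
    assert (0 <= eta i ^ 2) by pos. assert (0 <= (w * e i) ^ 2) by pos.
    assert (k0 * (w * e i) ^ 2 <= 2 * cq P (x i) * (w * e i) ^ 2) by mono. nra. }
  assert (one : forall i, (i <= n)%nat -> E i + b <= exp (C3 * step_plus x i) * (E (S i) + b)).
  { intros i Hi. set (delta := step_plus x i).
    assert (Hd : 0 < delta) by (apply (step_positive n x i Hg Hi)).
    assert (Hdh : delta <= h) by (apply Hs, Hi).
    assert (X0 := node_bounds n x i Hg ltac:(lia)). assert (X1 := node_bounds n x (S i) Hg ltac:(lia)).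
    assert (Hxs : x (S i) - x i = delta) by reflexivity.
    assert (Hin : forall t, x i <= t <= x (S i) -> inside t).
    { intros t Ht. destruct X0, X1. split; lra. }
    assert (Huv : x i <= x (S i)) by lra.
    assert (Hkd : K * delta <= / 2).
    { apply Rle_trans with (K * h); [apply Rmult_le_compat_l; lra | auto]. }
    assert (T1 : Rabs (W lam (x i) - (W lam (x (S i)) - delta * V lam (x (S i)) + delta ^ 2 / 2 * W2 lam (x (S i))))
       <= M * w ^ 2 * delta ^ 3).
    { rewrite <- Hxs. apply (taylor3_right (W lam) (V lam) (W2 lam) (W3 lam)); auto.
      - intros; apply W_derive.
      - intros; apply V_derive2.
      - intros; apply W2_derive; auto.
      - intros t Ht. now apply HW; auto. }
    assert (T2 : Rabs (V lam (x (S i)) - V lam (x i) - delta / 2 * (W2 lam (x i) + W2 lam (x (S i))))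
       <= 2 * (M * w ^ 3) * delta ^ 3).
    { rewrite <- Hxs. apply (trapezoid (V lam) (W2 lam) (W3 lam) (W4 lam)); auto.
      - intros; apply V_derive2.
      - intros; apply W2_derive; auto.
      - intros; apply W3_derive; auto.
      - intros t Ht. now apply HW; auto. }
    set (t1 := _ - (_ + _)) in T1. set (t2 := _ - _ - _) in T2.
    assert (Hd3 : 0 < delta ^ 3) by pos.
    assert (Hst := Hstep w lam delta (a (x i)) (a (x (S i))) (cq P (x i)) (cq P (x (S i)))
      (cc P (x i)) (cc P (x (S i))) (e i) (eta i) (e (S i)) (eta (S i)) (- t1) t2 (2 * M * w ^ 3 * delta ^ 3)).
    assert (Hq1 := q_pos (x i) X0). assert (Hq2 := q_pos (x (S i)) X1).
    assert (Hq3 := cq_bnd P (x i) X0). assert (Hq4 := cq_bnd P (x (S i)) X1).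
    apply Rabs_le_between in Hq3, Hq4.
    assert (HwT : w ^ 2 * delta <= Th).
    { apply Rle_trans with (w ^ 2 * h); auto. apply Rmult_le_compat_l; [apply pow2_ge_0 | auto]. }
    assert (HTd : Th * delta <= 1).
    { apply Rle_trans with (Th * h); auto. apply Rmult_le_compat_l; lra. }
    specialize (Hst Hw Hw2 Hd Hkd ltac:(lra) HwT HTd (ca_bnd P _ X0) (ca_bnd P _ X1) ltac:(lra) ltac:(lra)
      (cc_bnd P _ X0) (cc_bnd P _ X1)).
    assert (Hqq : Rabs (cq P (x i) - cq P (x (S i))) <= K * delta).
    { rewrite Rabs_minus_sym, <- Hxs. apply (lipschitz_of_derive (cq P) (cq1 P)); auto.
      - intros; apply cq_derive; auto. now apply Hin.
      - intros; apply cq1_bnd; now apply Hin. }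
    specialize (Hst Hqq).
    assert (HS1 : w * Rabs (- t1) <= 2 * M * w ^ 3 * delta ^ 3).
    { rewrite Rabs_Ropp. apply Rle_trans with (w * (M * w ^ 2 * delta ^ 3)); [apply Rmult_le_compat_l; lra|].
      assert (0 <= M * w ^ 3 * delta ^ 3).
      { apply Rmult_le_pos; [apply Rmult_le_pos; [lra | apply pow_le; lra] | lra]. }
      replace (w * (M * w ^ 2 * delta ^ 3)) with (M * w ^ 3 * delta ^ 3) by ring. lra. }
    assert (HS2 : Rabs t2 <= 2 * M * w ^ 3 * delta ^ 3) by lra.
    specialize (Hst HS1 HS2).
    assert (Ee : e i = e (S i) - delta * ((1 + a (x (S i)) * delta) * eta (S i)
        - (cc P (x (S i)) - lam * cq P (x (S i))) * delta * e (S i)) + - t1).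
    { unfold e at 1. rewrite (gv_step n x lam i Hi). fold delta. unfold flux. fold delta.
      unfold t1, e, eta, W2, cb. field. }
    assert (HA := grid_factor n x h i i (conj Hg Hs) HKh Hi ltac:(lia)). fold delta in HA.
    assert (Eeta : (1 - a (x i) * delta) * eta i + (cc P (x i) - lam * cq P (x i)) * delta * e i
      = (1 + a (x (S i)) * delta) * eta (S i) - (cc P (x (S i)) - lam * cq P (x (S i))) * delta * e (S i) + t2).
    { unfold eta at 1. rewrite (dv_step n x lam i Hi). fold delta. unfold flux. fold delta.
      unfold t2, e, eta, W2, cb. field. lra. }
    specialize (Hst Ee Eeta). fold (E i) (E (S i)) in Hst.
    set (N := Rabs (eta (S i)) + Rabs (w * e (S i))) in *.
    assert (HN : N ^ 2 <= 2 / k0 * E (S i)).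
    { apply Rle_trans with (2 * (eta (S i) ^ 2 + (w * e (S i)) ^ 2)).
      - unfold N. rewrite <- (pow2_abs (eta (S i))), <- (pow2_abs (w * e (S i))).
        generalize (pow2_ge_0 (Rabs (eta (S i)) - Rabs (w * e (S i)))). intros; lra.
      - specialize (Elow (S i) ltac:(lia)).
        apply Rmult_le_reg_l with k0; auto. replace (k0 * (2 / k0 * E (S i))) with (2 * E (S i)) by (field; lra). lra. }
    assert (HS : C * ((2 * M * w ^ 3 * delta ^ 3) ^ 2 / delta) <= C3 * delta * b).
    { replace (C * ((2 * M * w ^ 3 * delta ^ 3) ^ 2 / delta)) with (delta * (B * (delta ^ 4 * w ^ 6)))
        by (unfold B; field; lra).
      replace (C3 * delta * b) with (delta * (B * (h ^ 4 * w ^ 6))) by (unfold b; field; lra).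
      apply Rmult_le_compat_l; [lra|]. apply Rmult_le_compat_l; [lra|].
      apply Rmult_le_compat_r; [apply pow_le; lra|]. apply pow_incr; lra. }
    assert (HCN : C * delta * N ^ 2 <= C3 * delta * E (S i)).
    { replace (C3 * delta * E (S i)) with (C * delta * (2 / k0 * E (S i))) by (unfold C3; field; lra).
      apply Rmult_le_compat_l; [nra | auto]. }
    apply Rle_trans with ((1 + C3 * delta) * (E (S i) + b)).
    - assert (Eeq : E i <= E (S i) + C * delta * N ^ 2 + C * ((2 * M * w ^ 3 * delta ^ 3) ^ 2 / delta)) by exact Hst.
      lra.
    - apply Rmult_le_compat_r.
      + assert (0 <= E (S i)); [|lra]. eapply Rle_trans; [|apply Elow; lia].
        apply Rmult_le_pos; [lra|]. apply Rplus_le_le_0_compat; apply pow2_ge_0.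
      + apply exp_ineq1_le. }
  assert (all : forall j, (j <= S n)%nat -> E (S n - j)%nat + b <= exp (C3 * (r - x (S n - j)%nat)) * b).
  { destruct Hg as [G0 [G1 G2]].
    assert (Elast : E (S n) = 0).
    { unfold E, e, eta. rewrite gv_last, dv_last, G1, W_rgt, V_rgt. ring. }
    induction j as [|j IH]; intros Hj.
    - rewrite Nat.sub_0_r, Elast, G1, Rminus_diag, Rmult_0_r, exp_0. lra.
    - specialize (IH ltac:(lia)). set (i := (S n - S j)%nat) in *.
      replace (S n - j)%nat with (S i) in IH by lia.
      eapply Rle_trans; [apply one; lia|].
      apply Rle_trans with (exp (C3 * step_plus x i) * (exp (C3 * (r - x (S i))) * b)).
      + apply Rmult_le_compat_l; [left; apply exp_pos | exact IH].
      + right. rewrite <- Rmult_assoc, <- exp_plus. f_equal. f_equal. unfold step_plus. ring. }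
  intros i Hi.
  assert (Ei : k0 * (eta i ^ 2 + (w * e i) ^ 2) <= X * b).
  { eapply Rle_trans; [apply Elow, Hi|]. specialize (all (S n - i)%nat ltac:(lia)).
    replace (S n - (S n - i))%nat with i in all by lia.
    assert (exp (C3 * (r - x i)) * b <= X * b); [|lra].
    apply Rmult_le_compat_r; auto. apply exp_le. apply Rmult_le_compat_l; [lra|].
    destruct (node_bounds n x i Hg Hi). lra. }
  set (Y := X * (B / C3) / k0) in *.
  assert (Ei2 : eta i ^ 2 + (w * e i) ^ 2 <= ((1 + Y) * h ^ 2 * w ^ 3) ^ 2).
  { apply Rle_trans with (Y * (h ^ 2 * w ^ 3) ^ 2).
    - apply Rmult_le_reg_l with k0; auto. eapply Rle_trans; [exact Ei|]. right. unfold Y, b. field. lra.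
    - replace (((1 + Y) * h ^ 2 * w ^ 3) ^ 2) with ((1 + Y) ^ 2 * (h ^ 2 * w ^ 3) ^ 2) by ring.
      apply Rmult_le_compat_r; [apply pow2_ge_0 | nra]. }
  assert (Hpos : 0 <= (1 + Y) * h ^ 2 * w ^ 3).
  { apply Rmult_le_pos; [|apply pow_le; lra]. apply Rmult_le_pos; [lra | apply pow2_ge_0]. }
  assert (0 <= eta i ^ 2) by pos. assert (0 <= (w * e i) ^ 2) by pos.
  split.
  - apply abs_le_of_sqr; auto. unfold eta in *. lra.
  - rewrite <- (Rabs_right w) at 1 by lra. rewrite <- Rabs_mult. apply abs_le_of_sqr; auto.
    unfold e in *. lra.
Qed.

Lemma flux_nodal n x h lam i : fine_grid n x h -> K * h <= / 2 -> (i <= n)%nat ->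
  flux n x lam i = (1 - a (x i) * step_plus x i) * dv n x lam i
    + cb lam (x i) * step_plus x i * gv n x lam i.
Proof.
  intros Hf HK Hi. destruct (grid_factor n x h i i Hf HK Hi ltac:(lia)) as [HA _].
  rewrite (dv_step n x lam i Hi). field. lra.
Qed.

Lemma step_bounds n x h i : fine_grid n x h -> (i <= n)%nat -> 0 < step_plus x i <= h.
Proof. intros [Hg Hs] Hi. split; [eapply step_positive; eauto | auto]. Qed.

(** The boundary condition multiplies the error [h^2 om^2] of the value by [lam],
    which gives [h^2 om^4]; the first-order term of Scheme 1 is the length of the
    first cell times the second derivative, of size [om]. *)
Lemma shoot_n_error Th : 0 <= Th -> exists C h0, 1 <= C /\ 0 < h0 /\
  forall n x h lam sch, fine_grid n x h -> 0 < h <= h0 -> -1 <= lam -> om lam ^ 2 * h <= Th ->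
  Rabs (shoot_n n x sch lam - shoot lam)
    <= C * (h ^ 2 * om lam ^ 4 + h ^ scheme_order sch * om lam).
Proof.
  intros HTh. assert (HK := bnd_ge1 P). assert (Hrho := stick_pos P). assert (Hk0 := kap0_nonneg).
  destruct (scheme_error Th HTh) as [C [h0 [HC [Hh0 Hse]]]].
  destruct (W_bound) as [B [HB HWb]].
  set (D := B + C * Th ^ 2). assert (HT2 : 0 <= Th ^ 2) by pos.
  assert (HCT : 0 <= C * Th ^ 2) by pos.
  exists (rho * C + (kap0 + 1) * C + 3 * rho * K * D + 1), (Rmin h0 (Rmin 1 (/ (2 * K)))).
  assert (HrC : 0 < rho * C) by pos.
  assert (HkC : 0 < (kap0 + 1) * C) by pos.
  assert (HrK : 0 < rho * K) by pos.
  assert (HD : 0 < D) by (unfold D; lra).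
  assert (HrKD : 0 < rho * K * D) by pos.
  split; [lra|]. split; [repeat apply Rmin_pos; try lra; apply Rinv_0_lt_compat; lra|].
  intros n x h lam sch Hf [Hh Hh'] Hl HhT.
  assert (A1 : h <= h0) by below Hh'.
  assert (A2 : h <= 1) by below Hh'.
  assert (A3 : h <= / (2 * K)) by below Hh'.
  assert (HKh : K * h <= / 2).
  { apply Rle_trans with (K * / (2 * K)); [apply Rmult_le_compat_l; lra | right; field; lra]. }
  destruct (Hse n x h lam Hf (conj Hh A1) Hl HhT 0%nat ltac:(lia)) as [E1 E2].
  assert (Hw := om_ge1 lam Hl). assert (Hw2 := om_sqr lam Hl). set (w := om lam) in *.
  assert (Hx0 : x 0%nat = l) by apply Hf. rewrite Hx0 in *.
  destruct (HWb lam l Hl (inside_lft)) as [B1 B2]. fold w in B2.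
  set (T := h ^ 2 * w ^ 3). assert (HT : C * h ^ 2 * w ^ 3 = C * T) by (unfold T; ring). rewrite HT in *.
  assert (Hh2 : 0 < h ^ 2) by pos.
  assert (HT0 : 0 < T) by (unfold T; apply Rmult_lt_0_compat; apply pow_lt; lra).
  assert (HTw : T * w = h ^ 2 * w ^ 4) by (unfold T; ring).
  assert (HTT : T * w <= Th ^ 2).
  { rewrite HTw. replace (h ^ 2 * w ^ 4) with ((w ^ 2 * h) ^ 2) by ring. apply pow_incr. split; auto.
    apply Rmult_le_pos; [apply pow2_ge_0 | lra]. }
  assert (HTT' : T <= Th ^ 2) by nra.
  assert (E2' : Rabs (gv n x lam 0 - W lam l) * w ^ 2 <= C * (T * w)).
  { replace (Rabs (gv n x lam 0 - W lam l) * w ^ 2) with (w * (w * Rabs (gv n x lam 0 - W lam l))) by ring.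
    replace (C * (T * w)) with (w * (C * T)) by ring. apply Rmult_le_compat_l; lra. }
  assert (Hkl : Rabs (- (kap0 - lam)) <= (kap0 + 1) * w ^ 2).
  { apply Rabs_le. assert (kap0 <= kap0 * w ^ 2) by nra. lra. }
  assert (I2 : Rabs (- (kap0 - lam) * (gv n x lam 0 - W lam l)) <= (kap0 + 1) * C * (T * w)).
  { eapply Rle_trans; [apply Rabs_mul_le; [exact Hkl | apply Rle_refl]|].
    replace ((kap0 + 1) * w ^ 2 * Rabs (gv n x lam 0 - W lam l))
      with ((kap0 + 1) * (Rabs (gv n x lam 0 - W lam l) * w ^ 2)) by ring.
    rewrite (Rmult_assoc (kap0 + 1)). apply Rmult_le_compat_l; lra. }
  assert (I1 : Rabs (rho * (dv n x lam 0 - V lam l)) <= rho * C * (T * w)).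
  { rewrite Rabs_mult, (Rabs_right rho), Rmult_assoc by lra. apply Rmult_le_compat_l; [lra|].
    assert (C * T <= C * (T * w)) by (apply Rmult_le_compat_l; nra). lra. }
  set (Z := h ^ scheme_order sch * w). assert (HZ : 0 < Z) by (unfold Z; apply Rmult_lt_0_compat; [apply pow_lt|]; lra).
  rewrite <- HTw. set (U := T * w) in *. assert (HU : 0 < U) by (unfold U; apply Rmult_lt_0_compat; lra).
  assert (Hsplit : forall s, Rabs s <= 3 * rho * K * D * Z ->
     Rabs (s + rho * (dv n x lam 0 - V lam l) + - (kap0 - lam) * (gv n x lam 0 - W lam l))
       <= (rho * C + (kap0 + 1) * C + 3 * rho * K * D + 1) * (U + Z)).
  { intros s Hs. eapply Rle_trans; [repeat apply Rabs_add_le; eassumption|].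
    assert (0 <= (rho * C + (kap0 + 1) * C + 1) * Z) by pos.
    assert (0 <= (3 * rho * K * D + 1) * U) by pos. nra. }
  destruct sch.
  - replace (shoot_n n x Scheme1 lam - shoot lam)
      with (rho * (flux n x lam 0 - dv n x lam 0) + rho * (dv n x lam 0 - V lam l) + - (kap0 - lam) * (gv n x lam 0 - W lam l))
      by (unfold shoot_n, shoot, residual; ring).
    apply Hsplit. rewrite (flux_nodal n x h lam 0 Hf HKh ltac:(lia)), Hx0.
    destruct (step_bounds n x h 0 Hf ltac:(lia)) as [d1 d2]. set (d := step_plus x 0) in *.
    assert (Hd0 : Rabs (dv n x lam 0) <= D).
    { replace (dv n x lam 0) with (V lam l + (dv n x lam 0 - V lam l)) by ring. unfold D.
      apply Rabs_add_le; auto. eapply Rle_trans; [exact E1|]. apply Rmult_le_compat_l; lra. }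
    assert (Hg0 : w * Rabs (gv n x lam 0) <= D).
    { replace (gv n x lam 0) with (W lam l + (gv n x lam 0 - W lam l)) by ring. unfold D.
      apply Rle_trans with (w * (Rabs (W lam l) + Rabs (gv n x lam 0 - W lam l))).
      - apply Rmult_le_compat_l; [lra | apply Rabs_triang].
      - assert (C * T <= C * Th ^ 2) by mono. lra. }
    destruct (cb_bound lam l Hl (inside_lft)) as [Hb _]. fold w in Hb.
    replace (rho * ((1 - a l * d) * dv n x lam 0 + cb lam l * d * gv n x lam 0 - dv n x lam 0))
      with (rho * (d * (- (a l * dv n x lam 0) + cb lam l * gv n x lam 0))) by ring.
    rewrite Rabs_mult, (Rabs_right rho) by lra.
    replace (3 * rho * K * D * Z) with (rho * (h * (3 * K * D * w))) by (unfold Z; simpl; ring).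
    apply Rmult_le_compat_l; [lra|]. apply Rabs_mul_le; [rewrite Rabs_right; lra|].
    assert (S1 : Rabs (a l * dv n x lam 0) <= K * D) by (apply Rabs_mul_le; auto; apply ca_bnd, inside_lft).
    assert (S2 : Rabs (cb lam l * gv n x lam 0) <= 2 * K * D * w).
    { rewrite Rabs_mult. apply Rle_trans with (2 * K * w ^ 2 * Rabs (gv n x lam 0)).
      - apply Rmult_le_compat_r; [apply Rabs_pos | auto].
      - replace (2 * K * w ^ 2 * Rabs (gv n x lam 0)) with (2 * K * w * (w * Rabs (gv n x lam 0))) by ring.
        replace (2 * K * D * w) with (2 * K * w * D) by ring. apply Rmult_le_compat_l; [|auto].
        apply Rmult_le_pos; lra. }
    eapply Rle_trans; [apply Rabs_add_le; [rewrite Rabs_Ropp; exact S1 | exact S2]|].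
    assert (0 < K * D) by pos. nra.
  - replace (shoot_n n x Scheme2 lam - shoot lam)
      with (0 + rho * (dv n x lam 0 - V lam l) + - (kap0 - lam) * (gv n x lam 0 - W lam l))
      by (unfold shoot_n, shoot, residual; ring).
    apply Hsplit. rewrite Rabs_R0. apply Rmult_le_pos; lra.
Qed.

(** For [lam <= 0] all terms of the recursion have the same sign; consequently the
    discrete eigenvalues are positive. *)
Lemma gv_sign n x h lam : fine_grid n x h -> K * h <= / 2 -> lam <= 0 ->
  forall i, (i <= n)%nat -> flux n x lam i < 0 /\ 0 < gv n x lam i /\ dv n x lam i < 0.
Proof.
  intros Hf HK Hl.
  assert (Hb : forall i, (i <= S n)%nat -> 0 <= cb lam (x i)).
  { intros i Hi. assert (Hx := node_bounds n x i (proj1 Hf) Hi). unfold cb.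
    assert (H1 := cc_nonneg P _ Hx). assert (H2 := q_pos _ Hx). nra. }
  assert (main : forall j, (j <= n)%nat -> let i := (n - j)%nat in
     flux n x lam i < 0 /\ 0 < gv n x lam i /\ dv n x lam i < 0).
  { assert (one : forall i, (i <= n)%nat -> 0 <= gv n x lam (S i) -> dv n x lam (S i) < 0 ->
      flux n x lam i < 0 /\ 0 < gv n x lam i /\ dv n x lam i < 0).
    { intros i Hi G1 D1. destruct (step_bounds n x h i Hf Hi) as [d1 d2].
      destruct (grid_factor n x h i i Hf HK Hi ltac:(lia)) as [A1 _].
      destruct (grid_factor n x h i (S i) Hf HK Hi ltac:(lia)) as [_ A2].
      assert (B1 := Hb i ltac:(lia)). assert (B2 := Hb (S i) ltac:(lia)).
      set (d := step_plus x i) in *.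
      assert (F : flux n x lam i < 0).
      { unfold flux. fold d. assert (0 <= cb lam (x (S i)) * d * gv n x lam (S i)).
        { apply Rmult_le_pos; auto. apply Rmult_le_pos; lra. } nra. }
      assert (G : 0 < gv n x lam i) by (rewrite (gv_step n x lam i Hi); fold d; nra).
      split; [auto|]. split; [auto|]. rewrite (dv_step n x lam i Hi). fold d.
      assert (0 <= cb lam (x i) * d * gv n x lam i).
      { apply Rmult_le_pos; [|lra]. apply Rmult_le_pos; lra. }
      assert (0 < / (1 - a (x i) * d)) by pos. nra. }
    induction j as [|j IH]; intros Hj i.
    - unfold i. rewrite Nat.sub_0_r. apply one; auto.
      + rewrite gv_last. lra.
      + rewrite dv_last. lra.
    - specialize (IH ltac:(lia)). cbv zeta in IH. replace (n - j)%nat with (S i) in IH by (unfold i; lia).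
      apply one; [unfold i; lia | |]; lra. }
  intros i Hi. specialize (main (n - i)%nat ltac:(lia)). cbv zeta in main.
  now replace (n - (n - i))%nat with i in main by lia.
Qed.

Lemma gv_next_to_last n x h lam : fine_grid n x h -> K * h <= / 2 -> 0 < gv n x lam n.
Proof.
  intros Hf HK. destruct (step_bounds n x h n Hf ltac:(lia)) as [d1 _].
  destruct (grid_factor n x h n (S n) Hf HK ltac:(lia) ltac:(lia)) as [_ A2].
  rewrite (gv_step n x lam n ltac:(lia)). unfold flux. rewrite gv_last, dv_last. nra.
Qed.

Lemma shoot_n_neg n x h lam sch : fine_grid n x h -> K * h <= / 2 -> lam <= 0 ->
  shoot_n n x sch lam < 0.
Proof.
  intros Hf HK Hl. destruct (gv_sign n x h lam Hf HK Hl 0%nat ltac:(lia)) as [F [G D]].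
  assert (Hrho := stick_pos P). assert (Hk := kap0_nonneg). unfold shoot_n.
  assert (0 <= (kap0 - lam) * gv n x lam 0) by pos.
  destruct sch; nra.
Qed.

(** * The discrete eigenvalue problem *)

Section Coefficients.

Variables mu sigma kappa : R -> R.
Hypothesis Hsig : forall t, inside t -> 0 < sigma t ^ 2.
Hypothesis Hca : forall t, inside t -> ca P t = mu t / sigma t ^ 2.
Hypothesis Hcq : forall t, inside t -> cq P t = / sigma t ^ 2.
Hypothesis Hcc : forall t, inside t -> cc P t = kappa t / sigma t ^ 2.

Lemma kap0_eq : kap0 = kappa l.
Proof.
  unfold kap0. assert (Hi := inside_lft). rewrite (Hcc _ Hi), (Hcq _ Hi).
  assert (H := Hsig _ Hi). set (s := sigma l ^ 2) in *. field. lra.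
Qed.

Definition beta_den (x : nat -> R) (sch : scheme) : R :=
  match sch with Scheme1 => 1 | Scheme2 => 1 + (rho * q l - a l) * step_plus x 0 end.

Lemma beta_eq x sch : x 0%nat = l -> beta x sch rho mu sigma = / beta_den x sch.
Proof.
  intros Hx. assert (Hi := inside_lft). assert (Hs := Hsig l Hi).
  destruct sch; unfold beta, beta_den; [now rewrite Rinv_1|]. rewrite Hx, (Hcq l Hi), (Hca l Hi).
  f_equal. set (S2 := sigma l ^ 2) in *. field. lra.
Qed.

(** The two one-sided expressions of the nodal slope agree exactly when the
    difference equation holds at the node, so an eigenvector follows the recursion
    from the right end up to a factor, and its boundary condition is the zero of
    [shoot_n]. *)
Lemma discrete_shooting n x h sch lam g : fine_grid n x h -> K * h <= / 2 ->
  discrete_eigenpair x sch rho mu sigma kappa n lam g ->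
  exists s, s <> 0 /\ (forall i, (i <= S n)%nat -> g i = s * gv n x lam i) /\
    shoot_n n x sch lam = 0.
Proof.
  intros Hf HK [[i0 [Hi0 Hne]] [Heq Hlast]].
  assert (Hgn := gv_next_to_last n x h lam Hf HK).
  set (s := g n / gv n x lam n).
  assert (main : forall j, (j <= n)%nat -> g (n - j)%nat = s * gv n x lam (n - j) /\
     g (S (n - j)) = s * gv n x lam (S (n - j))).
  { induction j as [|j IH]; intros Hj.
    - rewrite Nat.sub_0_r, Hlast, gv_last. split; [unfold s; field; lra | ring].
    - destruct (IH ltac:(lia)) as [I1 I2]. set (i := (n - S j)%nat) in *.
      replace (n - j)%nat with (S i) in I1, I2 by (unfold i; lia).
      split; [|exact I1].
      assert (Hi : (S i <= n)%nat) by (unfold i; lia).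
      assert (Hin := node_bounds n x (S i) (proj1 Hf) ltac:(lia)).
      assert (E := Heq (S i) Hi). unfold generator, nabla, laplacian, nabla_plus, nabla_minus, step, step_minus in E.
      simpl pred in E. fold (step_plus x i) in E.
      destruct (step_bounds n x h (S i) Hf Hi) as [d1 _].
      destruct (step_bounds n x h i Hf ltac:(lia)) as [d2 _].
      destruct (grid_factor n x h (S i) (S i) Hf HK Hi ltac:(lia)) as [A1 _].
      destruct (grid_factor n x h i (S i) Hf HK ltac:(lia) ltac:(lia)) as [_ A2].
      assert (F1 := flux_nodal n x h lam (S i) Hf HK Hi).
      assert (G1 := gv_step n x lam (S i) Hi). assert (G2 := gv_step n x lam i ltac:(lia)).
      assert (F2 : flux n x lam i = (1 + a (x (S i)) * step_plus x i) * dv n x lam (S i) - cb lam (x (S i)) * step_plus x i * gv n x lam (S i)) by reflexivity.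
      rewrite G2. rewrite I1, I2 in E.
      set (d := step_plus x i) in *. set (d' := step_plus x (S i)) in *.
      set (gi := gv n x lam (S i)) in *. set (gp := gv n x lam (S (S i))) in *.
      replace gp with (gi + d' * flux n x lam (S i)) in E by lra.
      set (f1 := flux n x lam (S i)) in *. set (D := dv n x lam (S i)) in *.
      unfold cb in *. rewrite (Hca _ Hin), (Hcq _ Hin), (Hcc _ Hin) in *.
      assert (Hs := Hsig _ Hin). set (S2 := sigma (x (S i)) ^ 2) in *.
      set (m := mu (x (S i))) in *. set (k := kappa (x (S i))) in *.
      set (dm := (s * gi - g i) / d).
      assert (Edm : g i = s * gi - d * dm) by (unfold dm; field; lra).
      assert (E' : (1 + m / S2 * d) * (s * f1) - (1 - m / S2 * d') * dm = (d + d') * ((k - lam) / S2) * (s * gi)).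
      { replace ((s * (gi + d' * f1) - s * gi) / d') with (s * f1) in E by (field; lra).
        fold dm in E.
        apply (Rmult_eq_reg_l (S2 / (d + d'))); [|apply Rgt_not_eq; apply Rdiv_lt_0_compat; lra].
        transitivity (m * (d / (2 * (/ 2 * (d' + d))) * (s * f1) + d' / (2 * (/ 2 * (d' + d))) * dm)
           + / 2 * S2 * (/ (/ 2 * (d' + d)) * (s * f1 - dm))); [field; lra|].
        transitivity (k * (s * gi) - lam * (s * gi)); [lra | field; lra]. }
      assert (Edm2 : dm = s * flux n x lam i).
      { apply (Rmult_eq_reg_l (1 - m / S2 * d')); [|lra].
        replace ((1 - m / S2 * d') * dm) with ((1 + m / S2 * d) * (s * f1) - (d + d') * ((k - lam) / S2) * (s * gi)) by lra.
        rewrite F1, F2. field. lra. }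
      rewrite Edm, Edm2. ring. }
  assert (all : forall i, (i <= S n)%nat -> g i = s * gv n x lam i).
  { intros i Hi. destruct (Nat.eq_dec i (S n)) as [->|].
    - rewrite Hlast, gv_last. ring.
    - destruct (main (n - i)%nat ltac:(lia)) as [I _]. now replace (n - (n - i))%nat with i in I by lia. }
  assert (Hs : s <> 0).
  { intros E. apply Hne. rewrite (all i0 ltac:(lia)), E. ring. }
  exists s. split; [auto|]. split; [auto|].
  assert (Hx0 : x 0%nat = l) by apply Hf. assert (Hin := inside_lft).
  assert (E := Heq 0%nat ltac:(lia)). unfold generator, nabla_plus in E.
  rewrite (all 0%nat ltac:(lia)), (all 1%nat ltac:(lia)), (beta_eq x sch Hx0), Hx0 in E.
  destruct (step_bounds n x h 0 Hf ltac:(lia)) as [d1 d2].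
  assert (G := gv_step n x lam 0 ltac:(lia)).
  destruct (grid_factor n x h 0 0 Hf HK ltac:(lia) ltac:(lia)) as [A1 _]. rewrite Hx0 in A1.
  assert (F1 := flux_nodal n x h lam 0 Hf HK ltac:(lia)). rewrite Hx0 in F1.
  set (d := step_plus x 0) in *.
  replace (gv n x lam 1) with (gv n x lam 0 + d * flux n x lam 0) in E by lra.
  replace ((s * (gv n x lam 0 + d * flux n x lam 0) - s * gv n x lam 0) / d) with (s * flux n x lam 0) in E by (field; lra).
  assert (Hrho := stick_pos P). assert (HK1 := bnd_ge1 P).
  assert (Hql := cq_bnd P l Hin). assert (Hqp := q_pos l Hin). apply Rabs_le_between in Hql.
  apply (Rmult_eq_reg_l s); auto. rewrite Rmult_0_r. unfold shoot_n. rewrite kap0_eq.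
  destruct sch; simpl in E.
  - rewrite Rinv_1 in E. lra.
  - fold d in E.
    assert (Hal := ca_bnd P l Hin).
    assert (Had : Rabs (a l * d) <= K * h) by (apply Rabs_mul_le; auto; rewrite Rabs_right; lra).
    apply Rabs_le_between in Had.
    assert (0 <= rho * q l * d) by (apply Rmult_le_pos; nra).
    assert (Hbd : 0 < 1 + (rho * q l - a l) * d) by lra.
    assert (E2 : s * (rho * flux n x lam 0) = (kappa l - lam) * (1 + (rho * q l - a l) * d) * (s * gv n x lam 0)).
    { apply (Rmult_eq_reg_l (/ (1 + (rho * q l - a l) * d))); [|apply Rinv_neq_0_compat; lra].
      transitivity (rho * / (1 + (rho * q l - a l) * d) * (s * flux n x lam 0)); [ring|].
      transitivity ((kappa l - lam) * (s * gv n x lam 0)); [lra | field; lra]. }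
    apply (Rmult_eq_reg_l (1 - a l * d)); [|lra]. rewrite Rmult_0_r.
    rewrite F1 in E2. unfold cb in E2.
    assert (Ecc : cc P l = kappa l * q l).
    { rewrite (Hcc l Hin), (Hcq l Hin). reflexivity. }
    rewrite Ecc in E2. nra.
Qed.

End Coefficients.

(** * The discrete speed measure *)

Section Weights.

Variables mu sigma : R -> R.
Hypothesis Hsig : forall t, inside t -> 0 < sigma t ^ 2.
Hypothesis Hca : forall t, inside t -> ca P t = mu t / sigma t ^ 2.
Hypothesis Hcq : forall t, inside t -> cq P t = / sigma t ^ 2.

Variables (n : nat) (x : nat -> R) (h : R) (sch : scheme).
Hypothesis Hf : fine_grid n x h.
Hypothesis HK : K * h <= / 2.

Notation del := (step_plus x).
Notation Ap i := (1 - a (x i) * del i).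
Notation Am i := (1 + a (x i) * del (pred i)).

(** The product in the definition of the speed measure, regrouped by cells: up to
    the factor [gauge] it is a discrete version of [scale]. *)
Fixpoint ratio (i : nat) : R :=
  match i with O => 1 | S j => ratio j * (Am (S j) / Ap j) end.

Definition gauge : R := speed_left x sch rho mu sigma * rho * / beta_den x sch * Ap 0.

Lemma Ap_bounds i : (i <= n)%nat -> / 2 <= Ap i <= 3 / 2.
Proof. intros Hi. exact (proj1 (grid_factor n x h i i Hf HK Hi ltac:(lia))). Qed.

Lemma Am_bounds i : (i <= n)%nat -> / 2 <= 1 + a (x (S i)) * del i <= 3 / 2.
Proof. intros Hi. exact (proj2 (grid_factor n x h i (S i) Hf HK Hi ltac:(lia))). Qed.

Lemma density_ratio i : (i < n)%nat ->
  discrete_density x sch rho mu sigma (S i)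
  = gauge * ratio (S i) * (2 * q (x (S i)) / (Ap (S i) * Am (S i))).
Proof.
  assert (Hx0 : x 0%nat = l) by apply Hf.
  assert (Hb := beta_eq mu sigma Hsig Hca Hcq x sch Hx0).
  assert (pos : forall j, (j <= S n)%nat -> mu (x j) = a (x j) * sigma (x j) ^ 2
     /\ 0 < sigma (x j) ^ 2 /\ q (x j) = / sigma (x j) ^ 2).
  { intros j Hj. assert (Hin := node_bounds n x j (proj1 Hf) Hj). assert (Hs := Hsig _ Hin).
    rewrite (Hca _ Hin), (Hcq _ Hin). set (s := sigma (x j) ^ 2) in *. split; [field; lra | auto]. }
  induction i as [|i IH]; intros Hi.
  - unfold discrete_density, gauge. simpl seq. simpl fold_right. simpl ratio. simpl pred.
    rewrite Hb. destruct (pos 1%nat ltac:(lia)) as [E1 [E2 E3]]. rewrite E1, E3.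
    assert (B1 := Ap_bounds 0 ltac:(lia)). assert (B2 := Ap_bounds 1 ltac:(lia)).
    assert (B3 := Am_bounds 0 ltac:(lia)).
    set (s := sigma (x 1%nat) ^ 2) in *. set (bd := / beta_den x sch).
    replace (- (a (x 1%nat) * s) * del 1 + s) with (s * Ap 1) by ring.
    set (u := Ap 1) in *. set (v := Ap 0) in *. set (z := 1 + _) in *. field. repeat split; lra.
  - specialize (IH ltac:(lia)). unfold discrete_density in *.
    replace (S (S i) - 1)%nat with (S i) by lia. replace (S i - 1)%nat with i in IH by lia.
    rewrite seq_S, map_app. cbn [map]. rewrite fold_right_Rmult_snoc.
    replace (1 + i)%nat with (S i) by lia. rewrite <- Rmult_assoc, IH.
    destruct (pos (S i) ltac:(lia)) as [E1 [E2 E3]]. destruct (pos (S (S i)) ltac:(lia)) as [F1 [F2 F3]].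
    rewrite E1, E3, F1, F3. simpl ratio. unfold step_minus. simpl pred. fold (del i).
    assert (B1 := Ap_bounds i ltac:(lia)). assert (B2 := Ap_bounds (S i) ltac:(lia)).
    assert (B3 := Am_bounds i ltac:(lia)). assert (B4 := Am_bounds (S i) ltac:(lia)).
    assert (B5 := Ap_bounds (S (S i)) ltac:(lia)).
    set (s := sigma (x (S i)) ^ 2) in *. set (s' := sigma (x (S (S i))) ^ 2) in *.
    replace (- (a (x (S (S i))) * s') * del (S (S i)) + s') with (s' * Ap (S (S i))) by ring.
    replace (a (x (S i)) * s * del i + s) with (s * (1 + a (x (S i)) * del i)) by ring.
    set (u1 := Ap i) in *. set (u2 := Ap (S i)) in *. set (u3 := Ap (S (S i))) in *.
    set (v1 := 1 + a (x (S i)) * del i) in *. set (v2 := 1 + a (x (S (S i))) * del (S i)) in *.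
    field. repeat split; lra.
Qed.

(** Every interior node shares its mass between the two cells that meet there. *)
Lemma speed_split i : (i < n)%nat -> discrete_speed x sch rho mu sigma (S i)
  = gauge * ratio (S i) * q (x (S i)) * (del (S i) / Ap (S i) + del i / Am (S i)).
Proof.
  intros Hi. unfold discrete_speed. rewrite density_ratio by auto.
  assert (B2 := Ap_bounds (S i) ltac:(lia)). assert (B3 := Am_bounds i ltac:(lia)).
  unfold step, step_minus. simpl pred. fold (del i). field.
  simpl pred. lra.
Qed.

Definition interval_rule (f : nat -> R) (i : nat) : R :=
  del i * (gauge * ratio i * q (x i) * f i / Ap i
           + gauge * ratio (S i) * q (x (S i)) * f (S i) / Am (S i)).

Lemma sum_by_intervals f : f (S n) = 0 ->
  sum_f_R0 (fun i => f i * discrete_speed x sch rho mu sigma i) n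
  = f 0%nat * (discrete_speed x sch rho mu sigma 0 - gauge * q (x 0%nat) * del 0 / Ap 0)
    + sum_f_R0 (interval_rule f) n.
Proof.
  intros Hlast.
  assert (main : forall m, (m <= n)%nat ->
    sum_f_R0 (fun i => f i * discrete_speed x sch rho mu sigma i) m
    = f 0%nat * (discrete_speed x sch rho mu sigma 0 - gauge * q (x 0%nat) * del 0 / Ap 0)
      + sum_f_R0 (interval_rule f) m
      - del m * (gauge * ratio (S m) * q (x (S m)) * f (S m) / Am (S m))).
  { induction m as [|m IH]; intros Hm.
    - simpl sum_f_R0. unfold interval_rule. simpl (ratio 0).
      unfold Rdiv. simpl pred. simpl discrete_speed. ring.
    - rewrite !tech5, IH by lia. rewrite (speed_split m) by lia. unfold interval_rule. unfold Rdiv.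
      simpl pred. ring. }
  rewrite (main n (le_n n)), Hlast. unfold Rdiv. ring.
Qed.

End Weights.

(** Up to a product of two increments this is the trapezoidal rule for [scale' = 2
    a scale]. *)
Lemma scale_truncation : exists C, 1 <= C /\ forall u v, inside u -> inside v -> u <= v ->
  v - u <= 1 ->
  Rabs ((1 - a u * (v - u)) * scale v - (1 + a v * (v - u)) * scale u) <= C * (v - u) ^ 3.
Proof.
  destruct (scale_bounds) as [m [M [Hm [HM Hs]]]]. assert (HK := bnd_ge1 P).
  set (B := (2 * K + 12 * (K * K) + 8 * (K * K * K)) * M).
  assert (HKK : 1 <= K * K) by nra. assert (HKKK : 1 <= K * K * K) by nra.
  assert (HKM : 0 < K * M) by pos.
  assert (HB : 0 < B) by (unfold B; apply Rmult_lt_0_compat; lra).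
  assert (HKKM : 0 < K * (2 * K * M)) by pos.
  exists (2 * B + K * (2 * K * M) + 1). split; [lra|].
  intros u v Hu Hv Huv Hd.
  assert (Hin : forall t, u <= t <= v -> inside t) by (intros t Ht; destruct Hu, Hv; split; lra).
  assert (D0 := scale_derive).
  assert (sb : forall t, u <= t <= v -> Rabs (scale t) <= M).
  { intros t Ht. specialize (Hs t (Hin t Ht)). rewrite Rabs_right; lra. }
  assert (T := trapezoid scale (fun t => 2 * a t * scale t)
    (fun t => (2 * ca1 P t + 4 * (a t * a t)) * scale t)
    (fun t => (2 * ca2 P t + 12 * (a t * ca1 P t) + 8 * (a t * a t * a t)) * scale t) u v B Huv).
  assert (T1 : Rabs (scale v - scale u - (v - u) / 2 * (2 * a u * scale u + 2 * a v * scale v)) <= 2 * B * (v - u) ^ 3).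
  { apply T.
    - intros; apply D0.
    - intros t Ht. assert (D1 := ca_derive P t (Hin t Ht)). derive. ring.
    - intros t Ht. assert (D1 := ca_derive P t (Hin t Ht)). assert (D2 := ca1_derive P t (Hin t Ht)). derive. ring.
    - intros t Ht. assert (A := ca_bnd P t (Hin t Ht)). assert (A1 := ca1_bnd P t (Hin t Ht)).
      assert (A2 := ca2_bnd P t (Hin t Ht)). unfold B.
      assert (R2 : Rabs 2 <= 2) by (rewrite Rabs_right; lra). assert (R12 : Rabs 12 <= 12) by (rewrite Rabs_right; lra).
      assert (R8 : Rabs 8 <= 8) by (rewrite Rabs_right; lra).
      apply Rabs_mul_le; [|auto]. apply Rabs_add_le; [apply Rabs_add_le|].
      + apply Rabs_mul_le; [exact R2 | exact A2].
      + apply Rabs_mul_le; [exact R12 | now apply Rabs_mul_le].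
      + apply Rabs_mul_le; [exact R8 | apply Rabs_mul_le; [now apply Rabs_mul_le | auto]]. }
  assert (L1 : Rabs (a v - a u) <= K * (v - u)).
  { apply (lipschitz_of_derive a (ca1 P)); auto; intros;
      [apply ca_derive | apply ca1_bnd]; now apply Hin. }
  assert (L2 : Rabs (scale v - scale u) <= 2 * K * M * (v - u)).
  { apply (lipschitz_of_derive scale (fun t => 2 * a t * scale t)); auto.
    intros t Ht. apply Rabs_mul_le; [|auto]. apply Rabs_mul_le; [rewrite Rabs_right; lra | apply ca_bnd, Hin, Ht]. }
  set (d := v - u) in *. assert (Hd0 : 0 <= d) by (unfold d; lra).
  replace ((1 - a u * d) * scale v - (1 + a v * d) * scale u)
    with ((scale v - scale u - d / 2 * (2 * a u * scale u + 2 * a v * scale v)) + d * ((a v - a u) * (scale v - scale u))) by field.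
  apply Rle_trans with (2 * B * d ^ 3 + d * (K * d * (2 * K * M * d))).
  - apply Rabs_add_le; auto. apply Rabs_mul_le; [rewrite Rabs_right; lra|]. now apply Rabs_mul_le.
  - assert (0 <= d ^ 3) by pos. nra.
Qed.

(** The factor [Am / Ap] of one cell reproduces [scale] up to a third-order error,
    and these errors are amplified by a bounded factor over the whole grid. *)
Lemma ratio_error G : 0 <= G -> exists C h0, 1 <= C /\ 0 < h0 /\
  forall n x h y0, fine_grid n x h -> 0 < h <= h0 -> Rabs (y0 - 1) <= G * h ^ 2 ->
  forall i, (i <= S n)%nat -> Rabs (y0 * ratio x i - scale (x i)) <= C * h ^ 2.
Proof.
  intros HG. destruct scale_truncation as [C [HC Htr]]. assert (HK := bnd_ge1 P). assert (Hlr := lft_rgt P).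
  set (X := exp (4 * K * (r - l))). assert (HX : 0 < X) by apply exp_pos.
  exists (1 + X * (G + C)), (Rmin 1 (/ (2 * K))).
  assert (0 < X * (G + C)) by pos.
  split; [lra|]. split; [apply Rmin_pos; [lra | apply Rinv_0_lt_compat; lra]|].
  intros n x h y0 Hf [Hh Hh'] Hy.
  assert (A2 : h <= 1) by below Hh'.
  assert (A3 : h <= / (2 * K)) by below Hh'.
  assert (HKh : K * h <= / 2).
  { apply Rle_trans with (K * / (2 * K)); [apply Rmult_le_compat_l; lra | right; field; lra]. }
  assert (Hh2 : 0 < h ^ 2) by pos.
  set (b := C * h ^ 2). assert (Hb : 0 <= b) by (unfold b; apply Rmult_le_pos; lra).
  assert (Hx0 : x 0%nat = l) by apply Hf.
  assert (main : forall i, (i <= S n)%nat ->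
    Rabs (y0 * ratio x i - scale (x i)) + b <= exp (4 * K * (x i - l)) * (G * h ^ 2 + b)).
  { induction i as [|i IH]; intros Hi.
    - simpl ratio. rewrite Hx0, scale_lft, Rminus_diag, Rmult_0_r, exp_0, Rmult_1_r. lra.
    - specialize (IH ltac:(lia)).
      assert (X0 := node_bounds n x i (proj1 Hf) ltac:(lia)).
      assert (X1 := node_bounds n x (S i) (proj1 Hf) ltac:(lia)).
      destruct (step_bounds n x h i Hf ltac:(lia)) as [d1 d2].
      assert (B1 := Ap_bounds n x h Hf HKh i ltac:(lia)).
      assert (B2 := Am_bounds n x h Hf HKh i ltac:(lia)).
      assert (T := Htr (x i) (x (S i)) X0 X1). change (x (S i) - x i) with (step_plus x i) in T.
      set (d := step_plus x i) in *.
      specialize (T ltac:(unfold d, step_plus in d1; lra) ltac:(lra)).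
      simpl ratio. simpl pred. fold d.
      set (p := 1 - a (x i) * d) in *. set (m := 1 + a (x (S i)) * d) in *.
      assert (Had : Rabs (a (x i) * d) <= K * d).
      { apply Rabs_mul_le; [now apply ca_bnd | rewrite Rabs_right; lra]. }
      assert (Had' : Rabs (a (x (S i)) * d) <= K * d).
      { apply Rabs_mul_le; [now apply ca_bnd | rewrite Rabs_right; lra]. }
      apply Rabs_le_between in Had, Had'.
      assert (HKd : K * d <= K * h) by mono.
      assert (Hmp : m / p <= 1 + 4 * K * d).
      { apply Rmult_le_reg_r with p; [lra|]. replace (m / p * p) with m by (field; lra).
        unfold m, p. assert (0 <= K * d) by pos.
        apply Rle_trans with ((1 + 4 * K * d) * (1 - K * d)); [nra|]. apply Rmult_le_compat_l; lra. }
      assert (Hmp0 : 0 < m / p) by pos.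
      replace (y0 * (ratio x i * (m / p)) - scale (x (S i)))
        with (m / p * (y0 * ratio x i - scale (x i)) + - ((p * scale (x (S i)) - m * scale (x i)) * / p)) by (field; lra).
      assert (E : Rabs (m / p * (y0 * ratio x i - scale (x i)) + - ((p * scale (x (S i)) - m * scale (x i)) * / p))
        <= (1 + 4 * K * d) * Rabs (y0 * ratio x i - scale (x i)) + C * d ^ 3 * 2).
      { apply Rabs_add_le.
        - rewrite Rabs_mult, (Rabs_right (m / p)) by lra. apply Rmult_le_compat_r; [apply Rabs_pos | auto].
        - rewrite Rabs_Ropp. apply Rabs_mul_le; auto. rewrite Rabs_right by pos.
          rewrite <- (Rinv_inv 2). apply Rinv_le_contravar; lra. }
      assert (Hd3 : C * d ^ 3 * 2 <= 4 * K * d * b).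
      { assert (d ^ 2 <= h ^ 2) by (apply pow_incr; lra). unfold b.
        replace (C * d ^ 3 * 2) with (2 * d * (C * d ^ 2)) by ring.
        apply Rle_trans with (2 * d * (C * h ^ 2)).
        - apply Rmult_le_compat_l; [lra|]. apply Rmult_le_compat_l; lra.
        - apply Rmult_le_compat_r; [unfold b in Hb; lra | nra]. }
      apply Rle_trans with ((1 + 4 * K * d) * (Rabs (y0 * ratio x i - scale (x i)) + b)); [lra|].
      apply Rle_trans with (exp (4 * K * d) * (exp (4 * K * (x i - l)) * (G * h ^ 2 + b))).
      + apply Rmult_le_compat; auto.
        * assert (0 <= K * d) by pos. lra.
        * generalize (Rabs_pos (y0 * ratio x i - scale (x i))). lra.
        * apply exp_ineq1_le.
      + right. rewrite <- Rmult_assoc, <- exp_plus. f_equal. f_equal. unfold d, step_plus. ring. }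
  assert (HGh2 : 0 <= G * h ^ 2) by pos.
  intros i Hi. specialize (main i Hi). assert (X0 := node_bounds n x i (proj1 Hf) Hi).
  assert (exp (4 * K * (x i - l)) * (G * h ^ 2 + b) <= X * (G * h ^ 2 + b)).
  { apply Rmult_le_compat_r; [lra|]. apply exp_le. apply Rmult_le_compat_l; [lra|]. destruct X0; lra. }
  apply Rle_trans with (X * (G * h ^ 2 + b)); [lra|]. unfold b. assert (0 <= X * (G + C) * h ^ 2) by pos. lra.
Qed.

Definition matches (mu sigma : R -> R) : Prop := forall t, inside t ->
  0 < sigma t ^ 2 /\ ca P t = mu t / sigma t ^ 2 /\ cq P t = / sigma t ^ 2.

Lemma bnd_mesh_small h : 0 < h -> h <= / (2 * K) -> K * h <= / 2.
Proof.
  intros H1 H2. assert (HK := bnd_ge1 P).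
  apply Rle_trans with (K * / (2 * K)); [apply Rmult_le_compat_l; lra | right; field; lra].
Qed.

(** In both schemes the prefactors of the speed measure are second-order
    accurate, and in Scheme 2 the atom at the left end carries the half-cell
    [q(l) delta] that the trapezoidal rule requires. *)
Lemma left_weight_error : exists C h0, 1 <= C /\ 0 < h0 /\
  forall n x h sch mu sigma, matches mu sigma -> fine_grid n x h -> 0 < h <= h0 ->
  Rabs (gauge mu sigma x sch - 1) <= C * h ^ 2 /\
  Rabs (discrete_speed x sch rho mu sigma 0
    - gauge mu sigma x sch * q (x 0%nat) * step_plus x 0 / (1 - a (x 0%nat) * step_plus x 0) - / rho)
  <= C * h ^ scheme_order sch.
Proof.
  assert (HK := bnd_ge1 P). assert (Hrho := stick_pos P).
  assert (Hir : 0 < / rho) by pos.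
  set (G := (1 + rho) * K).
  assert (HG : 1 <= G) by (unfold G; nra).
  assert (HG2 : G <= G ^ 2) by nra.
  assert (HrK : rho * K <= G) by (unfold G; nra).
  assert (HKG : K <= G) by (unfold G; nra).
  exists ((1 + / rho) * (20 * G ^ 2)), (/ (4 * G)).
  assert (HC0 : 0 <= / rho * (20 * G ^ 2)) by pos.
  split; [lra|]. split; [apply Rinv_0_lt_compat; lra|].
  intros n x h sch mu sigma Hm Hf [Hh Hh'].
  assert (HGh : G * h <= / 4).
  { apply Rle_trans with (G * / (4 * G)); [apply Rmult_le_compat_l; lra | right; field; lra]. }
  assert (Hh1 : h <= 1) by nra.
  assert (Hx0 : x 0%nat = l) by apply Hf.
  assert (Hin := inside_lft). destruct (Hm l Hin) as [Hs [Ea Eq]].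
  unfold gauge. simpl discrete_speed. unfold speed_left. rewrite Hx0.
  destruct (step_bounds n x h 0 Hf ltac:(lia)) as [d1 d2]. set (d := step_plus x 0) in *.
  assert (Ba := ca_bnd P l Hin). assert (Bq := cq_bnd P l Hin). assert (Hqp := q_pos l Hin).
  set (s := a l * d). set (t := rho * q l * d).
  assert (Hs' : Rabs s <= G * h).
  { unfold s. apply Rle_trans with (K * h); [|apply Rmult_le_compat_r; lra].
    apply Rabs_mul_le; auto. rewrite Rabs_right; lra. }
  assert (Ht' : Rabs t <= G * h).
  { unfold t. apply Rle_trans with (rho * K * h); [|apply Rmult_le_compat_r; lra].
    apply Rabs_mul_le; [apply Rabs_mul_le; auto; rewrite Rabs_right; lra | rewrite Rabs_right; lra]. }
  assert (Hh2 : 0 < h ^ 2) by pos.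
  assert (sq : forall u, Rabs u <= G * h -> u ^ 2 <= G ^ 2 * h ^ 2).
  { intros u Hu. rewrite <- (pow2_abs u), <- Rpow_mult_distr. apply pow_incr. split; [apply Rabs_pos | auto]. }
  assert (Es := exp_second_order s ltac:(lra)). assert (Et := exp_second_order t ltac:(lra)).
  assert (Ss := sq s Hs'). assert (St := sq t Ht').
  assert (Sst : Rabs (t * s) <= G ^ 2 * h ^ 2).
  { replace (G ^ 2 * h ^ 2) with (G * h * (G * h)) by ring. now apply Rabs_mul_le. }
  apply Rabs_le_between in Hs', Ht', Es, Et, Sst.
  set (Z := G ^ 2 * h ^ 2) in *. assert (HZ : 0 <= Z) by (unfold Z; apply Rmult_le_pos; lra).
  assert (HZ' : 20 * Z <= (1 + / rho) * (20 * G ^ 2) * h ^ 2).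
  { replace ((1 + / rho) * (20 * G ^ 2) * h ^ 2) with (20 * Z + / rho * (20 * Z)) by (unfold Z; ring).
    assert (0 <= / rho * (20 * Z)) by pos. lra. }
  set (es := exp s) in *. set (et := exp t) in *.
  destruct sch; unfold alpha, beta_den; rewrite ?Hx0; fold d.
  - replace (mu l / sigma l ^ 2 * d) with s by (unfold s; rewrite Ea; reflexivity). fold es s.
    split.
    + replace (/ rho * es * rho * / 1 * (1 - s) - 1) with ((es - 1 - s) * (1 - s) + - s ^ 2) by (field; lra).
      eapply Rle_trans; [|exact HZ']. apply Rle_trans with (3 * Z * 2 + Z); [|lra].
      apply Rabs_add_le.
      * apply Rabs_mul_le; apply Rabs_le; lra.
      * rewrite Rabs_Ropp, Rabs_right; [auto | apply Rle_ge, pow2_ge_0].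
    + replace (/ rho * es - / rho * es * rho * / 1 * (1 - s) * q l * d / (1 - s) - / rho)
        with (/ rho * (es - 1 - s + (s + - (es * t)))) by (unfold t; field; lra).
      replace ((1 + / rho) * (20 * G ^ 2) * h ^ scheme_order Scheme1)
        with (/ rho * (20 * G ^ 2 * h) + 20 * G ^ 2 * h) by (simpl; ring).
      assert (0 <= 20 * G ^ 2 * h) by pos.
      apply Rle_trans with (/ rho * (20 * G ^ 2 * h)); [|lra].
      apply Rabs_mul_le; [rewrite Rabs_right; lra|].
      assert (HZ1 : Z <= (/ 4) ^ 2).
      { unfold Z. rewrite <- Rpow_mult_distr. apply pow_incr. split; [apply Rmult_le_pos; lra | auto]. }
      assert (Hes : Rabs es <= 3) by (apply Rabs_le; lra).
      assert (HZh : Z <= G ^ 2 * h) by (unfold Z; apply Rmult_le_compat_l; nra).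
      assert (HGh2 : G * h <= G ^ 2 * h) by mono.
      apply Rle_trans with (3 * Z + (G * h + 3 * (G * h))); [|lra].
      apply Rabs_add_le; [apply Rabs_le; lra|]. apply Rabs_add_le; [apply Rabs_le; lra|].
      rewrite Rabs_Ropp. apply Rabs_mul_le; [auto | apply Rabs_le; lra].
  - replace (rho / sigma l ^ 2 * d) with t by (unfold t; rewrite Eq; reflexivity). fold et s.
    replace (1 + (rho * q l - a l) * d) with (1 + t - s) by (unfold t, s; ring).
    assert (Hden : / 2 <= 1 + t - s) by lra.
    assert (main : Rabs (et * (1 - s) * / (1 + t - s) - 1) <= 20 * Z).
    { replace (et * (1 - s) * / (1 + t - s) - 1)
        with (((et - 1 - t) * (1 - s) + - (t * s)) * / (1 + t - s)) by (field; lra).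
      apply Rle_trans with ((3 * Z * 2 + Z) * 2); [|lra].
      apply Rabs_mul_le.
      - apply Rabs_add_le; [apply Rabs_mul_le; apply Rabs_le; lra|]. rewrite Rabs_Ropp. apply Rabs_le; lra.
      - rewrite Rabs_right by pos.
        rewrite <- (Rinv_inv 2). apply Rinv_le_contravar; lra. }
    split.
    + replace (/ rho * et * rho * / (1 + t - s) * (1 - s) - 1) with (et * (1 - s) * / (1 + t - s) - 1) by (field; lra).
      lra.
    + replace (/ rho * et - / rho * et * rho * / (1 + t - s) * (1 - s) * q l * d / (1 - s) - / rho)
        with (/ rho * (et * (1 - s) * / (1 + t - s) - 1)) by (unfold t in *; field; unfold s in *; lra).
      replace ((1 + / rho) * (20 * G ^ 2) * h ^ scheme_order Scheme2)
        with (/ rho * (20 * Z) + 20 * Z) by (unfold Z; simpl; ring).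
      apply Rle_trans with (/ rho * (20 * Z)); [|lra].
      apply Rabs_mul_le; [rewrite Rabs_right; lra | auto].
Qed.

(** With weights [1] at both ends the rule would be trapezoidal. The first-order
    parts [a delta] and [- a delta] of the weights [/ (1 - a delta)] and [/ (1 + a
    delta)] have opposite signs at the two ends and cancel up to one more order. *)
Lemma interval_rule_error : exists C h0, 1 <= C /\ 0 < h0 /\
  forall n x h sch mu sigma (F F1 F2 : R -> R) B, matches mu sigma -> fine_grid n x h -> 0 < h <= h0 ->
  (forall t, inside t -> is_derive F t (F1 t)) -> (forall t, inside t -> is_derive F1 t (F2 t)) ->
  (forall t, inside t -> Rabs (F t) <= B /\ Rabs (F1 t) <= B /\ Rabs (F2 t) <= B) ->
  forall i, (i <= n)%nat ->
  Rabs (interval_rule mu sigma x sch (fun j => F (x j)) i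
    - RInt (fun t => 2 * scale t * q t * F t) (x i) (x (S i))) <= C * B * h ^ 2 * step_plus x i.
Proof.
  destruct left_weight_error as [G [h1 [HG [Hh1 HLW]]]].
  destruct (ratio_error G ltac:(lra)) as [C [h2 [HC [Hh2 HR]]]].
  destruct (scale_bounds) as [m0 [M [Hm0 [HM Hsc]]]].
  assert (HK := bnd_ge1 P).
  assert (HMK : 1 <= M * K) by nra.
  assert (HKK : K <= K * K) by nra. assert (HKKK : K * K <= K * K * K) by nra.
  assert (HK3 : 1 <= K * K * K) by lra.
  exists (4 * C * K + 100 * (K * K * (M * (K * K * K)))), (Rmin (Rmin h1 h2) (Rmin 1 (/ (2 * K)))).
  assert (HCK : 1 <= C * K) by nra.
  assert (HMK3 : 0 < M * (K * K * K)) by pos.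
  assert (HMK5 : 0 < K * K * (M * (K * K * K))) by pos.
  split; [lra|]. split; [repeat apply Rmin_pos; try lra; apply Rinv_0_lt_compat; lra|].
  intros n x h sch mu sigma F F1 F2 B Hm Hf [Hh Hh'] D1 D2 HB i Hi.
  assert (A1 : h <= h1) by below Hh'.
  assert (A2 : h <= h2) by below Hh'.
  assert (A3 : h <= 1) by below Hh'.
  assert (A4 : h <= / (2 * K)) by below Hh'.
  assert (HKh := bnd_mesh_small h Hh A4).
  destruct (HLW n x h sch mu sigma Hm Hf (conj Hh A1)) as [Hga _].
  assert (e1 := HR n x h _ Hf (conj Hh A2) Hga i ltac:(lia)).
  assert (e2 := HR n x h _ Hf (conj Hh A2) Hga (S i) ltac:(lia)).
  assert (X0 := node_bounds n x i (proj1 Hf) ltac:(lia)).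
  assert (X1 := node_bounds n x (S i) (proj1 Hf) ltac:(lia)).
  destruct (step_bounds n x h i Hf ltac:(lia)) as [d1 d2].
  assert (B1 := Ap_bounds n x h Hf HKh i ltac:(lia)).
  assert (B2 := Am_bounds n x h Hf HKh i ltac:(lia)).
  assert (Hin : forall t, x i <= t <= x (S i) -> inside t) by (intros t Ht; destruct X0, X1; split; lra).
  assert (Hd : x (S i) - x i = step_plus x i) by reflexivity.
  unfold interval_rule. simpl pred. set (d := step_plus x i) in *.
  set (y := gauge mu sigma x sch * ratio x i) in *.
  set (y' := gauge mu sigma x sch * ratio x (S i)) in *.
  assert (HB0 : 0 <= B) by (eapply Rle_trans; [apply Rabs_pos | apply (HB _ X0)]).
  set (u := fun t => scale t * q t * F t).
  set (u1 := fun t => scale t * (2 * (a t * q t * F t) + cq1 P t * F t + q t * F1 t)).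
  set (u2 := fun t => scale t * (2 * (a t * (2 * (a t * q t * F t) + cq1 P t * F t + q t * F1 t))
     + (2 * (ca1 P t * q t * F t) + 2 * (a t * cq1 P t * F t) + 2 * (a t * q t * F1 t)
     + cq2 P t * F t + 2 * (cq1 P t * F1 t) + q t * F2 t))).
  assert (Du : forall t, x i <= t <= x (S i) -> is_derive u t (u1 t)).
  { intros t Ht. assert (T := Hin t Ht). assert (T0 := scale_derive t). assert (T1 := cq_derive P t T).
    assert (T2 := D1 t T). unfold u. derive. unfold u1. ring. }
  assert (Du1 : forall t, x i <= t <= x (S i) -> is_derive u1 t (u2 t)).
  { intros t Ht. assert (T := Hin t Ht). assert (T0 := scale_derive t). assert (T1 := cq_derive P t T).
    assert (T2 := D1 t T). assert (T3 := D2 t T). assert (T4 := cq1_derive P t T). assert (T5 := ca_derive P t T).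
    unfold u1. derive. unfold u2. ring. }
  assert (R2 : Rabs 2 <= 2) by (rewrite Rabs_right; lra).
  assert (bd : forall t, x i <= t <= x (S i) -> Rabs (u t) <= M * (K * K * K) * B /\
     Rabs (u1 t) <= 4 * (M * (K * K * K)) * B /\ Rabs (u2 t) <= 20 * (M * (K * K * K)) * B).
  { intros t Ht. assert (T := Hin t Ht). destruct (HB t T) as [b0 [b1 b2]].
    assert (c0 := ca_bnd P t T). assert (c1 := ca1_bnd P t T).
    assert (k0 := cq_bnd P t T). assert (k1 := cq1_bnd P t T). assert (k2 := cq2_bnd P t T).
    assert (sb : Rabs (scale t) <= M) by (specialize (Hsc t T); rewrite Rabs_right; lra).
    assert (KB : K * B <= K * K * B) by mono.
    assert (KB' : 0 <= K * B) by pos.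
    assert (KKB : K * K * B <= K * K * K * B) by mono.
    assert (MB : forall s z, Rabs s <= z -> Rabs (scale t * s) <= M * z) by (intros; now apply Rabs_mul_le).
    assert (in1 : Rabs (2 * (a t * q t * F t) + cq1 P t * F t + q t * F1 t) <= 4 * (K * K * B)).
    { apply Rle_trans with (2 * (K * K * B) + K * B + K * B); [|lra].
      apply Rabs_add_le; [apply Rabs_add_le|]; [|now apply Rabs_mul_le|now apply Rabs_mul_le].
      apply Rabs_mul_le; [exact R2|]. apply Rabs_mul_le; [now apply Rabs_mul_le | auto]. }
    split; [|split].
    - unfold u. rewrite Rmult_assoc. eapply Rle_trans; [apply MB, Rabs_mul_le; eassumption|].
      rewrite Rmult_assoc. apply Rmult_le_compat_l; lra.
    - unfold u1. eapply Rle_trans; [apply MB, in1|].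
      replace (4 * (M * (K * K * K)) * B) with (M * (4 * (K * K * K * B))) by ring. apply Rmult_le_compat_l; lra.
    - unfold u2. eapply Rle_trans; [apply MB|].
      + apply Rabs_add_le; [apply Rabs_mul_le; [exact R2 | apply Rabs_mul_le; [exact c0 | exact in1]]|].
        repeat apply Rabs_add_le.
        * apply Rabs_mul_le; [exact R2 | apply Rabs_mul_le; [apply Rabs_mul_le; [exact c1 | exact k0] | exact b0]].
        * apply Rabs_mul_le; [exact R2 | apply Rabs_mul_le; [apply Rabs_mul_le; [exact c0 | exact k1] | exact b0]].
        * apply Rabs_mul_le; [exact R2 | apply Rabs_mul_le; [apply Rabs_mul_le; [exact c0 | exact k0] | exact b1]].
        * apply Rabs_mul_le; [exact k2 | exact b0].
        * apply Rabs_mul_le; [exact R2 | apply Rabs_mul_le; [exact k1 | exact b1]].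
        * apply Rabs_mul_le; [exact k0 | exact b2].
      + replace (20 * (M * (K * K * K)) * B) with (M * (20 * (K * K * K * B))) by ring.
        apply Rmult_le_compat_l; lra. }
  set (T := M * (K * K * K) * B) in *. assert (HT : 0 <= T) by (unfold T; apply Rmult_le_pos; lra).
  assert (I1 : Rabs (RInt (fun t => 2 * scale t * q t * F t) (x i) (x (S i)) - d * (u (x i) + u (x (S i)))) <= 80 * T * d ^ 3).
  { rewrite (RInt_congr _ (fun t => 2 * u t)) by (intros; unfold u; ring).
    replace (d * (u (x i) + u (x (S i)))) with (d / 2 * (2 * u (x i) + 2 * u (x (S i)))) by field.
    replace (80 * T * d ^ 3) with (2 * (40 * T) * d ^ 3) by ring. rewrite <- Hd.
    apply (trapezoid_RInt (fun t => 2 * u t) (fun t => 2 * u1 t) (fun t => 2 * u2 t)); [lra| | |].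
    - intros t Ht. assert (E := Du t Ht). derive. ring.
    - intros t Ht. assert (E := Du1 t Ht). derive. ring.
    - intros t Ht. destruct (bd t Ht) as [_ [_ E]].
      replace (40 * T) with (2 * (20 * (M * (K * K * K)) * B)) by (unfold T; ring). now apply Rabs_mul_le. }
  set (v := fun t => a t * u t).
  assert (I2 : Rabs (v (x i) - v (x (S i))) <= 5 * K * T * d).
  { rewrite Rabs_minus_sym, <- Hd.
    apply (lipschitz_of_derive v (fun t => ca1 P t * u t + a t * u1 t)); [lra| |].
    - intros t Ht. assert (E := Du t Ht). assert (E' := ca_derive P t (Hin t Ht)). unfold v. derive. ring.
    - intros t Ht. destruct (bd t Ht) as [b0 [b1 _]].
      apply Rle_trans with (K * T + K * (4 * (M * (K * K * K)) * B)); [|right; unfold T; ring].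
      apply Rabs_add_le; apply Rabs_mul_le; auto; [apply ca1_bnd | apply ca_bnd]; now apply Hin. }
  assert (inv2 : forall z, / 2 <= z -> Rabs (/ z) <= 2).
  { intros z Hz. rewrite Rabs_right by pos.
    rewrite <- (Rinv_inv 2). apply Rinv_le_contravar; lra. }
  set (p := 1 - a (x i) * d) in *. set (m := 1 + a (x (S i)) * d) in *.
  assert (Hxi : x i <= x i <= x (S i)) by lra. assert (Hxs : x i <= x (S i) <= x (S i)) by lra.
  destruct (bd _ Hxi) as [bu _]. destruct (bd _ Hxs) as [bu' _].
  replace (d * (y * q (x i) * F (x i) / p + y' * q (x (S i)) * F (x (S i)) / m)
      - RInt (fun t => 2 * scale t * q t * F t) (x i) (x (S i)))
    with (- (RInt (fun t => 2 * scale t * q t * F t) (x i) (x (S i)) - d * (u (x i) + u (x (S i))))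
      + d * (((y - scale (x i)) * (q (x i) * F (x i)) * / p + (y' - scale (x (S i))) * (q (x (S i)) * F (x (S i))) * / m)
        + (d * (v (x i) - v (x (S i))) + d * d * (a (x i) * v (x i) * / p + a (x (S i)) * v (x (S i)) * / m)))).
  2:{ set (I := RInt _ _ _). unfold v, u.
      replace (y * q (x i) * F (x i) / p)
        with ((y - scale (x i)) * (q (x i) * F (x i)) * / p
          + scale (x i) * q (x i) * F (x i) * (1 + d * a (x i) + d * d * (a (x i) * a (x i)) * / p))
        by (unfold p; field; unfold p in B1; lra).
      replace (y' * q (x (S i)) * F (x (S i)) / m)
        with ((y' - scale (x (S i))) * (q (x (S i)) * F (x (S i))) * / m
          + scale (x (S i)) * q (x (S i)) * F (x (S i)) * (1 - d * a (x (S i)) + d * d * (a (x (S i)) * a (x (S i))) * / m))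
        by (unfold m; field; unfold m in B2; lra).
      ring. }
  assert (qF : forall t, inside t -> Rabs (q t * F t) <= K * B).
  { intros t Ht. apply Rabs_mul_le; [now apply cq_bnd | now apply HB]. }
  assert (J1 : Rabs ((y - scale (x i)) * (q (x i) * F (x i)) * / p
      + (y' - scale (x (S i))) * (q (x (S i)) * F (x (S i))) * / m) <= 4 * (C * h ^ 2 * (K * B))).
  { apply Rle_trans with (C * h ^ 2 * (K * B) * 2 + C * h ^ 2 * (K * B) * 2); [|lra].
    apply Rabs_add_le; (apply Rabs_mul_le; [apply Rabs_mul_le; auto | apply inv2; lra]). }
  assert (J2 : Rabs (a (x i) * v (x i) * / p + a (x (S i)) * v (x (S i)) * / m) <= 4 * (K * K * T)).
  { apply Rle_trans with (K * (K * T) * 2 + K * (K * T) * 2); [|lra].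
    apply Rabs_add_le; (apply Rabs_mul_le; [apply Rabs_mul_le; [now apply ca_bnd|] | apply inv2; lra]);
      (apply Rabs_mul_le; [now apply ca_bnd | auto]). }
  assert (HKT : K * T <= K * K * T) by mono.
  assert (HTKT : T <= K * K * T) by (rewrite <- (Rmult_1_l T) at 1; apply Rmult_le_compat_r; lra).
  assert (Hd2 : d * d <= h ^ 2) by (replace (d * d) with (d ^ 2) by ring; apply pow_incr; lra).
  assert (Hh2' : 0 < h ^ 2) by pos.
  apply Rle_trans with (80 * T * d ^ 3 + d * (4 * (C * h ^ 2 * (K * B)) + (d * (5 * K * T * d) + d * d * (4 * (K * K * T))))).
  - apply Rabs_add_le; [rewrite Rabs_Ropp; exact I1|].
    apply Rabs_mul_le; [rewrite Rabs_right; lra|]. apply Rabs_add_le; [exact J1|].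
    apply Rabs_add_le; apply Rabs_mul_le; auto; rewrite Rabs_right; try lra. nra.
  - replace (80 * T * d ^ 3 + d * (4 * (C * h ^ 2 * (K * B)) + (d * (5 * K * T * d) + d * d * (4 * (K * K * T)))))
      with (d * (4 * C * K * B * h ^ 2 + d * d * (80 * T + 5 * (K * T) + 4 * (K * K * T)))) by ring.
    apply Rle_trans with (d * ((4 * C * K + 100 * (K * K * (M * (K * K * K)))) * B * h ^ 2)); [|right; ring].
    apply Rmult_le_compat_l; [lra|].
    apply Rle_trans with (4 * C * K * B * h ^ 2 + h ^ 2 * (100 * (K * K * T))); [|right; unfold T; ring].
    apply Rplus_le_compat_l, Rmult_le_compat; try lra.
    + apply Rle_0_sqr.
    + assert (0 <= K * T) by pos. lra.
Qed.

Lemma order_pow_le h sch : 0 < h -> h <= 1 -> h ^ 2 <= h ^ scheme_order sch /\ h ^ scheme_order sch <= h.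
Proof. intros H0 H1. destruct sch; simpl; split; nra. Qed.

(** Second order holds in the interior for both schemes; the mass at the left end
    limits Scheme 1 to first order. *)
Lemma quadrature : exists C h0, 1 <= C /\ 0 < h0 /\
  forall n x h sch mu sigma (F F1 F2 : R -> R) B, matches mu sigma -> fine_grid n x h -> 0 < h <= h0 ->
  (forall t, inside t -> is_derive F t (F1 t)) -> (forall t, inside t -> is_derive F1 t (F2 t)) ->
  (forall t, inside t -> Rabs (F t) <= B /\ Rabs (F1 t) <= B /\ Rabs (F2 t) <= B) -> F r = 0 ->
  Rabs (sum_f_R0 (fun i => F (x i) * discrete_speed x sch rho mu sigma i) n
    - (RInt (fun t => 2 * scale t * q t * F t) l r + F l / rho)) <= C * B * h ^ scheme_order sch.
Proof.
  destruct (left_weight_error) as [G [h1 [HG [Hh1 HLW]]]].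
  destruct (interval_rule_error) as [C [h2 [HC [Hh2 HI]]]].
  assert (HK := bnd_ge1 P). assert (Hlr := lft_rgt P). assert (Hrho := stick_pos P).
  exists (G + C * (r - l)), (Rmin (Rmin h1 h2) (Rmin 1 (/ (2 * K)))).
  assert (HClr : 0 < C * (r - l)) by pos.
  split; [lra|]. split; [repeat apply Rmin_pos; try lra; apply Rinv_0_lt_compat; lra|].
  intros n x h sch mu sigma F F1 F2 B Hm Hf [Hh Hh'] D1 D2 HB Hr.
  assert (A1 : h <= h1) by below Hh'.
  assert (A2 : h <= h2) by below Hh'.
  assert (A3 : h <= 1) by below Hh'.
  assert (A4 : h <= / (2 * K)) by below Hh'.
  assert (HKh := bnd_mesh_small h Hh A4).
  destruct (order_pow_le h sch Hh A3) as [O1 O2].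
  assert (HB0 : 0 <= B) by (eapply Rle_trans; [apply Rabs_pos | apply (HB l (inside_lft))]).
  assert (Hx0 : x 0%nat = l) by apply Hf. assert (Hxn : x (S n) = r) by apply Hf.
  assert (Hms : forall t, inside t -> 0 < sigma t ^ 2) by (intros; now apply Hm).
  assert (Hma : forall t, inside t -> a t = mu t / sigma t ^ 2) by (intros; now apply Hm).
  assert (Hmq : forall t, inside t -> q t = / sigma t ^ 2) by (intros; now apply Hm).
  rewrite (sum_by_intervals mu sigma Hms Hma Hmq n x h sch Hf HKh (fun j => F (x j))) by (cbv beta; rewrite Hxn; exact Hr).
  destruct (HLW n x h sch mu sigma Hm Hf (conj Hh A1)) as [_ HL].
  assert (Hcont : forall t, inside t -> continuous (fun s => 2 * scale s * q s * F s) t).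
  { intros t Ht. assert (c1 := scale_cont). assert (c2 := cq_cont P).
    assert (c3 := continuous_of_derive _ _ _ (D1 t Ht)). repeat cont_step. }
  assert (Hex : forall u v, inside u -> inside v -> u <= v -> ex_RInt (fun t => 2 * scale t * q t * F t) u v).
  { intros u v Hu Hv Huv. apply ex_RInt_segment; auto. intros t Ht. apply Hcont. destruct Hu, Hv. split; lra. }
  assert (main : forall m, (m <= n)%nat ->
    Rabs (sum_f_R0 (interval_rule mu sigma x sch (fun j => F (x j))) m
      - RInt (fun t => 2 * scale t * q t * F t) l (x (S m))) <= C * B * h ^ 2 * (x (S m) - l)).
  { assert (one := HI n x h sch mu sigma F F1 F2 B Hm Hf (conj Hh A2) D1 D2 HB).
    induction m as [|m IH]; intros Hmn.
    - simpl sum_f_R0. specialize (one 0%nat Hmn). unfold step_plus in one. rewrite Hx0 in one. exact one.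
    - rewrite tech5. specialize (IH ltac:(lia)). specialize (one (S m) Hmn).
      assert (X1 := node_bounds n x (S m) (proj1 Hf) ltac:(lia)).
      assert (X2 := node_bounds n x (S (S m)) (proj1 Hf) ltac:(lia)).
      destruct (step_bounds n x h (S m) Hf Hmn) as [d1 _]. unfold step_plus in *.
      rewrite <- (RInt_Chasles (fun t => 2 * scale t * q t * F t) l (x (S m)) (x (S (S m)))).
      + unfold plus; simpl.
        set (I1 := RInt _ l _) in *. set (I2 := RInt _ (x (S m)) _) in *. set (S1 := sum_f_R0 _ m) in *.
        replace (S1 + interval_rule mu sigma x sch (fun j => F (x j)) (S m) - (I1 + I2))
          with (S1 - I1 + (interval_rule mu sigma x sch (fun j => F (x j)) (S m) - I2)) by ring.
        eapply Rle_trans; [apply Rabs_add_le; [exact IH | exact one]|]. right; ring.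
      + apply Hex; [apply inside_lft | auto | destruct X1; lra].
      + apply Hex; auto; lra. }
  specialize (main n (le_n n)). rewrite Hxn in main.
  rewrite Hx0 in *.
  set (M0 := discrete_speed x sch rho mu sigma 0 - _) in *.
  set (S1 := sum_f_R0 _ n) in *. set (I := RInt _ l r) in *.
  replace (F l * M0 + S1 - (I + F l / rho)) with (F l * (M0 - / rho) + (S1 - I)) by (field; lra).
  apply Rle_trans with (B * (G * h ^ scheme_order sch) + C * B * h ^ 2 * (r - l)).
  - apply Rabs_add_le; [|exact main]. apply Rabs_mul_le; [apply (HB l (inside_lft)) | exact HL].
  - assert (C * B * h ^ 2 * (r - l) <= C * B * h ^ scheme_order sch * (r - l)).
    { apply Rmult_le_compat_r; [lra|]. apply Rmult_le_compat_l; [apply Rmult_le_pos; lra | auto]. }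
    lra.
Qed.

(** The mass of a node is comparable with the lengths of its two cells. *)
Lemma mass_bound : exists C h0, 1 <= C /\ 0 < h0 /\
  forall n x h sch mu sigma u B, matches mu sigma -> fine_grid n x h -> 0 < h <= h0 ->
  (forall i, (i <= n)%nat -> Rabs (u i) <= B) ->
  Rabs (sum_f_R0 (fun i => u i * discrete_speed x sch rho mu sigma i) n) <= C * B.
Proof.
  destruct (left_weight_error) as [G [h1 [HG [Hh1 HLW]]]].
  destruct (ratio_error G ltac:(lra)) as [C [h2 [HC [Hh2 HR]]]].
  destruct (scale_bounds) as [m0 [M [Hm0 [HM Hsc]]]].
  assert (HK := bnd_ge1 P). assert (Hlr := lft_rgt P). assert (Hrho := stick_pos P).
  set (C1 := (M + C) * K * 2). set (C0 := / rho + G + (1 + G) * K * 2).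
  assert (HC1 : 0 < C1) by (unfold C1; apply Rmult_lt_0_compat; [apply Rmult_lt_0_compat|]; lra).
  assert (Hir : 0 < / rho) by pos.
  assert (HGK : 0 < (1 + G) * K) by pos.
  assert (HC0 : 1 <= C0) by (unfold C0; lra).
  assert (HClr : 0 < C1 * (r - l)) by pos.
  exists (C0 + 2 * (C1 * (r - l))), (Rmin (Rmin h1 h2) (Rmin 1 (/ (2 * K)))).
  split; [lra|]. split; [repeat apply Rmin_pos; try lra; apply Rinv_0_lt_compat; lra|].
  intros n x h sch mu sigma u B Hm Hf [Hh Hh'] Hu.
  assert (A1 : h <= h1) by below Hh'.
  assert (A2 : h <= h2) by below Hh'.
  assert (A3 : h <= 1) by below Hh'.
  assert (A4 : h <= / (2 * K)) by below Hh'.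
  assert (HKh := bnd_mesh_small h Hh A4).
  destruct (order_pow_le h sch Hh A3) as [O1 O2].
  assert (Hh2' : h ^ 2 <= 1) by lra. assert (Hh0' : 0 < h ^ 2) by pos.
  assert (HB0 : 0 <= B) by (eapply Rle_trans; [apply Rabs_pos | apply (Hu 0%nat); lia]).
  assert (Hx0 : x 0%nat = l) by apply Hf.
  assert (Hms : forall t, inside t -> 0 < sigma t ^ 2) by (intros; now apply Hm).
  assert (Hma : forall t, inside t -> a t = mu t / sigma t ^ 2) by (intros; now apply Hm).
  assert (Hmq : forall t, inside t -> q t = / sigma t ^ 2) by (intros; now apply Hm).
  destruct (HLW n x h sch mu sigma Hm Hf (conj Hh A1)) as [Hga HL].
  assert (inv2 : forall z, / 2 <= z -> Rabs (/ z) <= 2).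
  { intros z Hz. rewrite Rabs_right by pos.
    rewrite <- (Rinv_inv 2). apply Rinv_le_contravar; lra. }
  assert (W0 : Rabs (discrete_speed x sch rho mu sigma 0) <= C0).
  { set (g := gauge mu sigma x sch) in *.
    assert (B1 := Ap_bounds n x h Hf HKh 0 ltac:(lia)).
    destruct (step_bounds n x h 0 Hf ltac:(lia)) as [d1 d2].
    set (T := g * q (x 0%nat) * step_plus x 0 / (1 - a (x 0%nat) * step_plus x 0)) in *.
    replace (discrete_speed x sch rho mu sigma 0) with (/ rho + (discrete_speed x sch rho mu sigma 0 - T - / rho) + T) by ring.
    unfold C0. apply Rabs_add_le; [apply Rabs_add_le|].
    - rewrite Rabs_right; lra.
    - eapply Rle_trans; [exact HL|]. rewrite <- (Rmult_1_r G) at 2. apply Rmult_le_compat_l; lra.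
    - unfold T, Rdiv. replace ((1 + G) * K * 2) with ((1 + G) * K * 1 * 2) by ring.
      apply Rabs_mul_le; [apply Rabs_mul_le; [apply Rabs_mul_le|]|].
      + replace g with (1 + (g - 1)) by ring. apply Rabs_add_le; [rewrite Rabs_R1; lra|].
        eapply Rle_trans; [exact Hga|]. rewrite <- (Rmult_1_r G) at 2. apply Rmult_le_compat_l; lra.
      + apply cq_bnd. rewrite Hx0. apply inside_lft.
      + rewrite Rabs_right; lra.
      + apply inv2; lra. }
  assert (main : forall m, (m <= n)%nat ->
    Rabs (sum_f_R0 (fun i => u i * discrete_speed x sch rho mu sigma i) m)
      <= B * (C0 + C1 * ((x (S m) - l) + (x m - l)))).
  { induction m as [|m IH]; intros Hmn.
    - simpl sum_f_R0. rewrite Hx0. destruct (step_bounds n x h 0 Hf ltac:(lia)) as [d1 _].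
      unfold step_plus in d1. rewrite Hx0 in d1. apply Rabs_mul_le; [apply Hu; lia|].
      eapply Rle_trans; [exact W0|]. assert (0 <= C1 * (x 1%nat - l)) by pos. lra.
    - rewrite tech5. specialize (IH ltac:(lia)).
      rewrite (speed_split mu sigma Hms Hma Hmq n x h sch Hf HKh m) by lia.
      assert (X1 := node_bounds n x (S m) (proj1 Hf) ltac:(lia)).
      destruct (step_bounds n x h (S m) Hf Hmn) as [d1 _]. destruct (step_bounds n x h m Hf ltac:(lia)) as [d2 _].
      assert (B1 := Ap_bounds n x h Hf HKh (S m) ltac:(lia)).
      assert (B2 := Am_bounds n x h Hf HKh m ltac:(lia)).
      simpl pred.
      assert (E := HR n x h _ Hf (conj Hh A2) Hga (S m) ltac:(lia)).
      set (y := gauge mu sigma x sch * ratio x (S m)) in *.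
      assert (Hy : Rabs y <= M + C).
      { replace y with (scale (x (S m)) + (y - scale (x (S m)))) by ring. apply Rabs_add_le.
        - specialize (Hsc _ X1). rewrite Rabs_right; lra.
        - eapply Rle_trans; [exact E|]. rewrite <- (Rmult_1_r C) at 2. apply Rmult_le_compat_l; lra. }
      apply Rle_trans with (B * (C0 + C1 * ((x (S m) - l) + (x m - l)))
        + B * ((M + C) * K * (step_plus x (S m) * 2 + step_plus x m * 2))).
      + apply Rabs_add_le; [exact IH|]. apply Rabs_mul_le; [apply Hu; lia|].
        apply Rabs_mul_le; [apply Rabs_mul_le; [exact Hy | now apply cq_bnd]|].
        unfold Rdiv. apply Rabs_add_le; (apply Rabs_mul_le; [rewrite Rabs_right; lra | apply inv2; lra]).
      + right. unfold C1, step_plus. ring. }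
  specialize (main n (le_n n)).
  assert (X1 := node_bounds n x (S n) (proj1 Hf) ltac:(lia)). assert (X2 := node_bounds n x n (proj1 Hf) ltac:(lia)).
  eapply Rle_trans; [exact main|]. rewrite (Rmult_comm _ B). apply Rmult_le_compat_l; auto.
  apply Rplus_le_compat_l.
  apply Rle_trans with (C1 * (2 * (r - l))); [|right; ring]. apply Rmult_le_compat_l; [lra|].
  destruct X1, X2. lra.
Qed.

(** * The error of the eigenvalues *)

Definition spectrum (lam : nat -> R) : Prop :=
  (forall k, (1 <= k)%nat -> 0 <= lam k /\ shoot (lam k) = 0) /\
  (forall j k, (1 <= j < k)%nat -> lam j < lam k) /\
  (forall mu, -1 <= mu -> shoot mu = 0 -> exists k, (1 <= k)%nat /\ mu = lam k).

Lemma spectrum_le lam j k : spectrum lam -> (1 <= j <= k)%nat -> lam j <= lam k.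
Proof.
  intros [_ [H _]] Hjk. destruct (Nat.eq_dec j k) as [->|]; [lra|].
  left. apply H. lia.
Qed.

(** There is an eigenvalue between any two consecutive points of [shoot_zeros], so
    the [S i]-th eigenvalue lies below [tau (S i)]. *)
Lemma spectrum_growth lam : spectrum lam -> exists C, 1 <= C /\
  forall k, (1 <= k)%nat -> lam k <= C * INR k ^ 2.
Proof.
  intros Hs. destruct (shoot_zeros) as [C [tau [HC [H0 H]]]].
  assert (main : forall i, exists m, (S i <= m)%nat /\ tau i < lam m < tau (S i)).
  { assert (pos : forall i, 0 <= tau i).
    { induction i; auto. destruct (H i) as [h1 _]. lra. }
    assert (ex : forall i, exists m, (1 <= m)%nat /\ tau i < lam m < tau (S i)).
    { intros i. destruct (H i) as [_ [_ [mu [Hmu E]]]]. destruct Hs as [_ [_ Hs]].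
      destruct (Hs mu ltac:(specialize (pos i); lra) E) as [m [Hm ->]]. now exists m. }
    induction i as [|i [m [Hm1 Hm2]]]; [apply ex|].
    destruct (ex (S i)) as [m' [Hm1' Hm2']]. exists m'. split; auto.
    destruct (le_lt_dec m' m); [|lia].
    assert (lam m' <= lam m) by (apply spectrum_le; auto; lia). lra. }
  exists (4 * C + 1). split; [lra|]. intros [|i] Hk; [lia|].
  destruct (main i) as [m [Hm1 Hm2]]. assert (E : lam (S i) <= lam m) by (apply spectrum_le; auto; lia).
  destruct (H (S i)) as [_ [Hb _]]. rewrite (S_INR (S i)) in Hb. set (z := INR (S i)) in *.
  assert (Hz : 1 <= z) by (unfold z; rewrite S_INR; generalize (pos_INR i); lra).
  assert ((z + 1) ^ 2 <= 4 * z ^ 2) by nra. nra.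
Qed.

(** From [(h k^2)^5 = h^3 (k^5 h)^2]: in the admissible range of indices the
    wavelength is long compared with the mesh. *)
Lemma mesh_small eta h k : 0 < eta <= 1 -> 0 < h <= eta ^ 2 -> 1 <= k -> k ^ 5 * h <= 1 ->
  h * k ^ 2 <= eta.
Proof.
  intros He Hh Hk H. apply Rnot_lt_le. intros Hn.
  assert (H1 : eta ^ 5 < (h * k ^ 2) ^ 5).
  { assert (E : forall m, eta ^ S m < (h * k ^ 2) ^ S m).
    { induction m as [|m IH]; [simpl; lra|]. rewrite <- (tech_pow_Rmult eta), <- (tech_pow_Rmult (h * k ^ 2)).
      assert (0 < eta ^ S m) by pos. apply Rmult_le_0_lt_compat; lra. }
    apply E. }
  assert (H2 : (h * k ^ 2) ^ 5 = h ^ 3 * (k ^ 5 * h) ^ 2) by ring.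
  assert (Hk5 : 0 <= k ^ 5 * h) by (apply Rmult_le_pos; [apply pow_le|]; lra).
  assert (H3 : (k ^ 5 * h) ^ 2 <= 1 ^ 2) by (apply pow_incr; lra).
  assert (H4 : h ^ 3 <= (eta ^ 2) ^ 3) by (apply pow_incr; lra).
  assert (H5 : (eta ^ 2) ^ 3 <= eta ^ 5).
  { replace ((eta ^ 2) ^ 3) with (eta ^ 5 * eta) by ring. assert (0 < eta ^ 5) by pos. nra. }
  assert (0 <= h ^ 3) by pos. rewrite H2 in H1.
  assert (h ^ 3 * (k ^ 5 * h) ^ 2 <= h ^ 3 * 1) by mono. lra.
Qed.

(** Since [W lam] is of size [1 / om lam], its square has a bounded second
    derivative and the quadrature error carries no power of the frequency; an
    error [D] of the solutions enters, to first order, multiplied by [1 / om lam]. *)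
Lemma gram_error : exists C h0, 1 <= C /\ 0 < h0 /\
  forall n x h sch mu sigma lam u v D, matches mu sigma -> fine_grid n x h -> 0 < h <= h0 ->
  -1 <= lam -> 0 <= D ->
  (forall i, (i <= n)%nat -> Rabs (u i - W lam (x i)) <= D) ->
  (forall i, (i <= n)%nat -> Rabs (v i - W lam (x i)) <= D) ->
  Rabs (sum_f_R0 (fun i => u i * v i * discrete_speed x sch rho mu sigma i) n
    - inner (W lam) (W lam)) <= C * (h ^ scheme_order sch + D / om lam + D ^ 2).
Proof.
  destruct (quadrature) as [C1 [h1 [HC1 [Hh1 HQ]]]]. destruct (mass_bound) as [C2 [h2 [HC2 [Hh2 HM]]]].
  destruct (W_derivatives_bound) as [M [HMM HW]].
  set (B := 4 * M ^ 2). assert (HM2 : 1 <= M ^ 2) by nra.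
  exists (C1 * B + C2 * (2 * M + 1)), (Rmin h1 h2).
  assert (HCB : 1 <= C1 * B) by (unfold B; nra).
  assert (HCM : 1 <= C2 * (2 * M + 1)) by nra.
  split; [lra|]. split; [apply Rmin_pos; lra|].
  intros n x h sch mu sigma lam u v D Hm Hf [Hh Hh'] Hl HD Hu Hv.
  assert (A1 : h <= h1) by below Hh'.
  assert (A2 : h <= h2) by below Hh'.
  assert (Hw := om_ge1 lam Hl). set (w := om lam) in *.
  assert (Hiw : 0 < / w <= 1).
  { split; [apply Rinv_0_lt_compat; lra|]. rewrite <- Rinv_1. apply Rinv_le_contravar; lra. }
  assert (Hgamma : 0 < h ^ scheme_order sch) by pos.
  assert (E1 := HQ n x h sch mu sigma (fun t => W lam t * W lam t) (fun t => 2 * (W lam t * V lam t))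
    (fun t => 2 * (V lam t * V lam t + W lam t * W2 lam t)) B Hm Hf (conj Hh A1)).
  assert (E1' : Rabs (sum_f_R0 (fun i => W lam (x i) * W lam (x i) * discrete_speed x sch rho mu sigma i) n
     - inner (W lam) (W lam)) <= C1 * B * h ^ scheme_order sch).
  { unfold inner. apply E1.
    - intros t _. assert (D1 := W_derive lam t). derive. ring.
    - intros t _. assert (D1 := W_derive lam t). assert (D2 := V_derive2 lam t). derive. ring.
    - intros t Ht. destruct (HW lam t Hl Ht) as [b1 [b0 [b2 _]]]. fold w in b0, b2.
      assert (b0' : Rabs (W lam t) <= M) by (unfold Rdiv in b0; nra).
      assert (R2 : Rabs 2 <= 2) by (rewrite Rabs_right; lra).
      split; [|split]; unfold B.
      + apply Rle_trans with (M * M); [now apply Rabs_mul_le | nra].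
      + apply Rle_trans with (2 * (M * M)); [|nra]. apply Rabs_mul_le; auto. now apply Rabs_mul_le.
      + apply Rle_trans with (2 * (M * M + M / w * (M * w))); [|right; field; lra].
        apply Rabs_mul_le; auto. apply Rabs_add_le; now apply Rabs_mul_le.
    - cbv beta. rewrite W_rgt. apply Rmult_0_l. }
  assert (E2 : Rabs (sum_f_R0 (fun i => (u i * v i - W lam (x i) * W lam (x i)) * discrete_speed x sch rho mu sigma i) n)
     <= C2 * (2 * (M / w) * D + D ^ 2)).
  { apply (HM n x h sch mu sigma); auto. intros i Hi.
    assert (Hx := node_bounds n x i (proj1 Hf) ltac:(lia)).
    destruct (HW lam (x i) Hl Hx) as [_ [b0 _]]. fold w in b0.
    specialize (Hu i Hi). specialize (Hv i Hi).
    replace (u i * v i - W lam (x i) * W lam (x i))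
      with (W lam (x i) * (v i - W lam (x i)) + (u i - W lam (x i)) * W lam (x i)
        + (u i - W lam (x i)) * (v i - W lam (x i))) by ring.
    apply Rle_trans with (M / w * D + D * (M / w) + D * D); [|right; ring].
    repeat apply Rabs_add_le; now apply Rabs_mul_le. }
  assert (Esum : sum_f_R0 (fun i => u i * v i * discrete_speed x sch rho mu sigma i) n
    = sum_f_R0 (fun i => W lam (x i) * W lam (x i) * discrete_speed x sch rho mu sigma i) n
    + sum_f_R0 (fun i => (u i * v i - W lam (x i) * W lam (x i)) * discrete_speed x sch rho mu sigma i) n).
  { rewrite <- sum_plus. apply sum_eq. intros; ring. }
  rewrite Esum.
  set (S1 := sum_f_R0 (fun i => W lam (x i) * W lam (x i) * _) n) in *.
  set (S2 := sum_f_R0 (fun i => (u i * v i - _) * _) n) in *.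
  replace (S1 + S2 - inner (W lam) (W lam)) with (S1 - inner (W lam) (W lam) + S2) by ring.
  eapply Rle_trans; [apply Rabs_add_le; [exact E1' | exact E2]|].
  assert (Dw : 0 <= D / w) by pos. assert (D2 : 0 <= D ^ 2) by pos.
  replace (2 * (M / w) * D + D ^ 2) with (2 * M * (D / w) + D ^ 2) by (field; lra).
  assert (C2 * (2 * M * (D / w) + D ^ 2) <= C2 * (2 * M + 1) * (D / w + D ^ 2)).
  { rewrite (Rmult_assoc C2). apply Rmult_le_compat_l; [lra|]. nra. }
  set (Y := D / w + D ^ 2) in *. assert (0 <= Y) by (unfold Y; lra).
  replace (h ^ scheme_order sch + D / w + D ^ 2) with (h ^ scheme_order sch + Y) by (unfold Y; ring).
  nra.
Qed.

(** The error of the scheme at [lam'], added to the dependence of the exact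
    solution on the spectral parameter. *)
Lemma gv_close Th : 0 <= Th -> exists C h0, 1 <= C /\ 0 < h0 /\
  forall n x h lam lam' t, fine_grid n x h -> 0 < h <= h0 -> -1 <= lam -> -1 <= lam' ->
  Rabs (lam' - lam) <= t -> t <= 1 -> om lam' ^ 2 * h <= Th ->
  forall i, (i <= S n)%nat ->
  om lam * Rabs (gv n x lam' i - W lam (x i)) <= C * (h ^ 2 * om lam ^ 3 + t).
Proof.
  intros HTh. destruct (scheme_error Th HTh) as [C1 [h0 [HC1 [Hh0 HS]]]].
  destruct (W_lipschitz) as [C2 [HC2 HL]].
  exists (8 * C1 + 2 * C2), h0. split; [lra|]. split; [auto|].
  intros n x h lam lam' t Hf Hh Hl Hl' Ht Ht1 HT i Hi.
  destruct (HS n x h lam' Hf Hh Hl' HT i Hi) as [_ E1].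
  assert (Hx := node_bounds n x i (proj1 Hf) Hi).
  destruct (HL lam lam' (x i) Hl Hl' Hx) as [_ E2].
  assert (Ht' := Ht). apply Rabs_le_between in Ht'.
  assert (O1 := om_close lam lam' Hl Hl' ltac:(lra)). assert (O2 := om_close lam' lam Hl' Hl ltac:(lra)).
  assert (Hw := om_ge1 lam Hl). assert (Hw' := om_ge1 lam' Hl').
  set (w := om lam) in *. set (w' := om lam') in *.
  assert (Ht0 : 0 <= t) by (generalize (Rabs_pos (lam' - lam)); lra).
  assert (Hh2 : 0 <= h ^ 2) by pos.
  assert (F1 : Rabs (gv n x lam' i - W lam' (x i)) <= C1 * h ^ 2 * w' ^ 2).
  { apply Rmult_le_reg_l with w'; [lra|]. replace (w' * (C1 * h ^ 2 * w' ^ 2)) with (C1 * h ^ 2 * w' ^ 3) by ring. exact E1. }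
  assert (F1' : C1 * h ^ 2 * w' ^ 2 <= C1 * h ^ 2 * (4 * w ^ 2)).
  { apply Rmult_le_compat_l; [apply Rmult_le_pos; lra|].
    replace (4 * w ^ 2) with ((2 * w) ^ 2) by ring. apply pow_incr; lra. }
  assert (F2 : w * Rabs (W lam' (x i) - W lam (x i)) <= 2 * C2 * t).
  { apply Rle_trans with (2 * (w' * Rabs (W lam' (x i) - W lam (x i)))).
    - generalize (Rabs_pos (W lam' (x i) - W lam (x i))). nra.
    - assert (C2 * Rabs (lam' - lam) / w <= C2 * t); [|lra].
      apply Rmult_le_reg_r with w; [lra|]. replace (C2 * Rabs (lam' - lam) / w * w) with (C2 * Rabs (lam' - lam)) by (field; lra).
      rewrite Rmult_assoc. apply Rmult_le_compat_l; [lra|]. nra. }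
  replace (gv n x lam' i - W lam (x i)) with ((gv n x lam' i - W lam' (x i)) + (W lam' (x i) - W lam (x i))) by ring.
  apply Rle_trans with (w * (Rabs (gv n x lam' i - W lam' (x i)) + Rabs (W lam' (x i) - W lam (x i)))).
  - apply Rmult_le_compat_l; [lra | apply Rabs_triang].
  - assert (w * Rabs (gv n x lam' i - W lam' (x i)) <= w * (C1 * h ^ 2 * (4 * w ^ 2))) by mono.
    replace (w * (C1 * h ^ 2 * (4 * w ^ 2))) with (4 * C1 * (h ^ 2 * w ^ 3)) in H by ring.
    assert (0 <= h ^ 2 * w ^ 3) by (apply Rmult_le_pos; [auto | apply pow_le; lra]). nra.
Qed.

(** The degree of [shoot_n] is at most [n + 1], so the [n + 1] discrete
    eigenvalues exhaust its roots. *)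
Lemma root_in_list n x sch (lamn : nat -> R) z s :
  (forall k, (1 <= k <= S n)%nat -> shoot_n n x sch (lamn k) = 0) ->
  (forall j k, (1 <= j)%nat -> (j < k)%nat -> (k <= S n)%nat -> lamn j < lamn k) ->
  shoot_n n x sch z = 0 -> shoot_n n x sch s <> 0 ->
  exists i, (1 <= i <= S n)%nat /\ z = lamn i.
Proof.
  intros Hr Hi Hz Hs.
  destruct (Classical_Prop.classic (exists i, (1 <= i <= S n)%nat /\ z = lamn i)) as [|Hno]; auto.
  exfalso. apply Hs.
  set (f := fun i => if le_lt_dec (S n) i then z else lamn (S i)).
  apply (Plt_roots (S (S n)) (shoot_n n x sch) f (shoot_n_Plt n x sch)).
  - intros i Hlt. unfold f. destruct (le_lt_dec (S n) i); [exact Hz | apply Hr; lia].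
  - intros i j Hij. unfold f. destruct (le_lt_dec (S n) i), (le_lt_dec (S n) j); try lia.
    + intros E. apply Hno. exists (S i). split; [lia | auto].
    + apply Rlt_not_eq. apply Hi; lia.
Qed.

Definition discrete_data (n : nat) (x : nat -> R) (sch : scheme) (mu sigma : R -> R)
    (lamn : nat -> R) (phin : nat -> nat -> R) : Prop :=
  (forall k, (1 <= k <= S n)%nat -> exists s, s <> 0 /\
     (forall i, (i <= S n)%nat -> phin k i = s * gv n x (lamn k) i) /\
     shoot_n n x sch (lamn k) = 0) /\
  (forall j k, (1 <= j)%nat -> (j < k)%nat -> (k <= S n)%nat -> lamn j < lamn k) /\
  (forall j k, (1 <= j <= S n)%nat -> (1 <= k <= S n)%nat ->
     sum_f_R0 (fun i => phin j i * phin k i * discrete_speed x sch rho mu sigma i) n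
     = if Nat.eq_dec j k then 1 else 0).

(** The order of magnitude of [shoot_n - shoot] at frequencies of order [k]; by
    [shoot_sign_change] also that of the error of the eigenvalues. *)
Definition defect (h : R) (sch : scheme) (k : nat) : R :=
  h ^ 2 * INR k ^ 4 + h ^ scheme_order sch * INR k.

Lemma om_growth Cg lam mu k : 1 <= Cg -> (1 <= k)%nat -> lam <= Cg * INR k ^ 2 ->
  -1 <= mu -> mu <= lam + 1 ->
  om mu ^ 2 <= (Cg + 3) * INR k ^ 2 /\ om mu <= (Cg + 3) * INR k.
Proof.
  intros HC Hk Hl Hm Hml. apply le_INR in Hk. simpl in Hk. rewrite om_sqr by auto.
  assert (1 <= INR k ^ 2) by nra. assert (H1 : mu + 2 <= (Cg + 3) * INR k ^ 2) by lra.
  split; auto. apply Rsqr_incr_0_var; [|nra]. unfold Rsqr.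
  replace (om mu * om mu) with (om mu ^ 2) by ring. rewrite om_sqr by auto.
  assert ((Cg + 3) * INR k ^ 2 <= (Cg + 3) * (Cg + 3) * INR k ^ 2) by (apply Rmult_le_compat_r; nra). lra.
Qed.

Lemma shooting_close Cg : 1 <= Cg -> exists C h0, 1 <= C /\ 0 < h0 /\
  forall n x h sch k lam mu, fine_grid n x h -> 0 < h <= h0 -> (1 <= k)%nat -> INR k ^ 5 * h <= 1 ->
  lam <= Cg * INR k ^ 2 -> -1 <= mu -> mu <= lam + 1 ->
  Rabs (shoot_n n x sch mu - shoot mu) <= C * defect h sch k.
Proof.
  intros HCg. destruct (shoot_n_error (Cg + 3) ltac:(lra)) as [C [h0 [HC [Hh0 H]]]].
  exists (C * (Cg + 3) ^ 2), h0. assert (1 <= (Cg + 3) ^ 2) by nra. split; [nra|]. split; [auto|].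
  intros n x h sch k lam mu Hf Hh Hk Hkh Hl Hm Hml.
  destruct (om_growth Cg lam mu k HCg Hk Hl Hm Hml) as [O1 O2].
  assert (Ho := om_ge1 mu Hm). apply le_INR in Hk. simpl in Hk.
  assert (Hk2 : h * INR k ^ 2 <= 1).
  { assert (INR k ^ 2 <= INR k ^ 5) by (apply Rle_pow; [auto | lia]). nra. }
  eapply Rle_trans; [apply (H n x h mu sch Hf Hh Hm)|].
  - apply Rle_trans with ((Cg + 3) * INR k ^ 2 * h); [apply Rmult_le_compat_r; lra|]. nra.
  - rewrite Rmult_assoc. apply Rmult_le_compat_l; [lra|]. unfold defect. rewrite Rmult_plus_distr_l.
    apply Rplus_le_compat.
    + replace (om mu ^ 4) with ((om mu ^ 2) ^ 2) by ring.
      replace ((Cg + 3) ^ 2 * (h ^ 2 * INR k ^ 4)) with (h ^ 2 * ((Cg + 3) * INR k ^ 2) ^ 2) by ring.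
      apply Rmult_le_compat_l; [apply pow2_ge_0|]. apply pow_incr. split; [apply pow2_ge_0 | auto].
    + assert (Hg : 0 < h ^ scheme_order sch) by pos.
      replace ((Cg + 3) ^ 2 * (h ^ scheme_order sch * INR k)) with (h ^ scheme_order sch * ((Cg + 3) ^ 2 * INR k)) by ring.
      apply Rmult_le_compat_l; [lra|]. eapply Rle_trans; [exact O2|]. apply Rmult_le_compat_r; [lra|]. nra.
Qed.

Lemma defect_bounds h sch k eta : 0 < eta <= 1 -> 0 < h <= eta ^ 2 -> (1 <= k)%nat ->
  INR k ^ 5 * h <= 1 -> 0 < defect h sch k <= 2 * eta /\ h * INR k ^ 2 <= eta /\
  h ^ scheme_order sch * INR k ^ 2 <= eta.
Proof.
  intros He Hh Hk Hkh. apply le_INR in Hk. simpl in Hk.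
  assert (E := mesh_small eta h (INR k) He Hh Hk Hkh).
  assert (Hh1 : h <= 1) by nra. destruct (order_pow_le h sch ltac:(lra) Hh1) as [O1 O2].
  assert (Hg : 0 < h ^ scheme_order sch) by pos.
  assert (Hk2 : INR k <= INR k ^ 2) by nra.
  unfold defect. replace (h ^ 2 * INR k ^ 4) with ((h * INR k ^ 2) ^ 2) by ring.
  assert (0 < h * INR k ^ 2) by (apply Rmult_lt_0_compat; nra).
  assert (0 < h ^ scheme_order sch * INR k) by pos.
  assert (h ^ scheme_order sch * INR k <= h * INR k ^ 2) by mono.
  assert (h ^ scheme_order sch * INR k ^ 2 <= h * INR k ^ 2) by mono.
  split; [|split]; [|auto|lra]. split; [|nra].
  assert (0 <= (h * INR k ^ 2) ^ 2) by pos. lra.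
Qed.

(** Every eigenvalue of one problem has an eigenvalue of the other one nearby; the
    numberings agree because both assignments preserve the order strictly.  For
    the discrete eigenvalues strictness comes from orthogonality: two
    eigenvectors close to the same eigenfunction cannot be orthogonal. *)
Theorem eigenvalue_error lam : spectrum lam -> exists C h0, 1 <= C /\ 0 < h0 <= 1 /\
  forall n x h sch mu sigma lamn phin, matches mu sigma -> fine_grid n x h -> 0 < h <= h0 ->
  discrete_data n x sch mu sigma lamn phin ->
  forall k, (1 <= k <= S n)%nat -> INR k ^ 5 * h <= 1 ->
  Rabs (lamn k - lam k) <= C * defect h sch k /\ C * defect h sch k <= / 2.
Proof.
  intros Hsp. destruct (spectrum_growth lam Hsp) as [Cg [HCg Hgrow]].
  destruct (shoot_sign_change) as [t0 [c1 [c2 [[Ht0 Ht0'] [Hc1 [Hc2 Hsign]]]]]].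
  destruct (shooting_close Cg HCg) as [C2 [h1 [HC2 [Hh1 Hclose]]]].
  set (Co := Cg + 3). assert (HCo : 1 <= Co) by (unfold Co; lra).
  destruct (gv_close Co ltac:(lra)) as [Cv [h2 [HCv [Hh2 Hgv]]]].
  destruct (gram_error) as [Cr [h3 [HCr [Hh3 Hgram]]]].
  destruct (inner_lower) as [e0 [kN [He0 [HkN Hinner]]]].
  assert (HK := bnd_ge1 P).
  set (A := C2 * (/ c1 + 2 / c2) + 1).
  assert (Hic1 : 0 < / c1) by pos.
  assert (Hic2 : 0 < / c2) by pos.
  assert (HA : 1 <= A).
  { unfold A. assert (0 < C2 * (/ c1 + 2 / c2)); [|lra]. apply Rmult_lt_0_compat; [lra|]. unfold Rdiv. lra. }
  assert (HA1 : C2 <= c1 * A).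
  { unfold A. replace (c1 * (C2 * (/ c1 + 2 / c2) + 1)) with (C2 + c1 * (2 * C2 * / c2 + 1)) by (field; lra).
    assert (0 < c1 * (2 * C2 * / c2 + 1)); [|lra]. apply Rmult_lt_0_compat; auto.
    assert (0 < 2 * C2 * / c2) by pos. lra. }
  assert (HA2 : 2 * C2 <= c2 * A).
  { unfold A. replace (c2 * (C2 * (/ c1 + 2 / c2) + 1)) with (2 * C2 + c2 * (C2 * / c1 + 1)) by (field; lra).
    assert (0 < c2 * (C2 * / c1 + 1)); [|lra]. apply Rmult_lt_0_compat; auto.
    assert (0 < C2 * / c1) by pos. lra. }
  set (Y := Cv * (Co ^ 2 + 2 * A)).
  assert (HCo2 : 1 <= Co ^ 2) by nra.
  assert (HY : 1 <= Y) by (unfold Y; nra).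
  set (Z := Cr * (Co + 2 * Y)). assert (HZ : 1 <= Z) by (unfold Z; nra).
  set (eta := Rmin (Rmin 1 (t0 / (8 * A))) (Rmin (/ Y) (kN / (2 * Z)))).
  assert (Heta : 0 < eta).
  { unfold eta. repeat apply Rmin_pos; try lra.
    - apply Rdiv_lt_0_compat; lra.
    - apply Rinv_0_lt_compat; lra.
    - apply Rdiv_lt_0_compat; lra. }
  assert (E1 : eta <= 1) by below (Rle_refl eta).
  assert (E2 : eta <= t0 / (8 * A)) by below (Rle_refl eta).
  assert (E3 : eta <= / Y) by below (Rle_refl eta).
  assert (E4 : eta <= kN / (2 * Z)) by below (Rle_refl eta).
  assert (E2' : 8 * (A * eta) <= t0).
  { apply Rle_trans with (8 * (A * (t0 / (8 * A)))); [|right; field; lra].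
    apply Rmult_le_compat_l; [lra|]. apply Rmult_le_compat_l; lra. }
  assert (E3' : Y * eta <= 1).
  { apply Rle_trans with (Y * / Y); [apply Rmult_le_compat_l; lra | right; field; lra]. }
  assert (E4' : 2 * (Z * eta) <= kN).
  { apply Rle_trans with (2 * (Z * (kN / (2 * Z)))); [|right; field; lra].
    apply Rmult_le_compat_l; [lra|]. apply Rmult_le_compat_l; lra. }
  clearbody eta. clear E2 E3 E4.
  set (h0 := Rmin (Rmin (eta ^ 2) h1) (Rmin (Rmin h2 h3) (/ (2 * K)))).
  assert (Heta2 : 0 < eta ^ 2) by pos.
  exists A, h0. split; [auto|]. split.
  { split.
    - unfold h0. repeat apply Rmin_pos; try lra. apply Rinv_0_lt_compat; lra.
    - apply Rle_trans with (eta ^ 2); [unfold h0; eapply Rle_trans; [apply Rmin_l | apply Rmin_l] | nra]. }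
  intros n x h sch mu sigma lamn phin Hm Hf [Hh Hh'] [Hd1 [Hd2 Hd3]] k Hk Hkh.
  assert (H1 : h <= eta ^ 2) by below Hh'.
  assert (H2 : h <= h1) by below Hh'.
  assert (H3 : h <= h2) by below Hh'.
  assert (H4 : h <= h3) by below Hh'.
  assert (H5 : h <= / (2 * K)) by below Hh'.
  assert (HKh := bnd_mesh_small h Hh H5). clearbody h0.
  destruct (defect_bounds h sch k eta (conj Heta E1) (conj Hh H1) ltac:(lia) Hkh) as [[HT0 HT1] [HT2 HT3]].
  set (T := defect h sch k) in *. set (t := A * T) in *.
  assert (Ht : 0 < t) by (unfold t; apply Rmult_lt_0_compat; lra).
  assert (Htt0 : 4 * t <= t0).
  { unfold t. assert (A * T <= A * (2 * eta)) by mono. lra. }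
  assert (HteA : t <= 2 * A * eta).
  { unfold t. assert (A * T <= A * (2 * eta)) by mono. lra. }
  assert (Hc1t : C2 * T <= c1 * t).
  { unfold t. rewrite <- Rmult_assoc. apply Rmult_le_compat_r; lra. }
  assert (Hc2t : C2 * T < c2 * t).
  { unfold t. assert (2 * C2 * T <= c2 * A * T) by mono.
    assert (0 < C2 * T) by pos. lra. }
  split; [|lra].
  destruct Hsp as [Hs1 [Hs2 Hs3]].
  assert (Hmono : forall i j, (1 <= i <= j)%nat -> lam i <= lam j).
  { intros i j Hij. apply (spectrum_le); [split; auto | auto]. }
  assert (Hcl : forall z, -1 <= z -> z <= lam k + 1 -> Rabs (shoot_n n x sch z - shoot z) <= C2 * T).
  { intros z Z1 Z2. apply (Hclose n x h sch k (lam k) z); auto; try lra; [lia|]. apply Hgrow; lia. }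
  (* [shoot] stays away from zero up to the distance t0 from each of its zeros *)
  assert (Hgap : forall i j, (1 <= i < j)%nat -> lam i + t0 < lam j).
  { intros i j Hij. apply Rnot_le_lt. intros Hn.
    destruct (Hs1 i ltac:(lia)) as [z1 z2]. destruct (Hs1 j ltac:(lia)) as [_ z3].
    assert (z4 := Hs2 i j Hij).
    destruct (Hsign (lam i) (lam j - lam i) z1 ltac:(lra)) as [z5 _].
    - rewrite z2, Rabs_R0. apply Rmult_le_pos; lra.
    - replace (lam i + (lam j - lam i)) with (lam j) in z5 by ring. rewrite z3, Rabs_R0 in z5.
      assert (0 < c2 * (lam j - lam i)) by pos. lra. }
  (* t is so large that the error of shoot_n cannot change the signs of shoot at
     lam j - t and lam j + t *)
  assert (Hnear1 : forall j, (1 <= j <= k)%nat -> exists i, (1 <= i <= S n)%nat /\ Rabs (lamn i - lam j) < t).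
  { intros j Hj. destruct (Hs1 j ltac:(lia)) as [z1 z2]. assert (z3 := Hmono j k ltac:(lia)).
    destruct (Hsign (lam j) t z1 ltac:(lra)) as [s1 [s2 s3]].
    { rewrite z2, Rabs_R0. apply Rmult_le_pos; lra. }
    assert (q1 := Hcl (lam j + t) ltac:(lra) ltac:(lra)). assert (q2 := Hcl (lam j - t) ltac:(lra) ltac:(lra)).
    set (u1 := shoot (lam j + t)) in *. set (u2 := shoot (lam j - t)) in *.
    set (v1 := shoot_n n x sch (lam j + t)) in *. set (v2 := shoot_n n x sch (lam j - t)) in *.
    assert (S1 := same_sign u1 v1 _ _ Hc2t s1 q1). assert (S2 := same_sign u2 v2 _ _ Hc2t s2 q2).
    assert (Hv : v2 * v1 < 0).
    { assert (0 < (u1 * v1) * (u2 * v2)) by (apply Rmult_lt_0_compat; auto).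
      apply Rnot_le_lt. intros Hn.
      assert (0 <= - (u1 * u2) * (v2 * v1)) by pos. lra. }
    assert (Hv1 : v1 <> 0) by (intros E; rewrite E in Hv; lra).
    destruct (zero_between (shoot_n n x sch) (lam j - t) (lam j + t)) as [z [Hz Ez]]; [lra| |exact Hv|].
    - intros y _. exact (Plt_continuous _ _ (shoot_n_Plt n x sch) y).
    - destruct (root_in_list n x sch lamn z (lam j + t)) as [i [Hi Ei]]; auto.
      + intros i Hi. destruct (Hd1 i Hi) as [_ [_ [_ E]]]. exact E.
      + exists i. split; auto. rewrite <- Ei. apply Rabs_lt_between. lra. }
  assert (Hup : lamn k < lam k + t).
  { assert (main : forall j, (1 <= j <= k)%nat -> exists i, (j <= i <= S n)%nat /\ Rabs (lamn i - lam j) < t).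
    { induction j as [|j IH]; intros Hj; [lia|]. destruct (Hnear1 (S j) Hj) as [i' [Hi' Ei']].
      exists i'. split; auto. split; [|lia]. destruct (Nat.eq_dec j 0) as [->|]; [lia|].
      destruct (IH ltac:(lia)) as [i [Hi Ei]]. assert (G := Hgap j (S j) ltac:(lia)).
      apply Rabs_lt_between in Ei, Ei'. destruct (le_lt_dec i' i); [|lia].
      assert (lamn i' <= lamn i).
      { destruct (Nat.eq_dec i' i) as [->|]; [lra|]. left. apply Hd2; lia. }
      lra. }
    destruct (main k ltac:(lia)) as [i [Hi Ei]]. apply Rabs_lt_between in Ei.
    assert (lamn k <= lamn i).
    { destruct (Nat.eq_dec k i) as [->|]; [lra|]. left. apply Hd2; lia. }
    lra. }
  assert (Hlow : forall i, (1 <= i <= k)%nat -> 0 < lamn i <= lamn k).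
  { intros i Hi. split.
    - apply Rnot_le_lt. intros Hn. destruct (Hd1 i ltac:(lia)) as [_ [_ [_ E]]].
      assert (N := shoot_n_neg n x h (lamn i) sch Hf HKh Hn). lra.
    - destruct (Nat.eq_dec i k) as [->|]; [lra|]. left. apply Hd2; lia. }
  (* at a root of shoot_n the value of shoot is small, so shoot changes sign nearby *)
  assert (Hnear2 : forall i, (1 <= i <= k)%nat -> exists m, (1 <= m)%nat /\ Rabs (lamn i - lam m) < t).
  { intros i Hi. destruct (Hlow i Hi) as [z1 z2]. destruct (Hd1 i ltac:(lia)) as [_ [_ [_ E]]].
    assert (q1 := Hcl (lamn i) ltac:(lra) ltac:(lra)). rewrite E in q1.
    replace (0 - shoot (lamn i)) with (- shoot (lamn i)) in q1 by ring. rewrite Rabs_Ropp in q1.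
    destruct (Hsign (lamn i) t ltac:(lra) ltac:(lra) ltac:(lra)) as [_ [_ s3]].
    destruct (zero_between shoot (lamn i - t) (lamn i + t)) as [z [Hz Ez]]; [lra| |lra|].
    - intros y Hy. apply shoot_cont. lra.
    - destruct (Hs3 z ltac:(lra) Ez) as [m [Hm1 Hm2]]. exists m. split; auto. rewrite <- Hm2.
      apply Rabs_lt_between. lra. }
  (* both eigenvectors would be close to W (lam m), and their inner product close to
     its square norm, which is bounded from below *)
  assert (Hsep : forall i j m, (1 <= i < j)%nat -> (j <= k)%nat -> (1 <= m)%nat ->
     Rabs (lamn i - lam m) < t -> Rabs (lamn j - lam m) < t -> False).
  { intros i j m Hij Hjk Hm1 Ei Ej.
    destruct (Hs1 m Hm1) as [z1 z2].
    assert (Lj := Hlow j ltac:(lia)). assert (Li := Hlow i ltac:(lia)).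
    assert (Ej' := Ej). apply Rabs_lt_between in Ej'.
    assert (Hk1 : (1 <= k)%nat) by lia.
    destruct (om_growth Cg (lam k) (lam m) k HCg Hk1 (Hgrow k Hk1) ltac:(lra) ltac:(lra)) as [O1 _].
    destruct (om_growth Cg (lam k) (lamn i) k HCg Hk1 (Hgrow k Hk1) ltac:(lra) ltac:(lra)) as [O2 _].
    destruct (om_growth Cg (lam k) (lamn j) k HCg Hk1 (Hgrow k Hk1) ltac:(lra) ltac:(lra)) as [O3 _].
    fold Co in O1, O2, O3.
    assert (Oh : forall z, z <= Co * INR k ^ 2 -> z * h <= Co * eta).
    { intros z Hz. apply Rle_trans with (Co * INR k ^ 2 * h); [apply Rmult_le_compat_r; lra|].
      replace (Co * INR k ^ 2 * h) with (Co * (h * INR k ^ 2)) by ring. apply Rmult_le_compat_l; lra. }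
    assert (Oh1 : forall z, z <= Co * INR k ^ 2 -> z * h <= Co).
    { intros z Hz. specialize (Oh z Hz). assert (Co * eta <= Co * 1) by mono. lra. }
    assert (Hw := om_ge1 (lam m) ltac:(lra)). assert (Hws := om_sqr (lam m) ltac:(lra)).
    set (w := om (lam m)) in *.
    set (D := Cv * (h ^ 2 * w ^ 3 + t) / w).
    assert (Hw3 : h ^ 2 * w ^ 3 <= Co ^ 2 * eta).
    { apply Rle_trans with ((w ^ 2 * h) ^ 2).
      - replace ((w ^ 2 * h) ^ 2) with (h ^ 2 * w ^ 3 * w) by ring.
        rewrite <- (Rmult_1_r (h ^ 2 * w ^ 3)) at 1. apply Rmult_le_compat_l; [|lra].
        apply Rmult_le_pos; apply pow_le; lra.
      - apply Rle_trans with ((Co * eta) ^ 2).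
        + apply pow_incr. split; [apply Rmult_le_pos; [apply pow2_ge_0 | lra] | now apply Oh].
        + replace ((Co * eta) ^ 2) with (Co ^ 2 * (eta * eta)) by ring.
          rewrite <- (Rmult_1_r eta) at 3. apply Rmult_le_compat_l; [lra|]. apply Rmult_le_compat_l; lra. }
    assert (Hwp : 0 <= h ^ 2 * w ^ 3) by pos.
    assert (HwD : w * D <= Y * eta).
    { unfold D, Y. replace (w * (Cv * (h ^ 2 * w ^ 3 + t) / w)) with (Cv * (h ^ 2 * w ^ 3 + t)) by (field; lra).
      rewrite (Rmult_assoc Cv). apply Rmult_le_compat_l; lra. }
    assert (HD0 : 0 <= D).
    { unfold D, Rdiv. apply Rmult_le_pos; [apply Rmult_le_pos; lra | left; apply Rinv_0_lt_compat; lra]. }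
    assert (close : forall p, -1 <= lamn p -> Rabs (lamn p - lam m) < t -> om (lamn p) ^ 2 * h <= Co ->
       forall y, (y <= n)%nat -> Rabs (gv n x (lamn p) y - W (lam m) (x y)) <= D).
    { intros p Hp1 Hp2 Hp3 y Hy.
      assert (G := Hgv n x h (lam m) (lamn p) t Hf (conj Hh H3) ltac:(lra) Hp1 ltac:(lra) ltac:(lra) Hp3 y ltac:(lia)).
      fold w in G. apply Rmult_le_reg_l with w; [lra|]. unfold D.
      replace (w * (Cv * (h ^ 2 * w ^ 3 + t) / w)) with (Cv * (h ^ 2 * w ^ 3 + t)) by (field; lra). exact G. }
    assert (G := Hgram n x h sch mu sigma (lam m) (gv n x (lamn i)) (gv n x (lamn j)) D Hm Hf (conj Hh H4)
      ltac:(lra) HD0 (close i ltac:(lra) Ei (Oh1 _ O2)) (close j ltac:(lra) Ej (Oh1 _ O3))).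
    fold w in G.
    assert (Hzero : sum_f_R0 (fun p => gv n x (lamn i) p * gv n x (lamn j) p * discrete_speed x sch rho mu sigma p) n = 0).
    { destruct (Hd1 i ltac:(lia)) as [si [Hsi [Fi _]]]. destruct (Hd1 j ltac:(lia)) as [sj [Hsj [Fj _]]].
      assert (O := Hd3 i j ltac:(lia) ltac:(lia)). destruct (Nat.eq_dec i j); [lia|].
      rewrite (sum_eq _ (fun p => gv n x (lamn i) p * gv n x (lamn j) p * discrete_speed x sch rho mu sigma p * (si * sj))) in O.
      - rewrite <- scal_sum in O. destruct (Rmult_integral _ _ O) as [B|B]; auto.
        destruct (Rmult_integral _ _ B); contradiction.
      - intros p Hp. rewrite Fi, Fj by lia. ring. }
    rewrite Hzero in G.
    assert (Hin := Hinner (lam m) ltac:(lra) ltac:(rewrite z2, Rabs_R0; lra)).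
    rewrite <- Hws in Hin. apply Rabs_le_between in G.
    assert (Hg : 0 < h ^ scheme_order sch) by pos.
    assert (F1 : w ^ 2 * inner (W (lam m)) (W (lam m)) <= w ^ 2 * (Cr * (h ^ scheme_order sch + D / w + D ^ 2))).
    { apply Rmult_le_compat_l; [apply pow2_ge_0 | lra]. }
    replace (w ^ 2 * (Cr * (h ^ scheme_order sch + D / w + D ^ 2)))
      with (Cr * (h ^ scheme_order sch * w ^ 2 + w * D + (w * D) ^ 2)) in F1 by (field; lra).
    assert (F2 : h ^ scheme_order sch * w ^ 2 <= Co * eta).
    { apply Rle_trans with (h ^ scheme_order sch * (Co * INR k ^ 2)); [apply Rmult_le_compat_l; lra|].
      replace (h ^ scheme_order sch * (Co * INR k ^ 2)) with (Co * (h ^ scheme_order sch * INR k ^ 2)) by ring.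
      apply Rmult_le_compat_l; lra. }
    assert (HwD0 : 0 <= w * D) by pos.
    assert (F3 : (w * D) ^ 2 <= Y * eta).
    { assert ((w * D) * (w * D) <= (w * D) * 1) by mono.
      replace ((w * D) ^ 2) with ((w * D) * (w * D)) by ring. lra. }
    assert (F4 : Cr * (h ^ scheme_order sch * w ^ 2 + w * D + (w * D) ^ 2) <= Z * eta).
    { unfold Z. rewrite (Rmult_assoc Cr). apply Rmult_le_compat_l; lra. }
    lra. }
  assert (Hdown : lam k - t < lamn k).
  { assert (main : forall i, (1 <= i <= k)%nat -> exists m, (i <= m)%nat /\ Rabs (lamn i - lam m) < t).
    { induction i as [|i IH]; intros Hi; [lia|]. destruct (Hnear2 (S i) Hi) as [m' [Hm' Em']].
      exists m'. split; auto. destruct (Nat.eq_dec i 0) as [->|]; [lia|].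
      destruct (IH ltac:(lia)) as [m [Hm1 Em]].
      destruct (Nat.eq_dec m m') as [<-|Hne].
      - exfalso. apply (Hsep i (S i) m); auto; lia.
      - destruct (le_lt_dec m' m); [|lia]. exfalso. assert (G := Hgap m' m ltac:(lia)).
        assert (lamn i < lamn (S i)) by (apply Hd2; lia).
        apply Rabs_lt_between in Em, Em'. lra. }
    destruct (main k ltac:(lia)) as [m [Hm1 Em]]. apply Rabs_lt_between in Em.
    assert (lam k <= lam m) by (apply Hmono; lia). lra. }
  apply Rabs_le. fold t. lra.
Qed.

(** * The error of the eigenfunctions *)

(** The slope is [-1] at the right end and needs a distance of order [1 / om lam]
    to change its sign. *)
Lemma W_positive : exists M, 1 <= M /\ forall lam x, -1 <= lam -> inside x -> x < r ->
  M * om lam * (r - x) < 1 -> 0 < W lam x.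
Proof.
  destruct (W_derivatives_bound) as [M [HM HW]]. exists M. split; auto.
  intros lam x Hl Hx Hxr Hs. assert (Ho := om_ge1 lam Hl).
  assert (Hin : forall t, x <= t <= r -> inside t) by (intros t Ht; destruct Hx; split; lra).
  destruct (mean_value (W lam) (V lam) x r) as [y [Hy E]]; [lra | intros; apply W_derive |].
  assert (L : Rabs (V lam r - V lam y) <= M * om lam * (r - y)).
  { apply (lipschitz_of_derive (V lam) (W2 lam)); [lra | intros; apply V_derive2 |].
    intros t Ht. apply HW; auto. apply Hin; lra. }
  rewrite W_rgt in E. rewrite V_rgt in L.
  assert (M * om lam * (r - y) <= M * om lam * (r - x)).
  { apply Rmult_le_compat_l; [apply Rmult_le_pos|]; lra. }
  apply Rabs_le_between in L.
  assert (0 < (- V lam y) * (r - x)) by pos. lra.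
Qed.

(** From [(s - c) (s + c) = s^2 c^2 (N - Nn)] and, as [s] and [c] have the same
    sign, [|c| <= |s + c|]. *)
Lemma normalisation_close s c N Nn w k : 0 < k -> 0 < w -> s ^ 2 * Nn = 1 -> c ^ 2 * N = 1 ->
  0 <= s * c -> k <= w ^ 2 * N -> k / 2 <= w ^ 2 * Nn ->
  Rabs s <= (1 + 2 / k) * w /\ Rabs (s - c) <= (1 + 2 / k) ^ 3 * w ^ 3 * Rabs (Nn - N).
Proof.
  intros Hk Hw Hs Hc Hsc HN HNn.
  set (S0 := 1 + 2 / k). assert (Hik : 0 < 2 / k) by pos.
  assert (bound : forall u M, u ^ 2 * M = 1 -> k / 2 <= w ^ 2 * M -> u ^ 2 <= (S0 * w) ^ 2).
  { intros u M Hu HM. assert (Hu2 : 0 <= u ^ 2) by pos.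
    apply Rle_trans with (2 / k * w ^ 2).
    - apply Rmult_le_reg_l with (k / 2); [lra|]. replace (k / 2 * (2 / k * w ^ 2)) with (w ^ 2 * 1) by (field; lra).
      rewrite <- Hu. replace (w ^ 2 * (u ^ 2 * M)) with ((w ^ 2 * M) * u ^ 2) by ring.
      apply Rmult_le_compat_r; auto.
    - rewrite Rpow_mult_distr. apply Rmult_le_compat_r; [apply pow2_ge_0|]. unfold S0. nra. }
  assert (HS0w : 0 <= S0 * w) by (apply Rmult_le_pos; unfold S0; lra).
  assert (Bs := bound s Nn Hs HNn). assert (Bc := bound c N Hc ltac:(lra)).
  assert (Bc' := abs_le_of_sqr c _ HS0w Bc).
  split; [exact (abs_le_of_sqr s _ HS0w Bs)|].
  assert (Hc0 : 0 < Rabs c).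
  { apply Rabs_pos_lt. intros E. rewrite E in Hc. lra. }
  apply Rmult_le_reg_r with (Rabs c); auto.
  apply Rle_trans with (Rabs (s - c) * Rabs (s + c)).
  { apply Rmult_le_compat_l; [apply Rabs_pos|]. rewrite <- (sqrt_pow2 (Rabs c)), <- (sqrt_pow2 (Rabs (s + c))) by apply Rabs_pos.
    apply sqrt_le_1_alt. rewrite !pow2_abs. assert (0 <= s ^ 2) by pos. nra. }
  rewrite <- Rabs_mult.
  replace ((s - c) * (s + c)) with (- (s ^ 2 * (Rabs c * Rabs c) * (Nn - N))).
  2:{ replace (Rabs c * Rabs c) with (Rabs c ^ 2) by ring. rewrite pow2_abs.
      replace ((s - c) * (s + c)) with (s ^ 2 * (c ^ 2 * N) - c ^ 2 * (s ^ 2 * Nn)) by (rewrite Hs, Hc; ring). ring. }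
  rewrite Rabs_Ropp, !Rabs_mult, Rabs_Rabsolu, (Rabs_right (s ^ 2)) by apply Rle_ge, pow2_ge_0.
  replace (S0 ^ 3 * w ^ 3 * Rabs (Nn - N) * Rabs c) with ((S0 * w) ^ 2 * ((S0 * w) * Rabs c) * Rabs (Nn - N)) by ring.
  apply Rmult_le_compat_r; [apply Rabs_pos|].
  apply Rmult_le_compat; auto; [apply pow2_ge_0 | apply Rmult_le_pos; apply Rabs_pos |].
  apply Rmult_le_compat_r; [apply Rabs_pos | exact Bc'].
Qed.

(** Write the eigenvector as [s g] and the eigenfunction as [c W], and split [s g
    - c W = s (g - W) + (s - c) W]. The factors [s] and [c] are of order [om], the
    error [om |g - W|] is of order [h^2 om^3] plus the error of the eigenvalue,
    and [om^3 |Nn - N| |W|] is of order [om^2 h^gamma] plus the same errors, where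
    [gamma] is the order of the scheme; each term is at most of order [k^4
    h^gamma]. *)
Theorem eigenfunction_error lam : spectrum lam -> exists C h0, 1 <= C /\ 0 < h0 /\
  forall n x h sch mu sigma lamn phin, matches mu sigma -> fine_grid n x h -> 0 < h <= h0 ->
  discrete_data n x sch mu sigma lamn phin ->
  forall k ph c, (1 <= k <= S n)%nat -> INR k ^ 5 * h <= 1 ->
  (forall t, inside t -> ph t = c * W (lam k) t) -> c ^ 2 * inner (W (lam k)) (W (lam k)) = 1 ->
  0 <= phin k n * ph (x n) ->
  forall i, (i <= n)%nat -> Rabs (phin k i - ph (x i)) <= C * INR k ^ 4 * h ^ scheme_order sch.
Proof.
  intros Hsp. destruct (spectrum_growth lam Hsp) as [Cg [HCg Hgrow]].
  destruct (eigenvalue_error lam Hsp) as [C1 [h1 [HC1 [Hh1 Hev]]]].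
  set (Co := Cg + 3). assert (HCo : 1 <= Co) by (unfold Co; lra).
  destruct (gv_close Co ltac:(lra)) as [Cv [h2 [HCv [Hh2 Hgv]]]].
  destruct (gram_error) as [Cr [h3 [HCr [Hh3 Hgram]]]].
  destruct (inner_lower) as [e0 [kN [He0 [HkN Hinner]]]].
  destruct W_positive as [M [HM HWp]]. destruct (W_bound) as [B [HB HWb]].
  assert (HK := bnd_ge1 P).
  set (Y := Cv * (Co ^ 2 + 2 * C1)). assert (HCo2 : 1 <= Co ^ 2) by nra.
  assert (HY : 1 <= Y) by (unfold Y; nra).
  set (Z := Cr * (Co + 2 * Y)). assert (HZ : 1 <= Z) by (unfold Z; nra).
  set (S0 := 1 + 2 / kN). assert (HS0 : 1 < S0) by (unfold S0; assert (0 < 2 / kN) by pos; lra).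
  set (eta := Rmin (Rmin 1 (/ Y)) (Rmin (/ (2 * (M * Co))) (kN / (2 * Z)))).
  assert (HMC : 1 <= M * Co) by nra.
  assert (Heta : 0 < eta).
  { unfold eta. repeat apply Rmin_pos; try lra.
    - apply Rinv_0_lt_compat; lra.
    - apply Rinv_0_lt_compat; lra.
    - apply Rdiv_lt_0_compat; lra. }
  assert (E1 : eta <= 1) by below (Rle_refl eta).
  assert (E2 : eta <= / Y) by below (Rle_refl eta).
  assert (E3 : eta <= / (2 * (M * Co))) by below (Rle_refl eta).
  assert (E4 : eta <= kN / (2 * Z)) by below (Rle_refl eta).
  assert (E2' : Y * eta <= 1).
  { apply Rle_trans with (Y * / Y); [apply Rmult_le_compat_l; lra | right; field; lra]. }
  assert (E3' : M * Co * eta <= / 2).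
  { apply Rle_trans with (M * Co * / (2 * (M * Co))); [apply Rmult_le_compat_l; lra | right; field; lra]. }
  assert (E4' : 2 * (Z * eta) <= kN).
  { apply Rle_trans with (2 * (Z * (kN / (2 * Z)))); [|right; field; lra].
    apply Rmult_le_compat_l; [lra|]. apply Rmult_le_compat_l; lra. }
  clearbody eta. clear E2 E3 E4.
  set (h0 := Rmin (Rmin (eta ^ 2) h1) (Rmin (Rmin h2 h3) (/ (2 * K)))).
  assert (Heta2 : 0 < eta ^ 2) by pos.
  assert (HS03 : 1 <= S0 ^ 3) by (rewrite <- (pow1 3); apply pow_incr; lra).
  exists (S0 * Y + S0 ^ 3 * B * Z), h0.
  assert (HSY : 1 <= S0 * Y) by nra.
  assert (HSB : 0 < S0 ^ 3 * B * Z) by (apply Rmult_lt_0_compat; [apply Rmult_lt_0_compat|]; lra).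
  split; [lra|]. split.
  { unfold h0. repeat apply Rmin_pos; try lra. apply Rinv_0_lt_compat; lra. }
  intros n x h sch mu sigma lamn phin Hm Hf [Hh Hh'] Hdd k ph c Hk Hkh Hph Hc Hsign i Hi.
  assert (H1 : h <= eta ^ 2) by below Hh'.
  assert (H2 : h <= h1) by below Hh'.
  assert (H3 : h <= h2) by below Hh'.
  assert (H4 : h <= h3) by below Hh'.
  assert (H5 : h <= / (2 * K)) by below Hh'.
  assert (HKh := bnd_mesh_small h Hh H5). clearbody h0.
  destruct (defect_bounds h sch k eta (conj Heta E1) (conj Hh H1) ltac:(lia) Hkh) as [[HT0 HT1] [HT2 HT3]].
  destruct (Hev n x h sch mu sigma lamn phin Hm Hf (conj Hh H2) Hdd k Hk Hkh) as [Elam Ethalf].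
  destruct Hdd as [Hd1 [_ Hd3]]. destruct (Hd1 k Hk) as [s [Hs [Hphin _]]].
  destruct Hsp as [Hs1 _]. destruct (Hs1 k ltac:(lia)) as [z1 z2].
  set (t := C1 * defect h sch k) in *.
  set (Xi := INR k ^ 4 * h ^ scheme_order sch).
  assert (Hk1 : 1 <= INR k) by (destruct Hk as [Hk _]; apply le_INR in Hk; exact Hk).
  destruct (order_pow_le h sch Hh ltac:(lra)) as [Or1 Or2].
  assert (Hg : 0 < h ^ scheme_order sch) by pos.
  assert (Hk4 : 1 <= INR k ^ 4) by (rewrite <- (pow1 4); apply pow_incr; lra).
  assert (HXi : 0 < Xi) by (unfold Xi; apply Rmult_lt_0_compat; lra).
  assert (Hh2k : h ^ 2 * INR k ^ 4 <= Xi).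
  { unfold Xi. rewrite (Rmult_comm (INR k ^ 4)). apply Rmult_le_compat_r; lra. }
  assert (Hk24 : INR k ^ 2 <= INR k ^ 4) by (apply Rle_pow; [lra | lia]).
  assert (Hk14 : INR k <= INR k ^ 4) by (rewrite <- (pow_1 (INR k)) at 1; apply Rle_pow; [lra | lia]).
  assert (Hdef : defect h sch k <= 2 * Xi).
  { unfold defect. assert (h ^ scheme_order sch * INR k <= Xi); [|lra].
    unfold Xi. rewrite (Rmult_comm (INR k ^ 4)). apply Rmult_le_compat_l; lra. }
  assert (Elam' := Elam). apply Rabs_le_between in Elam'.
  assert (Hkn : (1 <= k)%nat) by lia.
  destruct (om_growth Cg (lam k) (lam k) k HCg Hkn (Hgrow k Hkn) ltac:(lra) ltac:(lra)) as [O1 O1'].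
  destruct (om_growth Cg (lam k) (lamn k) k HCg Hkn (Hgrow k Hkn) ltac:(lra) ltac:(lra)) as [O2 _].
  fold Co in O1, O1', O2.
  assert (Hw := om_ge1 (lam k) ltac:(lra)). assert (Hws := om_sqr (lam k) ltac:(lra)).
  set (w := om (lam k)) in *.
  assert (Oh : forall z, z <= Co * INR k ^ 2 -> z * h <= Co * eta).
  { intros z Hz. apply Rle_trans with (Co * INR k ^ 2 * h); [apply Rmult_le_compat_r; lra|].
    replace (Co * INR k ^ 2 * h) with (Co * (h * INR k ^ 2)) by ring. apply Rmult_le_compat_l; lra. }
  assert (HCe : Co * eta <= Co * 1) by mono.
  assert (Hw3p : 0 <= h ^ 2 * w ^ 3) by pos.
  assert (Hw34 : h ^ 2 * w ^ 3 <= (w ^ 2 * h) ^ 2).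
  { replace ((w ^ 2 * h) ^ 2) with (h ^ 2 * w ^ 3 * w) by ring.
    rewrite <- (Rmult_1_r (h ^ 2 * w ^ 3)) at 1. apply Rmult_le_compat_l; lra. }
  assert (Hw2h : 0 <= w ^ 2 * h) by (apply Rmult_le_pos; [apply pow2_ge_0 | lra]).
  assert (Hw3 : h ^ 2 * w ^ 3 <= Co ^ 2 * eta).
  { eapply Rle_trans; [exact Hw34|]. apply Rle_trans with ((Co * eta) ^ 2).
    - apply pow_incr. split; [auto | now apply Oh].
    - replace ((Co * eta) ^ 2) with (Co ^ 2 * (eta * eta)) by ring.
      rewrite <- (Rmult_1_r eta) at 3. apply Rmult_le_compat_l; [lra|]. apply Rmult_le_compat_l; lra. }
  assert (Hw3' : h ^ 2 * w ^ 3 <= Co ^ 2 * Xi).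
  { eapply Rle_trans; [exact Hw34|]. apply Rle_trans with ((Co * INR k ^ 2 * h) ^ 2).
    - apply pow_incr. split; [auto | apply Rmult_le_compat_r; lra].
    - replace ((Co * INR k ^ 2 * h) ^ 2) with (Co ^ 2 * (h ^ 2 * INR k ^ 4)) by ring.
      apply Rmult_le_compat_l; lra. }
  assert (Ht0 : 0 <= t) by (unfold t; apply Rmult_le_pos; lra).
  assert (Ht1 : t <= 2 * C1 * eta).
  { unfold t. replace (2 * C1 * eta) with (C1 * (2 * eta)) by ring. apply Rmult_le_compat_l; lra. }
  assert (Ht2 : t <= 2 * C1 * Xi).
  { unfold t. replace (2 * C1 * Xi) with (C1 * (2 * Xi)) by ring. apply Rmult_le_compat_l; lra. }
  set (wD := Cv * (h ^ 2 * w ^ 3 + t)).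
  assert (HwD0 : 0 <= wD) by (unfold wD; apply Rmult_le_pos; lra).
  assert (HwD1 : wD <= Y * eta) by (unfold wD, Y; rewrite (Rmult_assoc Cv); apply Rmult_le_compat_l; lra).
  assert (HwD2 : wD <= Y * Xi) by (unfold wD, Y; rewrite (Rmult_assoc Cv); apply Rmult_le_compat_l; lra).
  assert (close : forall y, (y <= S n)%nat -> w * Rabs (gv n x (lamn k) y - W (lam k) (x y)) <= wD).
  { intros y Hy. apply (Hgv n x h (lam k) (lamn k) t Hf (conj Hh H3)); auto; try lra.
    specialize (Oh _ O2). lra. }
  assert (close' : forall y, (y <= n)%nat -> Rabs (gv n x (lamn k) y - W (lam k) (x y)) <= wD / w).
  { intros y Hy. apply Rmult_le_reg_l with w; [lra|]. replace (w * (wD / w)) with wD by (field; lra).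
    apply close; lia. }
  assert (HD0 : 0 <= wD / w) by (unfold Rdiv; apply Rmult_le_pos; [auto | left; apply Rinv_0_lt_compat; lra]).
  assert (G := Hgram n x h sch mu sigma (lam k) (gv n x (lamn k)) (gv n x (lamn k)) (wD / w) Hm Hf (conj Hh H4)
    ltac:(lra) HD0 close' close').
  fold w in G.
  set (N := inner (W (lam k)) (W (lam k))) in *.
  set (Nn := sum_f_R0 (fun p => gv n x (lamn k) p * gv n x (lamn k) p * discrete_speed x sch rho mu sigma p) n) in *.
  assert (G2 : w ^ 2 * Rabs (Nn - N) <= Cr * (h ^ scheme_order sch * w ^ 2 + 2 * wD)).
  { apply Rle_trans with (w ^ 2 * (Cr * (h ^ scheme_order sch + wD / w / w + (wD / w) ^ 2))).
    - apply Rmult_le_compat_l; [apply pow2_ge_0 | exact G].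
    - replace (w ^ 2 * (Cr * (h ^ scheme_order sch + wD / w / w + (wD / w) ^ 2)))
        with (Cr * (h ^ scheme_order sch * w ^ 2 + (wD + wD * wD))) by (field; lra).
      apply Rmult_le_compat_l; [lra|].
      assert (wD * wD <= wD * 1) by mono. lra. }
  assert (Hgw : h ^ scheme_order sch * w ^ 2 <= Co * (h ^ scheme_order sch * INR k ^ 2)).
  { apply Rle_trans with (h ^ scheme_order sch * (Co * INR k ^ 2)); [apply Rmult_le_compat_l; lra | right; ring]. }
  assert (Hgk : h ^ scheme_order sch * INR k ^ 2 <= Xi).
  { unfold Xi. rewrite (Rmult_comm (INR k ^ 4)). apply Rmult_le_compat_l; lra. }
  assert (G3 : forall e, h ^ scheme_order sch * INR k ^ 2 <= e -> wD <= Y * e -> w ^ 2 * Rabs (Nn - N) <= Z * e).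
  { intros e He1 He2. eapply Rle_trans; [exact G2|]. unfold Z. rewrite (Rmult_assoc Cr).
    apply Rmult_le_compat_l; [lra|].
    assert (Co * (h ^ scheme_order sch * INR k ^ 2) <= Co * e) by mono. lra. }
  assert (Hin := Hinner (lam k) ltac:(lra) ltac:(rewrite z2, Rabs_R0; lra)).
  rewrite <- Hws in Hin. fold N in Hin.
  assert (HNn : kN / 2 <= w ^ 2 * Nn).
  { assert (F := G3 eta HT3 HwD1).
    assert (w ^ 2 * (N - Nn) <= w ^ 2 * Rabs (Nn - N)).
    { apply Rmult_le_compat_l; [apply pow2_ge_0|]. rewrite Rabs_minus_sym. apply Rle_abs. }
    lra. }
  assert (Hsn : s ^ 2 * Nn = 1).
  { assert (O := Hd3 k k Hk Hk). destruct (Nat.eq_dec k k) as [_|]; [|contradiction].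
    rewrite (sum_eq _ (fun p => gv n x (lamn k) p * gv n x (lamn k) p * discrete_speed x sch rho mu sigma p * s ^ 2)) in O.
    - rewrite <- scal_sum in O. exact O.
    - intros p Hp. rewrite Hphin by lia. ring. }
  assert (Hxn := node_bounds n x n (proj1 Hf) ltac:(lia)).
  destruct (step_bounds n x h n Hf (le_n n)) as [d1 d2]. unfold step_plus in d1, d2.
  assert (HxS : x (S n) = r) by apply Hf. rewrite HxS in d1, d2.
  (* both solutions are positive at x_n, so the sign convention decides the sign of s c *)
  assert (Hsc : 0 <= s * c).
  { rewrite Hphin, (Hph _ Hxn) in Hsign by lia.
    assert (g1 := gv_next_to_last n x h (lamn k) Hf HKh).
    assert (g2 : 0 < W (lam k) (x n)).
    { apply HWp; auto; try lra. fold w.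
      assert (w * (r - x n) <= w ^ 2 * h).
      { replace (w ^ 2 * h) with (w * (w * h)) by ring. apply Rmult_le_compat_l; [lra|].
        apply Rle_trans with (1 * h); [lra | apply Rmult_le_compat_r; lra]. }
      assert (M * (w * (r - x n)) <= M * (Co * eta)).
      { apply Rmult_le_compat_l; [lra|]. specialize (Oh _ O1). lra. }
      lra. }
    apply Rnot_lt_le. intros Hn.
    assert (0 < - (s * c) * (gv n x (lamn k) n * W (lam k) (x n))).
    { apply Rmult_lt_0_compat; [lra | now apply Rmult_lt_0_compat]. }
    lra. }
  destruct (normalisation_close s c N Nn w kN HkN ltac:(lra) Hsn Hc Hsc Hin HNn) as [Bs Bsc].
  fold S0 in Bs, Bsc.
  assert (Hxi := node_bounds n x i (proj1 Hf) ltac:(lia)).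
  destruct (HWb (lam k) (x i) ltac:(lra) Hxi) as [_ HWi]. fold w in HWi.
  rewrite Hphin, (Hph _ Hxi) by lia.
  replace (s * gv n x (lamn k) i - c * W (lam k) (x i))
    with (s * (gv n x (lamn k) i - W (lam k) (x i)) + (s - c) * W (lam k) (x i)) by ring.
  apply Rle_trans with (S0 * (Y * Xi) + S0 ^ 3 * B * (Z * Xi)); [|right; unfold Xi; ring].
  apply Rabs_add_le; rewrite Rabs_mult.
  - apply Rle_trans with (S0 * w * Rabs (gv n x (lamn k) i - W (lam k) (x i))).
    + apply Rmult_le_compat_r; [apply Rabs_pos | exact Bs].
    + rewrite Rmult_assoc. apply Rmult_le_compat_l; [lra|]. specialize (close i ltac:(lia)). lra.
  - apply Rle_trans with (S0 ^ 3 * w ^ 3 * Rabs (Nn - N) * Rabs (W (lam k) (x i))).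
    + apply Rmult_le_compat_r; [apply Rabs_pos | exact Bsc].
    + replace (S0 ^ 3 * w ^ 3 * Rabs (Nn - N) * Rabs (W (lam k) (x i)))
        with (S0 ^ 3 * (w * Rabs (W (lam k) (x i)) * (w ^ 2 * Rabs (Nn - N)))) by ring.
      rewrite (Rmult_assoc (S0 ^ 3) B). apply Rmult_le_compat_l; [lra|].
      apply Rmult_le_compat; auto.
      * apply Rmult_le_pos; [lra | apply Rabs_pos].
      * apply Rmult_le_pos; [apply pow2_ge_0 | apply Rabs_pos].
Qed.

(** * From the eigensystem to the shooting function *)

Section Translation.

Variables mu sigma kappa : R -> R.
Hypothesis Hsig : forall t, inside t -> 0 < sigma t ^ 2.
Hypothesis Hca : forall t, inside t -> ca P t = mu t / sigma t ^ 2.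
Hypothesis Hcq : forall t, inside t -> cq P t = / sigma t ^ 2.
Hypothesis Hcc : forall t, inside t -> cc P t = kappa t / sigma t ^ 2.

(** Extended to the line, an eigenfunction has two-sided derivatives at the ends,
    where they coincide with the one-sided ones. *)
Lemma eigenpair_solves lam ph : eigenpair l r rho mu sigma kappa lam ph ->
  exists y z, solves lam (fun _ => 0) y z /\ (forall t, inside t -> y t = ph t) /\ y r = 0 /\
    residual lam y z = 0.
Proof.
  intros [_ [d1 [d2 [D1 [D2 [D3 [Hode [Hl Hr]]]]]]]].
  assert (Hlr := lft_rgt P).
  destruct (C_on_extend 2 ph l r Hlr) as [F [F1 [F2 F3]]].
  { exists d1. split; auto. exists d2. split; auto. }
  assert (G1 : forall t, segment l r t -> F 1%nat t = d1 t).
  { intros t Ht. apply (D_in_unique ph (F 1%nat) d1 l r t Hlr Ht); [|now apply D1].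
    refine (D_in_congr (F 0%nat) ph (F 1%nat) (F 1%nat) l r t F3 _ Ht _); [reflexivity|]. apply is_derive_D_in, F1. lia. }
  assert (G2 : forall t, segment l r t -> F 2%nat t = d2 t).
  { intros t Ht. apply (D_in_unique d1 (F 2%nat) d2 l r t Hlr Ht); [|now apply D2].
    refine (D_in_congr (F 1%nat) d1 (F 2%nat) (F 2%nat) l r t G1 _ Ht _); [reflexivity|]. apply is_derive_D_in, F1. lia. }
  assert (ode : forall t, inside t ->
    F 2%nat t - (- 2 * ca P t * F 1%nat t + 2 * (cc P t - lam * cq P t) * F 0%nat t) = 0).
  { apply (zero_at_ends (fun t => F 2%nat t - (- 2 * ca P t * F 1%nat t + 2 * (cc P t - lam * cq P t) * F 0%nat t)) l r Hlr).
    - intros t. assert (h0 := F2 0%nat ltac:(lia)). assert (h1 := F2 1%nat ltac:(lia)). assert (h2 := F2 2%nat ltac:(lia)).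
      assert (h3 := ca_cont P). assert (h4 := cq_cont P). assert (h5 := cc_cont P).
      repeat cont_step.
    - intros t Ht. assert (Hi : inside t) by (split; lra). assert (E := Hode t Ht).
      rewrite (G1 t Hi), (G2 t Hi), (F3 t Hi), (Hca t Hi), (Hcq t Hi), (Hcc t Hi).
      assert (Hs := Hsig t Hi). set (s := sigma t ^ 2) in *.
      replace (d2 t) with (2 / s * (/ 2 * s * d2 t)) by (field; lra).
      replace (/ 2 * s * d2 t) with (kappa t * ph t - lam * ph t - mu t * d1 t) by lra. field. lra. }
  exists (F 0%nat), (F 1%nat). split; [|split; [|split]].
  - intros t Ht. split; [apply F1; lia|]. eapply is_derive_eq; [apply F1; lia|]. specialize (ode t Ht). lra.
  - exact F3.
  - rewrite F3; [exact Hr | apply inside_rgt].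
  - unfold residual. rewrite (kap0_eq sigma kappa Hsig Hcq Hcc), (F3 l (inside_lft)), (G1 l (inside_lft)). exact Hl.
Qed.

Lemma shoot_eigenpair lam : -1 <= lam -> shoot lam = 0 ->
  eigenpair l r rho mu sigma kappa lam (W lam).
Proof.
  intros Hl Hs. assert (Hlr := lft_rgt P). split.
  - destruct (W_positive) as [M [HM H]]. assert (Ho := om_ge1 lam Hl).
    set (e := Rmin (r - l) (/ (2 * (M * om lam)))).
    assert (HMo : 1 <= M * om lam) by nra.
    assert (He : 0 < e) by (apply Rmin_pos; [lra | apply Rinv_0_lt_compat; lra]).
    assert (He1 : e <= r - l) by apply Rmin_l.
    assert (He2 : e <= / (2 * (M * om lam))) by apply Rmin_r.
    exists (r - e). split; [split; lra|]. apply Rgt_not_eq, (H lam (r - e) Hl); [split; lra | lra |].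
    replace (r - (r - e)) with e by ring.
    apply Rle_lt_trans with (M * om lam * / (2 * (M * om lam))); [apply Rmult_le_compat_l; lra|].
    replace (M * om lam * / (2 * (M * om lam))) with (/ 2) by (field; lra). lra.
  - exists (V lam), (W2 lam). split; [|split; [|split; [|split; [|split]]]].
    + intros t _. apply is_derive_D_in, W_derive.
    + intros t _. apply is_derive_D_in, V_derive2.
    + intros t Ht. apply continuous_continue_in.
      exact (continuous_of_derive _ _ _ (W2_derive lam t Ht)).
    + intros t Ht. assert (Hi : inside t) by (split; lra). unfold W2, cb.
      rewrite (Hca t Hi), (Hcq t Hi), (Hcc t Hi). assert (E := Hsig t Hi). set (s := sigma t ^ 2) in *. field. lra.
    + unfold shoot, residual in Hs. rewrite (kap0_eq sigma kappa Hsig Hcq Hcc) in Hs. exact Hs.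
    + apply W_rgt.
Qed.

Lemma speed_integral_inner f u v : (forall t, inside t -> f t = u t * v t) ->
  speed_integral l r rho mu sigma f = inner u v.
Proof.
  intros Hf. assert (Hlr := lft_rgt P). unfold speed_integral, inner.
  rewrite (Hf l (inside_lft)). f_equal. apply RInt_congr_open; [lra|].
  intros t Ht. assert (Hi : inside t) by (split; lra).
  rewrite (Hf t Hi). unfold speed_density, scale_density, scale.
  assert (E : RInt (fun y => 2 * mu y / sigma y ^ 2) l t = 2 * RInt (ca P) l t).
  { rewrite <- (Rplus_0_l (2 * _)). rewrite <- (Rplus_0_l (RInt (fun y => 2 * mu y / sigma y ^ 2) l t)).
    assert (E0 : RInt (fun _ => 0) l t = 0).
    { rewrite RInt_const. unfold scal; simpl. unfold mult; simpl. ring. }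
    rewrite <- E0 at 2. rewrite <- RInt_lin.
    - rewrite Rplus_0_l. apply RInt_congr_open; [lra|]. intros s Hs.
      rewrite Rplus_0_l, Hca by (split; lra). unfold Rdiv. apply Rmult_assoc.
    - apply ex_RInt_const.
    - apply ex_RInt_segment; [lra|]. intros; apply ca_cont. }
  rewrite E, (Hcq t Hi), exp_Ropp. assert (Hs := Hsig t Hi).
  set (s := sigma t ^ 2) in *. set (z := exp _). assert (Hz : 0 < z) by apply exp_pos. field. lra.
Qed.

Lemma inner_ext u v u' v' : (forall t, inside t -> u t * v t = u' t * v' t) -> inner u v = inner u' v'.
Proof.
  intros H. assert (Hlr := lft_rgt P). unfold inner. rewrite (H l (inside_lft)). f_equal. apply RInt_congr_open; [lra|].
  intros t Ht. f_equal. apply H. split; lra.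
Qed.

(** The eigenvalues are nonnegative by the energy identity, and the eigenfunctions
    are multiples of [W] by uniqueness for the initial value problem at the right
    end. *)
Lemma spectrum_of_eigensystem lam phi : eigensystem l r rho mu sigma kappa lam phi ->
  spectrum lam /\ forall k, (1 <= k)%nat -> exists c,
    (forall t, inside t -> phi k t = c * W (lam k) t) /\
    c ^ 2 * inner (W (lam k)) (W (lam k)) = 1.
Proof.
  intros [H1 [H2 [H3 H4]]]. assert (Hlr := lft_rgt P). assert (Hrho := stick_pos P).
  assert (norm1 : forall k, (1 <= k)%nat -> inner (phi k) (phi k) = 1).
  { intros k Hk. rewrite <- (speed_integral_inner (fun t => phi k t * phi k t)) by auto.
    rewrite H4 by auto. destruct (Nat.eq_dec k k); [auto | contradiction]. }
  assert (main : forall k, (1 <= k)%nat -> 0 <= lam k /\ shoot (lam k) = 0 /\ exists c,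
    (forall t, inside t -> phi k t = c * W (lam k) t)).
  { intros k Hk. destruct (eigenpair_solves _ _ (H1 k Hk)) as [y [z [Hs [Hy [Hr Hres]]]]].
    assert (Hin : inner y y = 1).
    { rewrite <- (norm1 k Hk). apply inner_ext. intros t Ht. now rewrite !Hy. }
    assert (E := energy_identity (lam k) y z Hs Hr). rewrite Hin, Hres in E.
    destruct (solves_cont _ _ _ Hs) as [cy cz].
    assert (I0 : 0 * (r - l) <= RInt (fun x => scale x * z x ^ 2 + 2 * scale x * cc P x * y x ^ 2) l r).
    { apply RInt_ge_cst; [lra| |].
      - apply ex_RInt_segment; [lra|]. intros x Hx. assert (C1 := scale_cont). assert (C2 := cc_cont P).
        repeat cont_step.
      - intros x Hx. assert (S1 := scale_pos x). assert (S2 := cc_nonneg P x Hx).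
        apply Rplus_le_le_0_compat.
        + apply Rmult_le_pos; [lra | apply pow2_ge_0].
        + apply Rmult_le_pos; [|apply pow2_ge_0]. apply Rmult_le_pos; lra. }
    assert (K0 := kap0_nonneg).
    assert (K1 : 0 <= kap0 * y l ^ 2 / rho).
    { apply Rmult_le_pos; [apply Rmult_le_pos; [auto | apply pow2_ge_0] | left; now apply Rinv_0_lt_compat]. }
    assert (Hl0 : 0 <= lam k).
    { unfold Rdiv in E at 2. rewrite Rmult_0_l, Rmult_0_l in E. lra. }
    assert (U := solves_unique (lam k) y z ltac:(lra) Hs Hr).
    split; [auto|]. split.
    - destruct (U l (inside_lft)) as [U1 U2]. unfold residual in Hres. rewrite U1, U2 in Hres.
      assert (Hz : - z r <> 0).
      { intros Ez. assert (E0 : inner y y = inner (fun _ => 0) (fun _ => 0)).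
        { apply inner_ext. intros t Ht. destruct (U t Ht) as [-> _]. rewrite Ez. ring. }
        rewrite Hin in E0. unfold inner in E0.
        rewrite (RInt_congr _ (fun _ => 0)), RInt_const in E0 by (intros; ring).
        unfold scal in E0; simpl in E0. unfold mult in E0; simpl in E0. unfold Rdiv in E0.
        rewrite !Rmult_0_r, Rmult_0_l in E0. lra. }
      apply (Rmult_eq_reg_l (- z r)); auto. unfold shoot, residual. rewrite Rmult_0_r. lra.
    - exists (- z r). intros t Ht. rewrite <- Hy by auto. now apply U. }
  split.
  - split; [|split].
    + intros k Hk. destruct (main k Hk) as [m1 [m2 _]]. auto.
    + exact H2.
    + intros nu Hnu Hs. destruct (H3 nu _ (shoot_eigenpair nu Hnu Hs)) as [k [c [Hk [E _]]]]. now exists k.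
  - intros k Hk. destruct (main k Hk) as [_ [_ [c Hc]]]. exists c. split; auto.
    rewrite <- (norm1 k Hk). assert (C1 := scale_cont). assert (C2 := cq_cont P). assert (C3 := W_cont (lam k)).
    rewrite (inner_ext (phi k) (phi k) (fun t => 0 + c ^ 2 * W (lam k) t) (W (lam k))).
    + unfold inner. rewrite (RInt_congr (fun x => 2 * scale x * cq P x * ((0 + c ^ 2 * W (lam k) x) * W (lam k) x))
        (fun x => 0 + c ^ 2 * (2 * scale x * cq P x * (W (lam k) x * W (lam k) x)))) by (intros; ring).
      rewrite (RInt_lin (fun _ => 0)).
      * rewrite RInt_const. unfold scal; simpl. unfold mult; simpl. field. lra.
      * apply ex_RInt_const.
      * apply ex_RInt_segment; [lra|]. intros; repeat cont_step.
    + intros t Ht. rewrite Hc by auto. ring.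
Qed.

End Translation.

End Sticky.

(** * The coefficients, the grid and the range of indices *)

Lemma quotient_derive2 (S S1 S2 F F1 F2 Q : R -> R) t :
  is_derive S t (S1 t) -> is_derive S1 t (S2 t) -> is_derive F t (F1 t) -> is_derive F1 t (F2 t) ->
  0 < S t -> (exists d, 0 < d /\ forall s, Rabs (s - t) < d -> Q s = / S s) ->
  let Q1 := fun s => - S1 s * (Q s * Q s) in
  let Q2 := fun s => - S2 s * (Q s * Q s) + - S1 s * (Q1 s * Q s + Q s * Q1 s) in
  is_derive (fun s => F s * Q s) t (F1 t * Q t + F t * Q1 t) /\
  is_derive (fun s => F1 s * Q s + F s * Q1 s) t (F2 t * Q t + 2 * (F1 t * Q1 t) + F t * Q2 t).
Proof.
  intros DS DS1 DF DF1 Hp [d [Hd HQ]] Q1 Q2.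
  assert (Qt : Q t = / S t) by (apply HQ; rewrite Rminus_diag, Rabs_R0; auto).
  assert (DQ : is_derive Q t (Q1 t)).
  { apply (is_derive_ext_loc (fun s => / S s)).
    - exists (mkposreal d Hd). intros s Hs. symmetry. apply HQ. exact Hs.
    - derive; [lra|]. unfold Q1. rewrite Qt. field. lra. }
  split.
  - derive. ring.
  - unfold Q1 at 1. derive. unfold Q2, Q1. ring.
Qed.

Lemma continuous_Rmax_cst (f : R -> R) m (t : R) : continuous f t -> continuous (fun s => Rmax (f s) m) t.
Proof.
  intros Hf%continuity_pt_filterlim. apply continuity_pt_filterlim. intros eps Heps.
  destruct (Hf eps Heps) as [d [Hd H]]. exists d. split; auto. intros s Hs. specialize (H s Hs).
  simpl in *. unfold Rdist in *. eapply Rle_lt_trans; [|exact H].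
  unfold Rmax. destruct (Rle_dec (f s) m), (Rle_dec (f t) m); unfold Rabs; repeat destruct (Rcase_abs _); lra.
Qed.

Lemma common_bound (L : list (R -> R)) u v : u <= v ->
  (forall f, In f L -> forall x, u <= x <= v -> continuous f x) ->
  exists K, 1 <= K /\ forall f, In f L -> forall x, u <= x <= v -> Rabs (f x) <= K.
Proof.
  intros Huv. induction L as [|f L IH]; intros H.
  - exists 1. split; [lra|]. intros f [].
  - destruct IH as [K1 [HK1 B1]]; [intros; apply H; [now right | auto]|].
    destruct (bounded_on_segment f u v Huv) as [K2 [HK2 B2]]; [intros; apply H; [now left | auto]|].
    exists (K1 + K2). split; [lra|]. intros g [<-|Hg] x Hx.
    + specialize (B2 x Hx). lra.
    + specialize (B1 g Hg x Hx). lra.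
Qed.

(** The quotients by [sigma^2] are made continuous on the whole line by bounding
    the extended [sigma^2] from below, which changes nothing near the interval. *)
Lemma problem_exists (l r rho : R) (mu sigma kappa : R -> R) : l < r -> 0 < rho ->
  C_on 3 (segment l r) mu -> C_on 4 (segment l r) (fun x => sigma x ^ 2) ->
  (forall x, segment l r x -> 0 < sigma x ^ 2) -> C_on 2 (segment l r) kappa ->
  (forall x, segment l r x -> 0 <= kappa x) ->
  exists P : sticky_problem, lft P = l /\ rgt P = r /\ stick P = rho /\
    forall t, segment l r t -> ca P t = mu t / sigma t ^ 2 /\ cq P t = / sigma t ^ 2 /\
      cc P t = kappa t / sigma t ^ 2.
Proof.
  intros Hlr Hrho Hmu Hsig Hpos Hkap Hk0.
  destruct (C_on_extend 2 mu l r Hlr (C_on_pred _ _ _ Hmu)) as [m [m1 [m2 m3]]].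
  destruct (C_on_extend 2 _ l r Hlr (C_on_pred _ _ _ (C_on_pred _ _ _ Hsig))) as [S [s1 [s2 s3]]].
  destruct (C_on_extend 2 kappa l r Hlr Hkap) as [k [k1 [k2 k3]]].
  destruct (positive_on_segment (S 0%nat) l r) as [s0 [Hs0 Hs]]; [lra | intros; apply s2; lia | |].
  { intros x Hx. rewrite s3 by exact Hx. now apply Hpos. }
  set (Q := fun t => / Rmax (S 0%nat t) (s0 / 2)).
  assert (cQ : forall t, continuous Q t).
  { intros t. unfold Q. apply (continuous_comp (fun s => Rmax (S 0%nat s) (s0 / 2)) Rinv).
    - apply continuous_Rmax_cst, s2. lia.
    - apply continuity_pt_filterlim. apply (continuity_pt_inv id); [apply derivable_continuous_pt, derivable_pt_id|].
      unfold id. generalize (Rmax_r (S 0%nat t) (s0 / 2)). lra. }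
  assert (locQ : forall t, l <= t <= r -> exists d, 0 < d /\ forall s, Rabs (s - t) < d -> Q s = / S 0%nat s).
  { intros t Ht. assert (C := s2 0%nat ltac:(lia) t). apply continuity_pt_filterlim in C.
    destruct (C (s0 / 2) ltac:(lra)) as [d [Hd HC]]. exists d. split; auto. intros s Hs'.
    unfold Q. f_equal. apply Rmax_left. specialize (Hs t Ht).
    destruct (Req_dec s t) as [->|n]; [lra|].
    specialize (HC s). simpl in HC. unfold Rdist in HC.
    assert (E : Rabs (S 0%nat s - S 0%nat t) < s0 / 2).
    { apply HC. split; auto. split; [exact I | auto]. }
    apply Rabs_lt_between in E. lra. }
  assert (valQ : forall t, l <= t <= r -> Q t = / sigma t ^ 2).
  { intros t Ht. destruct (locQ t Ht) as [d [Hd H]]. rewrite H by (rewrite Rminus_diag, Rabs_R0; auto).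
    now rewrite s3. }
  set (Q1 := fun s => - S 1%nat s * (Q s * Q s)).
  set (Q2 := fun s => - S 2%nat s * (Q s * Q s) + - S 1%nat s * (Q1 s * Q s + Q s * Q1 s)).
  assert (c0 := cQ).
  assert (csn : forall j, (j <= 2)%nat -> forall t, continuous (S j) t) by exact s2.
  assert (cs1 : forall t, continuous (S 1%nat) t) by (apply s2; lia).
  assert (cs2 : forall t, continuous (S 2%nat) t) by (apply s2; lia).
  assert (cneg : forall f : R -> R, (forall t, continuous f t) -> forall t, continuous (fun s => - f s) t).
  { intros f Hf t. apply (continuous_opp f). apply Hf. }
  assert (cQ1 : forall t, continuous Q1 t).
  { intros t. unfold Q1. apply continuous_mul; [now apply cneg | apply continuous_mul; auto]. }
  assert (cQ2 : forall t, continuous Q2 t).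
  { intros t. unfold Q2. apply continuous_add; apply continuous_mul; try (now apply cneg).
    - apply continuous_mul; auto.
    - apply continuous_add; apply continuous_mul; auto. }
  assert (quot : forall F : nat -> R -> R, (forall j, (j < 2)%nat -> forall x, is_derive (F j) x (F (Datatypes.S j) x)) ->
    (forall j, (j <= 2)%nat -> forall x, continuous (F j) x) ->
    let g := fun s => F 0%nat s * Q s in
    let g1 := fun s => F 1%nat s * Q s + F 0%nat s * Q1 s in
    let g2 := fun s => F 2%nat s * Q s + 2 * (F 1%nat s * Q1 s) + F 0%nat s * Q2 s in
    (forall t, continuous g t) /\ (forall t, continuous g1 t) /\ (forall t, continuous g2 t) /\
    (forall t, l <= t <= r -> is_derive g t (g1 t)) /\ (forall t, l <= t <= r -> is_derive g1 t (g2 t))).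
  { intros F DF CF g g1 g2.
    assert (f0 : forall t, continuous (F 0%nat) t) by (apply CF; lia).
    assert (f1 : forall t, continuous (F 1%nat) t) by (apply CF; lia).
    assert (f2 : forall t, continuous (F 2%nat) t) by (apply CF; lia).
    split; [|split; [|split]].
    - intros t. unfold g. apply continuous_mul; auto.
    - intros t. unfold g1. apply continuous_add; apply continuous_mul; auto.
    - intros t. unfold g2. apply continuous_add; [apply continuous_add|]; apply continuous_mul; auto.
      + apply continuous_cst.
      + apply continuous_mul; auto.
    - assert (D : forall t, l <= t <= r -> is_derive g t (g1 t) /\ is_derive g1 t (g2 t)).
      { intros t Ht. apply (quotient_derive2 (S 0%nat) (S 1%nat) (S 2%nat) (F 0%nat) (F 1%nat) (F 2%nat) Q t).
        - apply s1; lia.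
        - apply s1; lia.
        - apply DF; lia.
        - apply DF; lia.
        - specialize (Hs t Ht). lra.
        - apply locQ, Ht. }
      split; intros t Ht; now apply D. }
  set (one := fun (j : nat) (_ : R) => match j with O => 1 | _ => 0 end).
  destruct (quot m m1 m2) as [a1 [a2 [a3 [a4 a5]]]].
  destruct (quot one) as [q1 [q2 [q3 [q4 q5]]]].
  { intros [|j] _ x; apply derive_cst. }
  { intros [|j] _ x; apply continuous_cst. }
  destruct (quot k k1 k2) as [c1 [c2 [c3 [c4 c5]]]].
  set (A := fun s => m 0%nat s * Q s) in *. set (A1 := fun s => m 1%nat s * Q s + _) in *.
  set (A2 := fun s => m 2%nat s * Q s + _ + _) in *.
  set (O := fun s => one 0%nat s * Q s) in *. set (O1 := fun s => one 1%nat s * Q s + _) in *.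
  set (O2 := fun s => one 2%nat s * Q s + _ + _) in *.
  set (C := fun s => k 0%nat s * Q s) in *. set (C1 := fun s => k 1%nat s * Q s + _) in *.
  set (C2 := fun s => k 2%nat s * Q s + _ + _) in *.
  destruct (common_bound (A :: A1 :: A2 :: O :: O1 :: O2 :: C :: C1 :: C2 :: nil) l r) as [K [HK B]]; [lra| |].
  { intros f Hf x _. simpl in Hf. destruct Hf as [<-|[<-|[<-|[<-|[<-|[<-|[<-|[<-|[<-|[]]]]]]]]]]; auto. }
  destruct (positive_on_segment O l r) as [q0 [Hq0 Hq]]; [lra | auto | |].
  { intros t Ht. unfold O, one. rewrite Rmult_1_l, valQ by auto. apply Rinv_0_lt_compat, Hpos, Ht. }
  assert (Cn : forall t, l <= t <= r -> 0 <= C t).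
  { intros t Ht. unfold C. rewrite k3, valQ by exact Ht. apply Rmult_le_pos; [apply Hk0, Ht|].
    left. apply Rinv_0_lt_compat, Hpos, Ht. }
  unshelve eexists (StickyProblem l r rho A A1 A2 O O1 O2 C C1 C2 K q0
    Hlr Hrho a1 q1 c1 a4 a5 q4 q5 c4 c5 HK _ _ _ _ _ _ _ _ _ Hq0 Hq Cn);
    try (intros t Ht; apply B; [simpl; tauto | exact Ht]).
  simpl. split; [auto|]. split; [auto|]. split; [auto|]. intros t Ht.
  unfold A, O, C, one. rewrite m3, k3, valQ by exact Ht. split; [reflexivity|]. split; [apply Rmult_1_l | reflexivity].
Qed.

Lemma step_le_max_step x n i : (i <= n)%nat -> step_plus x i <= max_step x n.
Proof. intros Hi. apply MaxRlist_P1, in_map, in_seq. lia. Qed.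

Lemma grid_error_le x n phin ph B :
  (forall i, (i <= n)%nat -> Rabs (phin i - ph (x i)) <= B) -> grid_error x n phin ph <= B.
Proof.
  intros H. unfold grid_error. set (L := map _ _).
  assert (Hin : In (MaxRlist L) L).
  { apply MaxRlist_P2. exists (Rabs (phin 0%nat - ph (x 0%nat))). apply (in_map (fun i => Rabs (phin i - ph (x i)))), in_seq. lia. }
  apply in_map_iff in Hin. destruct Hin as [i [E Hi]]. rewrite <- E. apply H. apply in_seq in Hi. lia.
Qed.

Lemma grid_length l r n x h : is_grid l r n x -> (forall i, (i <= n)%nat -> step_plus x i <= h) ->
  r - l <= INR (S n) * h.
Proof.
  intros [H0 [H1 _]] Hs. rewrite <- H0, <- H1.
  assert (main : forall m, (m <= S n)%nat -> x m - x 0%nat <= INR m * h).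
  { induction m as [|m IH]; intros Hm; [simpl; lra|]. specialize (IH ltac:(lia)). specialize (Hs m ltac:(lia)).
    unfold step_plus in Hs. rewrite S_INR. lra. }
  now apply main.
Qed.

(** In this form the range of the index enters all estimates. *)
Lemma index_bound k h : 0 < h -> INR k <= Rpower h (- (1 / 5)) -> INR k ^ 5 * h <= 1.
Proof.
  intros Hh Hk. assert (E : Rpower h (- (1 / 5)) ^ 5 = / h).
  { rewrite <- Rpower_pow by apply exp_pos. rewrite Rpower_mult.
    replace (- (1 / 5) * INR 5) with (Ropp 1) by (simpl; field).
    rewrite Rpower_Ropp, Rpower_1; auto. }
  apply Rle_trans with (/ h * h); [|right; field; lra].
  apply Rmult_le_compat_r; [lra|]. rewrite <- E. apply pow_incr. split; [apply pos_INR | auto].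
Qed.

Theorem proposition4p3
  (l r rho : R) (mu sigma kappa : R -> R)
  (Hlr : l < r) (Hrho : 0 < rho)
  (Hmu : C_on 3 (segment l r) mu)
  (Hsigma : C_on 4 (segment l r) (fun x => sigma x ^ 2))
  (Hsigma_pos : forall x, segment l r x -> 0 < sigma x ^ 2)
  (Hkappa : C_on 2 (segment l r) kappa)
  (Hkappa_nonneg : forall x, segment l r x -> 0 <= kappa x)
  (lam : nat -> R) (phi : nat -> R -> R)
  (Heig : eigensystem l r rho mu sigma kappa lam phi)
  (x : nat -> nat -> R) (C0 : R)
  (Hgrid : forall n, is_grid l r n (x n))
  (Hmesh : is_lim_seq (fun n => max_step (x n) n) 0)
  (Hratio : forall n, max_step (x n) n / min_step (x n) n <= C0)
  (sch : scheme) :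
  exists delta0 C : R, 0 < delta0 /\ 0 < C /\
    forall n : nat, 0 < max_step (x n) n < delta0 ->
    forall (lamn : nat -> R) (phin : nat -> nat -> R),
      discrete_eigensystem (x n) sch rho mu sigma kappa n phi lamn phin ->
    forall k : nat, (1 <= k)%nat ->
      INR k <= Rpower (max_step (x n) n) (- (1 / 5)) ->
      grid_error (x n) n (phin k) (phi k)
      <= C * INR k ^ 4 * max_step (x n) n ^ scheme_order sch.
Proof.
  destruct (problem_exists l r rho mu sigma kappa Hlr Hrho Hmu Hsigma Hsigma_pos Hkappa Hkappa_nonneg)
    as [P [El [Er [Erho Hcoef]]]].
  subst l r rho.
  assert (Hca : forall t, inside P t -> ca P t = mu t / sigma t ^ 2) by (intros; now apply Hcoef).
  assert (Hcq : forall t, inside P t -> cq P t = / sigma t ^ 2) by (intros; now apply Hcoef).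
  assert (Hcc : forall t, inside P t -> cc P t = kappa t / sigma t ^ 2) by (intros; now apply Hcoef).
  destruct (spectrum_of_eigensystem P mu sigma kappa Hsigma_pos Hca Hcq Hcc lam phi Heig) as [Hsp Hphi].
  destruct (eigenfunction_error P lam Hsp) as [C [h0 [HC [Hh0 Herr]]]].
  assert (HK := bnd_ge1 P).
  set (e := Rmin 1 (rgt P - lft P)).
  assert (He : 0 < e <= 1) by (split; [apply Rmin_pos; lra | apply Rmin_l]).
  assert (He' : e <= rgt P - lft P) by apply Rmin_r.
  exists (Rmin (Rmin h0 (/ (2 * bnd P))) (e ^ 2)), C.
  split; [|split; [lra|]].
  { repeat apply Rmin_pos; try lra; [apply Rinv_0_lt_compat; lra | apply pow_lt; lra]. }
  intros n [Hh Hh'] lamn phin [Hd1 [Hd2 [Hd3 Hd4]]] k Hk Hkh.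
  set (h := max_step (x n) n) in *.
  assert (A1 : h <= h0) by (left; eapply Rlt_le_trans; [exact Hh' | eapply Rle_trans; [apply Rmin_l | apply Rmin_l]]).
  assert (A2 : h <= / (2 * bnd P)) by (left; eapply Rlt_le_trans; [exact Hh' | eapply Rle_trans; [apply Rmin_l | apply Rmin_r]]).
  assert (A3 : h <= e ^ 2) by (left; eapply Rlt_le_trans; [exact Hh' | apply Rmin_r]).
  assert (HKh := bnd_mesh_small P h Hh A2).
  assert (Hf : fine_grid P n (x n) h) by (split; [apply Hgrid | intros i Hi; now apply step_le_max_step]).
  apply index_bound in Hkh; auto.
  assert (Hk1 : 1 <= INR k) by (apply le_INR in Hk; exact Hk).
  (* h k^2 is at most r - l, and r - l is at most (n + 1) h *)
  assert (Hkn : (k <= S n)%nat).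
  { apply INR_le. assert (L := grid_length _ _ n (x n) h (Hgrid n) (proj2 Hf)).
    assert (M := mesh_small e h (INR k) He (conj Hh A3) Hk1 Hkh).
    apply Rmult_le_reg_r with h; auto. assert (INR k * h <= h * INR k ^ 2); [|lra].
    replace (h * INR k ^ 2) with (INR k * (INR k * h)) by ring.
    rewrite <- (Rmult_1_l (INR k * h)) at 1. apply Rmult_le_compat_r; [apply Rmult_le_pos; lra | auto]. }
  destruct (Hphi k Hk) as [c [Hc1 Hc2]].
  apply grid_error_le. intros i Hi.
  apply (Herr n (x n) h sch mu sigma lamn phin) with (c := c); auto.
  - intros t Ht. split; [now apply Hsigma_pos | now split; [apply Hca | apply Hcq]].
  - split; [|split; auto]. intros j Hj.
    destruct (discrete_shooting P mu sigma kappa Hsigma_pos Hca Hcq Hcc n (x n) h sch (lamn j) (phin j) Hf HKh (Hd1 j Hj))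
      as [s [s1 [s2 s3]]]. now exists s.
Qed.
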